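(* Let $d\ge1$ and $0<q<p\leq 1$. Then, for every corridor-type strongly admissible enumeration $\mathcal{U}$ of $\mathscr{H}_d$ (as constructed in the context), the partial sum operators $S_R=S_R^{\mathcal{U}}$ satisfy $$\sup_{R\in \mathbb{N}} \sup\Big\{ \|S_R f\|_{B^{d(\frac 1p-1)}_{p,q}(\mathbb{R}^d)} :\ \|f\|_{B^{d(\frac 1p-1)}_{p,q}(\mathbb{R}^d)} \le 1\Big\} =\infty.$$
   Context: $B^s_{p,q}(\mathbb{R}^d)$ is the usual inhomogeneous Besov space. Haar system: let $h^{(0)}=\mathbf{1}_{[0,1)}$ and $h^{(1)}=\mathbf{1}_{[0,1/2)}-\mathbf{1}_{[1/2,1)}$ on $\mathbb{R}$. For $\epsilon\in\{0,1\}^d$, $k\in\mathbb{N}_0$, $\mu\in\mathbb{Z}^d$ put $h^{\epsilon}_{k,\mu}(x)=\prod_{i=1}^d h^{(\epsilon_i)}(2^kx_i-\mu_i)$. With $\Upsilon=\{0,1\}^d\setminus\{\vec 0\}$, $\mathscr{H}_d=\{h^{\vec 0}_{0,\mu}\}_{\mu\in\mathbb{Z}^d}\cup\{h^{\epsilon}_{k,\mu}: k\in\mathbb{N}_0,\mu\in\mathbb{Z}^d,\epsilon\in\Upsilon\}$; $2^k$ is the Haar frequency of $h^\epsilon_{k,\mu}$. For an enumeration $\mathcal{U}=\{u_n\}_{n\ge1}$, $u_n=h^{\epsilon(n)}_{k(n),\mu(n)}$, put $S_R^{\mathcal{U}}f=\sum_{n=1}^R2^{k(n)d}\langle f,u_n\rangle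 u_n$. Corridor-type enumerations: let $\mathfrak{Q}_5$ be the family of cubes $\prod_{i=1}^d[10\kappa_i-5,10\kappa_i+5)$, $\kappa\in\mathbb{Z}^d$. Let $\mathfrak{Q}_5(\ell)$, $\ell=0,1,2,\dots$, be a strictly increasing sequence of finite subfamilies of $\mathfrak{Q}_5$ with $\mathfrak{Q}_5(0)=\{[-5,5)^d\}$, such that for each cube in $\mathfrak{Q}_5(\ell)$ all its neighboring cubes in $\mathfrak{Q}_5$ belong to $\mathfrak{Q}_5(\ell+1)$, and $\mathfrak{Q}_5=\bigcup_\ell\mathfrak{Q}_5(\ell)$. (Example: $\mathfrak{Q}_5(\ell)$ is the set of all $Q\in\mathfrak{Q}_5$ with $Q\subset[-10\ell-5,10\ell+5)^d$.) Let $\mathcal{A}_0=[-5,5)^d$ and, for $\ell\ge1$, let $\mathcal{A}_\ell$ be the union of the cubes in $\mathfrak{Q}_5(\ell)\setminus\mathfrak{Q}_5(\ell-1)$. Let $\mathscr{H}(\ell,0)$ be the set of characteristic functions of dyadic unit cubes contained in $\mathcal{A}_\ell$; for $k\ge1$ let $\mathscr{H}(\ell,k)$ be the set of Haar functions of mean value $0$ and Haar frequency $2^{k-1}$ whose support has interior contained in $\mathcal{A}_\ell$. Then $\mathscr{H}_d=\bigcup_{\ell,k\ge0}\mathscr{H}(\ell,k)$, all sets being finite. The enumeration $\mathcal{U}$ lists the blocks $\mathscr{H}(\ell,k)$ successively in increasing order of $m=\ell+k$ and, for the same $m$, in increasing order of $k$, that is $\mathscr{H}(m,0),\mathscr{H}(m-1,1),\dots,\mathscr{H}(0,m)$;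 within each block the order is arbitrary. *)

(* Defs.v *)
From HB Require Import structures.
From mathcomp Require Import all_boot all_order all_algebra.
From mathcomp Require Import all_classical all_reals all_analysis.
From mathcomp Require Import complex.

Set Implicit Arguments.
Unset Strict Implicit.
Unset Printing Implicit Defensive.
Import Order.TTheory GRing.Theory Num.Theory.
Import numFieldNormedType.Exports.

Local Open Scope classical_set_scope.
Local Open Scope ring_scope.
Local Open Scope complex_scope.

Definition measure_rV_display : measure_display -> measure_display.
Proof. exact. Qed.

Section measurable_rV.
Context {R : realType} (n : nat).

Let coord : 'I_n -> 'rV[R]_n -> measurableTypeR R := fun i x => x ord0 i.

Let rV_set0 : g_sigma_preimage coord set0.
Proof. exact: sigma_algebra0. Qed.

Let rV_setC A : g_sigma_preimage coord A -> g_sigma_preimage coord (~` A).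
Proof. exact: sigma_algebraC. Qed.

Let rV_bigcup (F : _^nat) : (forall i, g_sigma_preimage coord (F i)) ->
  g_sigma_preimage coord (\bigcup_i (F i)).
Proof. exact: sigma_algebra_bigcup. Qed.

HB.instance Definition _ := @isMeasurable.Build
  (measure_rV_display (sigma_display (@ocitv R)))
  'rV[R]_n (g_sigma_preimage coord) rV_set0 rV_setC rV_bigcup.

End measurable_rV.

Section lebesgue_rV.
Context {R : realType}.

Lemma measurable_coord n (i : 'I_n) :
  measurable_fun [set: 'rV[R]_n] (fun x => x ord0 i : measurableTypeR R).
Proof.
move=> _ Y mY; rewrite setTI; apply: sub_sigma_algebra => /=.
rewrite -bigcup_seq/=; exists i => /=; first by rewrite mem_index_enum.
by exists Y => //; rewrite setTI.
Qed.

Lemma measurable_fun_rV d (T : measurableType d) n (f : T -> 'rV[R]_n) :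
  (forall i, measurable_fun [set: T]
     (fun t => f t ord0 i : measurableTypeR R)) ->
  measurable_fun [set: T] f.
Proof.
move=> mf _ Y mY; rewrite setTI.
suff : g_sigma_preimage
    (fun i (x : T) => f x ord0 i : measurableTypeR R) `<=` measurable.
  apply; rewrite (@g_sigma_preimage_comp _ _ _ _
    (fun i (x : 'rV[R]_n) => x ord0 i : measurableTypeR R) _ f).
  by exists Y => //; rewrite setTI.
apply: smallest_sub; first exact: sigma_algebra_measurable.
rewrite -bigcup_seq; apply: bigcup_sub => i _ A [B mB <-].
exact: mf.
Qed.

Definition rV_cons n (xv : measurableTypeR R * 'rV[R]_n) : 'rV[R]_n.+1 :=
  \row_(i < n.+1) oapp (xv.2 ord0) xv.1 (unlift ord0 i).

Definition rV_uncons n (x : 'rV[R]_n.+1) : measurableTypeR R * 'rV[R]_n :=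
  (x ord0 ord0, \row_(j < n) x ord0 (lift ord0 j)).

Lemma rV_consK n : cancel (@rV_cons n) (@rV_uncons n).
Proof.
case=> x v; rewrite /rV_uncons /rV_cons !mxE unlift_none /=; congr (_, _).
by apply/rowP => j; rewrite !mxE liftK.
Qed.

Lemma measurable_rV_cons n : measurable_fun setT (@rV_cons n).
Proof.
apply: measurable_fun_rV => i.
case: (unliftP ord0 i) => [j|] ->.
- rewrite (_ : (fun t => _) =
    (fun x : 'rV[R]_n => x ord0 j : measurableTypeR R) \o snd).
    exact: measurableT_comp (measurable_coord j) measurable_snd.
  by apply/funext => t; rewrite /rV_cons mxE liftK.
- rewrite (_ : (fun t => _) = fst); first exact: measurable_fst.
  by apply/funext => t; rewrite /rV_cons mxE unlift_none.
Qed.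

Lemma measurable_rV_uncons n : measurable_fun setT (@rV_uncons n).
Proof.
apply: measurable_fun_pair; first exact: measurable_coord.
apply: measurable_fun_rV => i.
rewrite (_ : (fun t => _) =
  (fun x : 'rV[R]_n.+1 => x ord0 (lift ord0 i) : measurableTypeR R)).
  exact: measurable_coord.
by apply/funext => t; rewrite mxE.
Qed.

Section cons_measure.
Variables (n : nat) (m : {sigma_finite_measure set 'rV[R]_n -> \bar R}).

Definition cons_measure : set 'rV[R]_n.+1 -> \bar R :=
  pushforward (@lebesgue_measure R \x m)%E (@rV_cons n).

Let mcons := @measurable_rV_cons n.

Let cons_measure0 : cons_measure set0 = 0%E.
Proof. by rewrite /cons_measure /pushforward preimage_set0 measure0. Qed.

Let cons_measure_ge0 A : (0 <= cons_measure A)%E.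
Proof. exact: measure_ge0. Qed.

Let cons_measure_sigma_additive : semi_sigma_additive cons_measure.
Proof. exact: measure_semi_sigma_additive. Qed.

HB.instance Definition _ := isMeasure.Build _ _ _ cons_measure
  cons_measure0 cons_measure_ge0 cons_measure_sigma_additive.

Let cons_measure_sigma_finite : sigma_finite setT cons_measure.
Proof.
have /sigma_finiteP[F [TF ndF Foo]] := sigma_finiteT (@lebesgue_measure R).
have /sigma_finiteP[G [TG ndG Goo]] := sigma_finiteT m.
have mFG k : measurable (F k `*` G k).
  by have [? _] := Foo k; have [? _] := Goo k; exact: measurableX.
exists (fun k => @rV_uncons n @^-1` (F k `*` G k)).
  apply/esym; rewrite -subTset => x _.
  have [i _ Fi] : (\bigcup_k F k) (rV_uncons x).1 by rewrite -TF.
  have [j _ Gj] : (\bigcup_k G k) (rV_uncons x).2 by rewrite -TG.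
  exists (maxn i j) => //; split.
  - by move: Fi; exact/subsetPset/ndF/leq_maxl.
  - by move: Gj; exact/subsetPset/ndG/leq_maxr.
move=> k; split.
  by rewrite -[X in measurable X]setTI; exact: measurable_rV_uncons.
have [? ?] := Foo k; have [? ?] := Goo k.
rewrite /cons_measure /pushforward -comp_preimage.
rewrite (_ : _ \o _ = id) ?preimage_id; last exact/funext/rV_consK.
by rewrite product_measure1E// lte_mul_pinfty// ge0_fin_numE.
Qed.

HB.instance Definition _ := Measure_isSigmaFinite.Build _ _ _ cons_measure
  cons_measure_sigma_finite.

End cons_measure.

(* Lebesgue measure on R^n: the image of the product of [lebesgue_measure] and
   Lebesgue measure on R^(n-1) under the identification [rV_cons]. *)
Fixpoint lebesgue_rV n : {sigma_finite_measure set 'rV[R]_n -> \bar R} :=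
  if n is n'.+1 then cons_measure (lebesgue_rV n') else \d_(0 : 'rV[R]_0).

End lebesgue_rV.

Section distributions.
Context {R : realType} (d : nat).
Local Notation E := 'rV[R]_d.
Local Notation mu := (@lebesgue_rV R d).

Definition dotp (x y : E) : R := \sum_(i < d) x ord0 i * y ord0 i.

Definition enorm (x : E) : R := Num.sqrt (dotp x x).

Definition cintegrable (f : E -> R[i]) : Prop :=
  mu.-integrable setT (fun x => (complex.Re (f x))%:E) /\
  mu.-integrable setT (fun x => (complex.Im (f x))%:E).

Definition cintegral (f : E -> R[i]) : R[i] :=
  (\int[mu]_x complex.Re (f x))%R +i* (\int[mu]_x complex.Im (f x))%R.

(* Iterated partial derivatives along the coordinate directions listed in s;
   a multi-index alpha corresponds to a list of length |alpha|. *)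
Definition pderiv (s : seq 'I_d) (f : E -> R) : E -> R :=
  foldr (fun i g => 'D_(delta_mx ord0 i : E) g) f s.

Definition smooth (f : E -> R) : Prop :=
  forall s x, differentiable (pderiv s f) x.

Definition cpderiv (s : seq 'I_d) (f : E -> R[i]) (x : E) : R[i] :=
  pderiv s (fun y => complex.Re (f y)) x +i*
  pderiv s (fun y => complex.Im (f y)) x.

Definition schwartz (f : E -> R[i]) : Prop :=
  [/\ smooth (fun x => complex.Re (f x)),
      smooth (fun x => complex.Im (f x)) &
      forall (N : nat) (s : seq 'I_d), exists M : R, forall x,
        (1 + enorm x) ^+ N * Normc.normc (cpderiv s f x) <= M].

(* A distribution is a functional on test functions; only its values on
   Schwartz functions matter.  Continuity on the Schwartz space is expressed
   by |T f| <= C * sup_(|alpha| <= N, x) (1 + |x|)^N |d^alpha f(x)|. *)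
Definition tempered (T : (E -> R[i]) -> R[i]) : Prop :=
  (forall (a : R[i]) f g, schwartz f -> schwartz g ->
     T (fun x => a * f x + g x) = a * T f + T g) /\
  (exists (C : R) (N : nat), forall f, schwartz f -> forall M : R,
     (forall s : seq 'I_d, (size s <= N)%N -> forall x,
        (1 + enorm x) ^+ N * Normc.normc (cpderiv s f x) <= M) ->
     Normc.normc (T f) <= C * M).

Definition regular_distribution (f : E -> R[i]) : (E -> R[i]) -> R[i] :=
  fun g => cintegral (fun x => f x * g x).

(* Generator of a smooth inhomogeneous dyadic resolution of unity. *)
Definition lp_cutoff (phi0 : E -> R) : Prop :=
  [/\ smooth phi0, forall xi, enorm xi <= 1 -> phi0 xi = 1 &
      forall xi, 2 <= enorm xi -> phi0 xi = 0].

Definition lp_multiplier (phi0 : E -> R) (j : nat) (xi : E) : R :=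
  if j is j'.+1 then phi0 (2^-1 ^+ j *: xi) - phi0 (2^-1 ^+ j' *: xi)
  else phi0 xi.

(* Inverse Fourier transform, with kernel e^(2 pi i x.xi). *)
Definition inv_fourier (g : E -> R) (x : E) : R[i] :=
  cintegral (fun xi =>
    (g xi)%:C * (cos (2 * pi * dotp x xi) +i* sin (2 * pi * dotp x xi))).

(* The smooth function F^-1 (phi_j F T) = (F^-1 phi_j) * T. *)
Definition lp_piece (phi0 : E -> R) (T : (E -> R[i]) -> R[i]) (j : nat)
    (x : E) : R[i] :=
  T (fun y => inv_fourier (lp_multiplier phi0 j) (x - y)).

Definition besov_norm (phi0 : E -> R) (s p q : R) (T : (E -> R[i]) -> R[i]) :
    \bar R :=
  ((\sum_(0 <= j <oo)
     ((2 `^ (j%:R * s))%:E *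
      Lnorm mu p%:E (fun x => (Normc.normc (lp_piece phi0 T j x))%:E)) `^ q)
   `^ q^-1)%E.

Definition besov_unit_ball (phi0 : E -> R) (s p q : R) :
    set ((E -> R[i]) -> R[i]) :=
  [set T | tempered T /\ (besov_norm phi0 s p q T <= 1)%E].

(* For q <= p <= 1 and s = d (1/p - 1), every element of B^s_(p,q) is an
   integrable function: B^s_(p,q) embeds into B^0_(1,q), hence into L^1.  This
   gives the unit ball as a set of functions, on which the Haar coefficients
   are plain integrals. *)
Definition besov_unit_ball_L1 (phi0 : E -> R) (s p q : R) : set (E -> R[i]) :=
  [set f | cintegrable f /\
           besov_unit_ball phi0 s p q (regular_distribution f)].

Definition haar1 (e : bool) : R -> R :=
  if e then \1_`[0, 2^-1[ \- \1_`[2^-1, 1[ else \1_`[0, 1[.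

End distributions.

(* The index (eps, k, mu) of h^eps_(k,mu). *)
Record haar_index (d : nat) := HaarIndex {
  haar_eps : {ffun 'I_d -> bool};
  haar_freq : nat;
  haar_shift : 'rV[int]_d }.

Section haar.
Context {R : realType} (d : nat).
Local Notation E := 'rV[R]_d.

Definition haar (a : haar_index d) (x : E) : R :=
  \prod_(i < d) haar1 (haar_eps a i)
    (2 ^+ haar_freq a * x ord0 i - (haar_shift a ord0 i)%:~R).

(* Upsilon: the eps different from the zero vector. *)
Definition haar_mean_zero (a : haar_index d) : Prop :=
  exists i, haar_eps a i.

(* Distinct indices give distinct Haar functions, so the Haar system is
   represented by its set of indices. *)
Definition haar_system : set (haar_index d) :=
  [set a | haar_mean_zero a \/ haar_freq a = 0%N].

Definition haar_partial_sum (u : nat -> haar_index d) (N : nat)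
    (f : E -> R[i]) (x : E) : R[i] :=
  \sum_(n < N) (2 ^+ (haar_freq (u n) * d))%:C *
    cintegral (fun y => f y * (haar (u n) y)%:C) * (haar (u n) x)%:C.

(* The cubes of the family Q_5, indexed by kappa in Z^d. *)
Definition cube5 (kappa : 'rV[int]_d) : set E :=
  [set x | forall i, 10 * (kappa ord0 i)%:~R - 5 <= x ord0 i
                     < 10 * (kappa ord0 i)%:~R + 5].

(* Neighboring cubes are those whose closures meet (corners included). *)
Definition neighbor5 (kappa kappa' : 'rV[int]_d) : Prop :=
  kappa <> kappa' /\ closure (cube5 kappa) `&` closure (cube5 kappa') !=set0.

(* Q l is the set of indices of the cubes of Q_5(l). *)
Definition corridor_family (Q : nat -> set 'rV[int]_d) : Prop :=
  [/\ Q 0%N = [set 0],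
      forall l, finite_set (Q l),
      forall l, Q l `<` Q l.+1,
      forall l kappa kappa', Q l kappa -> neighbor5 kappa kappa' ->
        Q l.+1 kappa' &
      \bigcup_l Q l = setT].

Definition corridor (Q : nat -> set 'rV[int]_d) (l : nat) : set E :=
  if l is l'.+1 then \bigcup_(kappa in Q l `\` Q l') cube5 kappa
  else cube5 0.

Definition haar_block (Q : nat -> set 'rV[int]_d) (l k : nat) :
    set (haar_index d) :=
  if k is k'.+1 then
    [set a | [/\ haar_mean_zero a, haar_freq a = k' &
                 (closure [set x | haar a x != 0])° `<=` corridor Q l]]
  else
    [set a | [/\ ~ haar_mean_zero a, haar_freq a = 0%N &
                 [set x | haar a x = 1] `<=` corridor Q l]].

End haar.

(* [u n] is the index of u_(n+1). *)
Definition corridor_enumeration (R : realType) (d : nat)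
    (u : nat -> haar_index d) : Prop :=
  set_bij setT (@haar_system d) u /\
  exists Q, @corridor_family R d Q /\
    forall l k l' k' n n',
      @haar_block R d Q l k (u n) -> @haar_block R d Q l' k' (u n') ->
      (l + k < l' + k')%N \/ (l + k = l' + k')%N /\ (k < k')%N ->
      (n < n')%N.

(* Main.v *)
Require Import Defs.
From mathcomp Require Import all_boot all_order all_algebra.
From mathcomp Require Import all_classical all_reals all_analysis measurable_realfun.
From mathcomp Require Import complex ring lra zify.

(** Why the partial sums are unbounded.

    Write s = d (1/p - 1).  At this critical smoothness the j-th term of the
    Besov norm does not change when a function is dilated by 2^j with its
    integral preserved (critical_Lnorm).  A bump that is the kernel of a
    Littlewood-Paley operator of high frequency 2^J therefore has norm about 1
    whatever J is, and a sum of M such bumps has norm at most C M^(1/p): its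
    Fourier transform is carried by one dyadic annulus, so that only three terms
    of the norm are nonzero, and each is p-subadditive (besov_upper).

    The partial sum operator can spread these M bumps over M different
    frequencies.  Fix m > M.  For l < M choose a cube of the l-th corridor and
    put the l-th bump close to the midpoint of a dyadic cube of side 2^(-k_l) in
    it, where k_l = m - l - 1.  The Haar functions of frequency 2^(k_l)
    supported by this dyadic cube lie in the block with indices l and k_l + 1,
    and l + (k_l + 1) = m for every l.  Let N be the first length at which the
    partial sum contains all of them.  As J tends to infinity the bump shrinks
    to a point, and the Haar coefficients converge (haar_coef_center):
    - a Haar function of frequency below 2^(k_l) is constant near that point,
      and the bump has integral zero, so the coefficient tends to 0;
    - a Haar function of frequency above 2^(k_l) whose support touches that
      point belongs to a block of the l-th corridor with index sum larger than
      m, and is listed only after the N-th one;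
    - a Haar function of frequency 2^(k_l) carried by the dyadic cube in
      question has a jump at its midpoint, and its coefficient tends to a number
      which depends on the type epsilon but not on l.
    Hence the partial sum converges to a sum over l of one and the same finite
    combination of Haar functions, placed at the frequency 2^(k_l)
    (partial_sum_selection).  Its Littlewood-Paley piece of frequency 2^(k_l),
    rescaled, is a fixed profile plus the contributions of the other cubes,
    whose distance after the rescaling is at least of order 2^(k_l); these tend
    to 0 as m grows (piece_limit).  By Fatou's lemma M different terms of the
    Besov norm of the partial sum are bounded below (besov_terms_lower), so that
    the norm is at least c M^(1/q).  The quotient M^(1/q - 1/p) is unbounded
    because q < p.

    It remains to know that the profile is not almost everywhere 0.  The bumps
    are moved away from the midpoint by t 2^(-J) in one coordinate direction;
    if the coefficient of the Haar function which oscillates only in this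
    direction vanished for every t, a function of t would be invariant under
    halving, hence constant on each half-line, and this contradicts its limits
    at both infinities (central_coef_unit_neq0).  The Fourier transform of the
    profile at a unit vector is then a nonzero multiple of that coefficient
    (limit_piece_gt0).

    Fourier inversion is used in the form: the Fourier transform of the inverse
    transform of a test function is the same function times a constant that
    does not depend on it (inversion), and this constant is not 0
    (cst_inv_neq0). *)

Set Implicit Arguments.
Unset Strict Implicit.
Unset Printing Implicit Defensive.
Import Order.TTheory GRing.Theory Num.Theory.
Import numFieldNormedType.Exports.
Local Open Scope classical_set_scope.
Local Open Scope ring_scope.
Local Open Scope complex_scope.
Local Notation Re := complex.Re.
Local Notation Im := complex.Im.
Local Notation normc := Normc.normc.

(** * Integration over R^d *)

Section onedim.
Context {R : realType}.
Local Notation leb := (@lebesgue_measure R).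

(** Uniqueness of Lebesgue measure: it is c times its image under x |-> a + c x,
    because the two agree on intervals. *)
Lemma ge0_integral_affine (a c : R) (G : R -> \bar R) : 0 < c ->
  measurable_fun [set: R] G -> (forall x, 0 <= G x)%E ->
  (\int[leb]_x G x = c%:E * \int[leb]_x G (a + c * x)%R)%E.
Proof.
move=> c0 mG G0.
pose phi (x : R) : measurableTypeR R := a + c * x.
have mphi : measurable_fun [set: measurableTypeR R] phi.
  by apply: measurable_funD => //; apply: measurable_funM.
(* the image of Lebesgue measure under the affine map, scaled by c *)
pose m := mscale (NngNum (ltW c0)) (pushforward leb phi).
transitivity (\int[m mphi]_x G x)%E.
  apply: eq_measure_integral => A mA _.
  apply: lebesgue_measure_unique => // _ [[u v]] _ <-.
  rewrite [RHS](_ : _ = c%:E * leb (phi @^-1` `]u, v]%classic))%E//.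
  have -> : phi @^-1` `]u, v] = [set` `](u - a) / c, (v - a) / c]].
    apply/seteqP; split => x /=; rewrite !in_itv/= /phi ltr_pdivrMr// ler_pdivlMr//;
      by rewrite ltrBlDl lerBrDl mulrC.
  rewrite !lebesgue_measure_itv/= !lte_fin ltr_pM2r ?invr_gt0// ltrD2r.
  case: ifPn => _; last by rewrite mule0.
  by rewrite -!EFinB -EFinM -mulrBl; congr EFin; field; rewrite gt_eqF.
rewrite ge0_integral_mscale//=.
by rewrite ge0_integral_pushforward.
Qed.

Lemma integral_oneDsqrV : (\int[leb]_x ((1 + x ^+ 2)^-1)%:E < +oo)%E.
Proof.
pose f (x : R) : \bar R := ((1 + x ^+ 2)^-1)%:E.
have h : (\int[leb]_(x in `[0%R, +oo[) f x = (pi / 2)%:E)%E by exact: integral0y_oneDsqr.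
have mf : measurable_fun [set: R] f.
  apply/measurable_EFinP; apply: continuous_measurable_fun.
  exact: continuous_oneDsqrV.
have f0 x : (0 <= f x)%E by rewrite lee_fin invr_ge0 addr_ge0// sqr_ge0.
have h2 : (\int[leb]_(x in `]-oo, 0%R]) f x = (pi / 2)%:E)%E.
  rewrite -h ge0_integration_by_substitution0//.
  by apply: eq_integral => x _; rewrite /f sqrrN.
have -> : [set: R] = `]-oo, 0%R]%classic `|` `[0%R, +oo[%classic.
  apply/seteqP; split => x //= _; rewrite !in_itv/= andbT.
  by case: (leP x 0) => h0; [left|right; exact: ltW].
have -> : `]-oo, 0%R]%classic `|` `[0%R, +oo[%classic = `]-oo, 0%R]%classic `|` `]0%R, +oo[%classic :> set R.
  apply/seteqP; split => x /=; rewrite !in_itv/= !andbT.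
    by move=> _; case: (leP x 0); [left|right].
  by case=> [?|/ltW ?]; [left|right].
rewrite ge0_integral_setU//=; last 3 first.
- exact: measurable_funTS.
- by move=> x _; exact: f0.
- by apply/disj_setPS => x /= []; rewrite !in_itv/= andbT => h0 /(le_lt_trans h0); rewrite ltxx.
rewrite h2; apply: (@le_lt_trans _ _ ((pi/2)%:E + (pi/2)%:E)%E); last by rewrite -EFinD ltry.
rewrite leeD2l// -h; apply: ge0_subset_integral => //=.
  exact: measurable_funTS.
  by move=> x _; exact: f0.
by move=> x /=; rewrite !in_itv/= !andbT; exact: ltW.
Qed.

End onedim.

Section rVmeas.
Context {R : realType}.
Local Notation leb := (@lebesgue_measure R).
Local Notation lrv n := (@lebesgue_rV R n).

Lemma ge0_integral_rVS n (F : 'rV[R]_n.+1 -> \bar R) :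
  measurable_fun setT F -> (forall x, 0 <= F x)%E ->
  (\int[lrv n.+1]_x F x = \int[leb]_x \int[lrv n]_v F (rV_cons (x, v)))%E.
Proof.
move=> mF F0.
have mc := @measurable_rV_cons R n.
rewrite [LHS](_ : _ = \int[pushforward (leb \x (lrv n))%E (@rV_cons R n)]_x F x)%E//.
rewrite ge0_integral_pushforward// preimage_setT fubini_tonelli1//.
all: by [exact: measurableT_comp | move=> *; exact: F0].
Qed.

Lemma integral_rVS n (F : 'rV[R]_n.+1 -> \bar R) : measurable_fun setT F ->
  (leb \x lrv n)%E.-integrable setT (F \o @rV_cons R n) ->
  (lrv n.+1).-integrable setT F /\
  (\int[lrv n.+1]_x F x = \int[(leb \x lrv n)]_z F (rV_cons z))%E.
Proof.
move=> mF iF; have mc := @measurable_rV_cons R n.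
split; first exact: (integrable_pushforward mc).
rewrite [LHS](_ : _ = \int[pushforward (leb \x (lrv n))%E (@rV_cons R n)]_x F x)%E//.
by rewrite (integral_pushforward mc)// preimage_setT.
Qed.

Lemma integrable_tensor2 d1 d2 (T1 : measurableType d1) (T2 : measurableType d2)
   (m1 : {sigma_finite_measure set T1 -> \bar R})
   (m2 : {sigma_finite_measure set T2 -> \bar R}) (f : T1 -> R) (g : T2 -> R) :
  m1.-integrable setT (EFin \o f) -> m2.-integrable setT (EFin \o g) ->
  (m1 \x m2)%E.-integrable setT (fun z => (f z.1 * g z.2)%:E) /\
  (\int[m1 \x m2]_z (f z.1 * g z.2)%:E =
    ((\int[m1]_x f x) * (\int[m2]_y g y))%R%:E)%E.
Proof.
move=> fi gi.
have [/measurable_EFinP mf fy] := integrableP _ _ _ fi.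
have [/measurable_EFinP mg gy] := integrableP _ _ _ gi.
have mfg : measurable_fun setT (fun z : T1 * T2 => (f z.1 * g z.2)%:E).
  apply/measurable_EFinP; apply: measurable_funM.
    exact: measurableT_comp mf measurable_fst.
  exact: measurableT_comp mg measurable_snd.
have ifg : (m1 \x m2)%E.-integrable setT (fun z => (f z.1 * g z.2)%:E).
  apply/integrable12ltyP => //=.
  under eq_integral => x _.
    under eq_integral => y _ do rewrite normrM EFinM.
    rewrite ge0_integralZl//; last exact/measurable_EFinP/measurableT_comp.
    over.
  rewrite ge0_integralZr//=; last 2 first.
  - exact/measurable_EFinP/measurableT_comp.
  - exact: integral_ge0.
  by rewrite lte_mul_pinfty// ?integral_ge0// ge0_fin_numE ?integral_ge0.
split=> //.
rewrite -(integral12_prod_meas1 ifg)/fubini_F/=.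
under eq_integral => x _.
  under eq_integral => y _ do rewrite EFinM.
  rewrite integralZl// -[X in (_ * X)%E]fineK; last exact: integrable_fin_num.
  over.
rewrite integralZr//= EFinM; congr (_ * _)%E.
by rewrite /Rintegral fineK//; exact: integrable_fin_num.
Qed.

(** Every explicit integral over R^d below is a product of one-variable integrals;
    induction on the dimension through the coordinates (first, others). *)
Lemma integral_tensor n (f : 'I_n -> R -> R) :
  (forall i, leb.-integrable setT (EFin \o f i)) ->
  (lrv n).-integrable setT (fun x => (\prod_i f i (x ord0 i))%:E) /\
  \int[lrv n]_x (\prod_i f i (x ord0 i)) = \prod_i \int[leb]_t f i t.
Proof.
elim: n f => [|n ih] f fi.
  have l0 : lrv 0 setT = 1%E by apply: (@diracT _ _ R).

  have -> : (fun x : 'rV[R]_0 => (\prod_i f i (x ord0 i))%:E) = cst 1%E.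
    by apply/funext => x; rewrite big_ord0.
  split.
    apply/integrableP; split => //=.
    by rewrite integral_cst//= normr1 mul1e l0 ltry.
  rewrite big_ord0; under eq_Rintegral do rewrite big_ord0.
  by rewrite Rintegral_cst// mul1r; exact: (congr1 fine l0).
have [ih1 ih2] := ih (fun i => f (lift ord0 i)) (fun i => fi _).
have [it1 it2] := integrable_tensor2 (fi ord0) ih1.
have mF : measurable_fun setT (fun x : 'rV[R]_n.+1 => (\prod_i f i (x ord0 i))%:E).
  apply/measurable_EFinP; apply: measurable_prod => i _.
  have /integrableP[/measurable_EFinP mf _] := fi i.
  exact: measurableT_comp mf (measurable_coord i).
have E : (fun x : 'rV[R]_n.+1 => (\prod_i f i (x ord0 i))%:E) \o @rV_cons R n =
   (fun z => (f ord0 z.1 * \prod_(i < n) f (lift ord0 i) (z.2 ord0 i))%:E).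
  apply/funext => -[x v] /=; rewrite big_ord_recl mxE unlift_none/=; congr (_ * _)%:E.
  by apply: eq_bigr => i _; rewrite mxE liftK.
have [] := @integral_rVS n _ mF; first by rewrite E.
move=> h1 h2; split => //.
rewrite /Rintegral h2 [X in fine X](_ : _ =
    \int[(leb \x lrv n)]_z (f ord0 z.1 * \prod_(i < n) f (lift ord0 i) (z.2 ord0 i))%:E)%E.
  by rewrite it2/= ih2 big_ord_recl.
by rewrite -E.
Qed.

Lemma measurable_rV_affine n (a : 'rV[R]_n) (c : R) :
  measurable_fun [set: 'rV[R]_n] (fun x : 'rV[R]_n => a + c *: x : 'rV[R]_n).
Proof.
apply: measurable_fun_rV => i.
rewrite (_ : (fun t => _) = (fun x : 'rV[R]_n => a ord0 i + c * x ord0 i : measurableTypeR R)).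
  by apply: measurable_funD => //; apply: measurable_funM => //; exact: measurable_coord.
by apply/funext => x; rewrite !mxE.
Qed.

(** The dilation factor is one power of c for each coordinate. *)
Lemma ge0_integral_rV_affine n (a : 'rV[R]_n) c (F : 'rV[R]_n -> \bar R) : 0 < c ->
  measurable_fun setT F -> (forall x, 0 <= F x)%E ->
  (\int[lrv n]_x F x = (c ^+ n)%:E * \int[lrv n]_x F (a + c *: x)%R)%E.
Proof.
elim: n a F => [|n ih] a F c0 mF F0.
  rewrite mul1e; apply: eq_integral => x _; congr F.
  by apply/rowP => -[].
pose a' : 'rV[R]_n := \row_j a ord0 (lift ord0 j).
rewrite !ge0_integral_rVS//; last first.
  by apply: (measurableT_comp mF); exact: measurable_rV_affine.
have mFc : measurable_fun setT (F \o @rV_cons R n).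
  by apply: (measurableT_comp mF); exact: measurable_rV_cons.
have E (x : R) (v : 'rV[R]_n) : a + c *: rV_cons (x, v) =
   rV_cons (a ord0 ord0 + c * x, a' + c *: v).
  apply/rowP => i; rewrite !mxE/=; case: (unliftP ord0 i) => [j|] -> /=;
  by rewrite ?mxE.
rewrite (ge0_integral_affine (a ord0 ord0) c0); last 2 first.
- exact: (measurable_fun_fubini_tonelli_F (F \o @rV_cons R n) mFc (fun z => F0 _)).
- by move=> x; exact: integral_ge0.
have ih' (y : R) : (\int[lrv n]_v F (rV_cons (y, v)) =
    (c ^+ n)%:E * \int[lrv n]_v F (rV_cons (y, (a' + c *: v)%R)))%E.
  apply: (ih a' (fun v => F (rV_cons (y, v)))) => //.
  apply: (measurableT_comp mFc).
  by apply: measurable_fun_pair; [exact: measurable_cst|exact: measurable_id].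
under eq_integral do rewrite ih'.
rewrite ge0_integralZl//=; last 3 first.
- have m1 : measurable_fun setT (fun z : measurableTypeR R * 'rV[R]_n =>
      F (rV_cons (a ord0 ord0 + c * z.1, a' + c *: z.2))).
    under eq_fun do rewrite -E.
    exact: (measurableT_comp mF
      (measurableT_comp (measurable_rV_affine a c) (@measurable_rV_cons R n))).
  exact: (measurable_fun_fubini_tonelli_F _ m1 (fun z => F0 _)).
- by move=> x _; exact: integral_ge0.
- by rewrite lee_fin exprn_ge0// ltW.
rewrite muleA -EFinM -exprS; congr (_ * _)%E.
by apply: eq_integral => x _; apply: eq_integral => v _; rewrite E.
Qed.

End rVmeas.

(** * Measurability by dyadic rounding *)

Section grid.
Context {R : realType} {d : nat}.
Local Notation E := 'rV[R]_d.

Definition grid_index (n : nat) (x : E) : 'rV[int]_d :=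
  \row_i Num.floor (2 ^+ n * x ord0 i).

(** Rounding of the coordinates down to multiples of 2^-n.  It takes countably many
    values, each on a measurable set, so composing any function with it gives a
    measurable function. *)
Definition grid (n : nat) (x : E) : E :=
  \row_i ((Num.floor (2 ^+ n * x ord0 i))%:~R / 2 ^+ n).

Lemma measurable_grid_comp n (f : E -> R) :
  measurable_fun [set: E] (fun x => f (grid n x)).
Proof.
move=> _ Y mY; rewrite setTI.
have -> : (fun x => f (grid n x)) @^-1` Y = \bigcup_(z : 'rV[int]_d)
   (if f (\row_i ((z ord0 i)%:~R / 2 ^+ n)) \in Y then grid_index n @^-1` [set z] else set0).
  apply/seteqP; split => x /=.
    move=> Yx; exists (grid_index n x) => //.
    have -> : \row_i ((grid_index n x ord0 i)%:~R / 2 ^+ n) = grid n x.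
      by apply/rowP => i; rewrite !mxE.
    by rewrite mem_set.
  case=> z _; case: ifPn => // /set_mem Yz /= xz.
  suff -> : grid n x = \row_i ((z ord0 i)%:~R / 2 ^+ n) by [].
  by rewrite -xz; apply/rowP => i; rewrite !mxE.
apply: countable_bigcupT_measurable; first exact: countableP.
move=> z; case: ifPn => // _.
have -> : grid_index n @^-1` [set z] = \bigcap_(i in [set: 'I_d])
    ((fun x : E => x ord0 i) @^-1` [set t | (z ord0 i)%:~R <= 2 ^+ n * t < (z ord0 i + 1)%:~R]).
  apply/seteqP; split => x /=.
    by move=> <- i _ /=; rewrite mxE; exact: floor_itv.
  move=> h; apply/rowP => i; rewrite mxE; apply/floor_def.
  by have := h i I.
apply: fin_bigcap_measurable => // i _.
rewrite -[X in measurable X]setTI; apply: measurable_coord => //.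
have -> : [set t : R | (z ord0 i)%:~R <= 2 ^+ n * t < (z ord0 i + 1)%:~R] =
   `[(z ord0 i)%:~R / 2 ^+ n, (z ord0 i + 1)%:~R / 2 ^+ n[%classic.
  apply/seteqP; split => t /=; rewrite in_itv/= ler_pdivrMr ?exprn_gt0// ltr_pdivlMr ?exprn_gt0//;
   by rewrite mulrC.
exact: measurable_itv.
Qed.

Lemma grid_le n (x : E) i : `|x ord0 i - grid n x ord0 i| <= (2 ^+ n)^-1.
Proof.
rewrite mxE; have /andP[h1 h2] := floor_itv (2 ^+ n * x ord0 i).
have p0 : 0 < 2 ^+ n :> R by rewrite exprn_gt0.
rewrite ler_norml; apply/andP; split.
  apply: (@le_trans _ _ 0); first by rewrite oppr_le0 invr_ge0 ltW.
  by rewrite subr_ge0 ler_pdivrMr// [x ord0 i * _]mulrC.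
rewrite lerBlDr -[X in _ <= X + _]mul1r -mulrDl ler_pdivlMr// [x ord0 i * _]mulrC addrC.
by rewrite intrD in h2; exact: ltW.
Qed.

Lemma cvg_inv2n : (fun n : nat => (2 ^+ n)^-1 : R) @ \oo --> (0 : R).
Proof.
rewrite (_ : (fun _ => _) = (fun n => (2^-1 : R) ^+ n)).
  by apply: cvg_expr; rewrite ger0_norm ?invr_ge0// invf_lt1// ltr1n.
by apply/funext => n; rewrite exprVn.
Qed.

Lemma cvg_rV (u : nat -> E) (x : E) :
  (forall i, (fun n => u n ord0 i) @ \oo --> x ord0 i) -> u @ \oo --> x.
Proof.
move=> h; apply/cvg_ballP => e e0.
have H : \forall n \near \oo, forall j, ball (x ord0 j) e (u n ord0 j).
  by apply: filter_forall => j; have /cvg_ballP/(_ _ e0) := h j.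
by apply: filterS H => n Hn; split => // i j; rewrite ord1.
Qed.

Lemma grid_cvg_coord (x : E) i : (fun n => grid n x ord0 i) @ \oo --> x ord0 i.
Proof.
apply/subr_cvg0; apply/norm_cvg0P.
apply: (@squeeze_cvgr _ _ _ _ (cst 0) (fun n => (2 ^+ n)^-1)).
- by apply: nearW => n /=; rewrite normr_ge0/= distrC grid_le.
- exact: cvg_cst.
- exact: cvg_inv2n.
Qed.

Lemma grid_cvg (x : E) : (fun n => grid n x) @ \oo --> x.
Proof. by apply: cvg_rV => i; exact: grid_cvg_coord. Qed.

(** The sigma-algebra of R^d is generated by the coordinates.  To prove a function
    measurable for it, it is enough that the function is the pointwise limit of its
    values at the rounded points; continuous functions have this property. *)
Lemma measurable_grid_cvg (f : E -> R) :
  (forall x, (fun n => f (grid n x)) @ \oo --> f x) -> measurable_fun [set: E] f.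
Proof.
move=> h; apply: (@measurable_fun_cvg _ _ _ setT (fun n x => f (grid n x))) => // n.
exact: measurable_grid_comp.
Qed.

Lemma continuous_measurable_rV (f : E -> R) : continuous f -> measurable_fun [set: E] f.
Proof.
move=> cf; apply: measurable_grid_cvg => x.
by apply: continuous_cvg; [exact: cf|exact: grid_cvg].
Qed.

End grid.

(** * Complex numbers and complex-valued functions *)

Section complex_basics.
Context {R : realType}.
Implicit Types (x y z : R[i]).

Lemma Re_mul x y : Re (x * y) = Re x * Re y - Im x * Im y.
Proof. by case: x => a b; case: y => c e. Qed.
Lemma Im_mul x y : Im (x * y) = Re x * Im y + Im x * Re y.
Proof. by case: x => a b; case: y => c e. Qed.
Lemma Re_add x y : Re (x + y) = Re x + Re y. Proof. by case: x => a b; case: y => c e. Qed.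
Lemma Im_add x y : Im (x + y) = Im x + Im y. Proof. by case: x => a b; case: y => c e. Qed.
Lemma Re_opp x : Re (- x) = - Re x. Proof. by case: x. Qed.
Lemma Im_opp x : Im (- x) = - Im x. Proof. by case: x. Qed.

Lemma complex_eq x y : Re x = Re y -> Im x = Im y -> x = y.
Proof. by case: x; case: y => /= a b c e -> ->. Qed.

Lemma normc_ge0 z : 0 <= normc z.
Proof. by case: z => a b; exact: sqrtr_ge0. Qed.

Lemma normcReIm z : normc z = Num.sqrt (Re z ^+ 2 + Im z ^+ 2).
Proof. by case: z. Qed.

Lemma normc_real (a : R) : normc a%:C = `|a|.
Proof. by rewrite /= expr0n/= addr0 sqrtr_sqr. Qed.

Lemma Re_le_normc z : `|Re z| <= normc z.
Proof. by rewrite normcReIm -sqrtr_sqr ler_wsqrtr// lerDl sqr_ge0. Qed.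

Lemma Im_le_normc z : `|Im z| <= normc z.
Proof. by rewrite normcReIm -sqrtr_sqr ler_wsqrtr// lerDr sqr_ge0. Qed.

Lemma normc_le_ReIm z : normc z <= `|Re z| + `|Im z|.
Proof.
rewrite normcReIm -(ger0_norm (_ : 0 <= `|Re z| + `|Im z|)) ?addr_ge0//.
rewrite -sqrtr_sqr ler_wsqrtr// sqrrD -!normrX !(ger0_norm (sqr_ge0 _)).
by rewrite addrAC lerDl mulrn_wge0// mulr_ge0.
Qed.

Lemma normc_eq0 z : (normc z == 0) = (z == 0).
Proof.
apply/eqP/eqP => [|->]; first exact: Normc.eq0_normc.
by rewrite normcReIm/= expr0n/= addr0 sqrtr0.
Qed.

Lemma le_normc_sum (I : Type) (r : seq I) (P : pred I) (F : I -> R[i]) :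
  normc (\sum_(i <- r | P i) F i) <= \sum_(i <- r | P i) normc (F i).
Proof.
elim/big_ind2: _ => //; first by rewrite normc_real normr0.
by move=> x1 x2 y1 y2 h1 h2; apply: (le_trans (le_normcD _ _)); exact: lerD.
Qed.

(** The character of the real line with period 1. *)
Definition expi (t : R) : R[i] := cos (2 * pi * t) +i* sin (2 * pi * t).

Lemma expi0 : expi 0 = 1.
Proof. by rewrite /expi mulr0 cos0 sin0. Qed.

Lemma expiD s t : expi (s + t) = expi s * expi t.
Proof. by apply: complex_eq; rewrite ?Re_mul ?Im_mul/= mulrDr ?cosD ?sinD//; ring. Qed.

Lemma normc_expi t : normc (expi t) = 1.
Proof. by rewrite normcReIm/= cos2Dsin2 sqrtr1. Qed.

(** Convergence is tested on real and imaginary parts, where the limit theorems for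
    real sequences apply. *)
Definition ccvg (u : nat -> R[i]) (l : R[i]) : Prop :=
  ((fun n => Re (u n)) @ \oo --> Re l) /\ ((fun n => Im (u n)) @ \oo --> Im l).

Lemma ccvg_cst l : ccvg (fun=> l) l.
Proof. by split; exact: cvg_cst. Qed.

Lemma ccvgD u v a b : ccvg u a -> ccvg v b -> ccvg (fun n => u n + v n) (a + b).
Proof.
move=> [u1 u2] [v1 v2]; split.
  by under eq_fun do rewrite Re_add; rewrite Re_add; exact: cvgD.
by under eq_fun do rewrite Im_add; rewrite Im_add; exact: cvgD.
Qed.

Lemma ccvgM u v a b : ccvg u a -> ccvg v b -> ccvg (fun n => u n * v n) (a * b).
Proof.
move=> [u1 u2] [v1 v2]; split.
  by under eq_fun do rewrite Re_mul; rewrite Re_mul; apply: cvgB; exact: cvgM.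
by under eq_fun do rewrite Im_mul; rewrite Im_mul; apply: cvgD; exact: cvgM.
Qed.

Lemma ccvg_real (u : nat -> R) (l : R) : u @ \oo --> l -> ccvg (fun n => (u n)%:C) l%:C.
Proof. by move=> h; split => //=; exact: cvg_cst. Qed.

Lemma ccvg_sum (I : Type) (r : seq I) (u : I -> nat -> R[i]) (l : I -> R[i]) :
  (forall i, ccvg (u i) (l i)) ->
  ccvg (fun n => \sum_(i <- r) u i n) (\sum_(i <- r) l i).
Proof.
move=> h; elim: r => [|i r ih].
  by under [fun _ => _]eq_fun do rewrite big_nil; rewrite big_nil; exact: ccvg_cst.
by under [fun _ => _]eq_fun do rewrite big_cons; rewrite big_cons; exact: ccvgD.
Qed.

Lemma ccvg_unique u a b : ccvg u a -> ccvg u b -> a = b.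
Proof.
move=> [u1 u2] [v1 v2]; apply: complex_eq.
  by rewrite -(cvg_lim _ u1)// -(cvg_lim _ v1).
by rewrite -(cvg_lim _ u2)// -(cvg_lim _ v2).
Qed.

Lemma ccvg_normc u a : ccvg u a -> (fun n => normc (u n)) @ \oo --> normc a.
Proof.
move=> [u1 u2]; under eq_fun do rewrite normcReIm; rewrite normcReIm.
apply: continuous_cvg; first exact: sqrt_continuous.
by apply: cvgD; rewrite expr2; under eq_fun do rewrite expr2; exact: cvgM.
Qed.

Lemma ccvg0_normc u : (fun n => normc (u n)) @ \oo --> (0 : R) -> ccvg u 0.
Proof.
move=> h; split; apply/norm_cvg0P.
  apply: (@squeeze_cvgr _ _ _ _ (cst 0) (fun n => normc (u n))) => //; last exact: cvg_cst.
  by apply: nearW => n /=; rewrite normr_ge0 Re_le_normc.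
apply: (@squeeze_cvgr _ _ _ _ (cst 0) (fun n => normc (u n))) => //; last exact: cvg_cst.
by apply: nearW => n /=; rewrite normr_ge0 Im_le_normc.
Qed.

Lemma ccvg_expi (u : nat -> R) (l : R) : u @ \oo --> l -> ccvg (fun n => expi (u n)) (expi l).
Proof.
move=> h; have h2 : (fun n => 2 * pi * u n) @ \oo --> 2 * pi * l.
  by apply: cvgM => //; exact: cvg_cst.
split; rewrite /expi/=.
  by apply: continuous_cvg h2; exact: continuous_cos.
by apply: continuous_cvg h2; exact: continuous_sin.
Qed.

End complex_basics.

Section cmeasurable.
Context {R : realType}.

Section cmeas.
Context {dd} {T : measurableType dd}.
Implicit Types f g : T -> R[i].

Definition cmeas f := measurable_fun [set: T] (fun x => Re (f x)) /\
  measurable_fun [set: T] (fun x => Im (f x)).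

Lemma cmeas_cst a : cmeas (fun=> a).
Proof. by split; exact: measurable_cst. Qed.

Lemma cmeas_real (a : T -> R) : measurable_fun setT a -> cmeas (fun x => (a x)%:C).
Proof. by move=> h; split => //; exact: measurable_cst. Qed.

Lemma cmeasD f g : cmeas f -> cmeas g -> cmeas (fun x => f x + g x).
Proof.
move=> [f1 f2] [g1 g2]; split.
  by under eq_fun do rewrite Re_add; exact: measurable_funD.
by under eq_fun do rewrite Im_add; exact: measurable_funD.
Qed.

Lemma cmeasM f g : cmeas f -> cmeas g -> cmeas (fun x => f x * g x).
Proof.
move=> [f1 f2] [g1 g2]; split.
  by under eq_fun do rewrite Re_mul; apply: measurable_funB; exact: measurable_funM.
by under eq_fun do rewrite Im_mul; apply: measurable_funD; exact: measurable_funM.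
Qed.

Lemma cmeas_sum (I : Type) (r : seq I) (F : I -> T -> R[i]) :
  (forall i, cmeas (F i)) -> cmeas (fun x => \sum_(i <- r) F i x).
Proof.
move=> h; elim: r => [|i r ih].
  by under [fun _ => _]eq_fun do rewrite big_nil; exact: cmeas_cst.
by under [fun _ => _]eq_fun do rewrite big_cons; exact: cmeasD.
Qed.

Lemma cmeas_expi (a : T -> R) : measurable_fun setT a -> cmeas (fun x => expi (a x)).
Proof.
move=> h; have h2 : measurable_fun setT (fun x => 2 * pi * a x).
  by apply: measurable_funM => //; exact: measurable_cst.
split.
  apply: (measurableT_comp _ h2); apply: continuous_measurable_fun; exact: continuous_cos.
apply: (measurableT_comp _ h2); apply: continuous_measurable_fun; exact: continuous_sin.
Qed.

Lemma cmeas_normc f : cmeas f -> measurable_fun setT (fun x => normc (f x)).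
Proof.
move=> [f1 f2]; under eq_fun do rewrite normcReIm.
apply: (@measurableT_comp _ _ _ _ _ _ (@Num.sqrt R)).
  by apply: continuous_measurable_fun; exact: sqrt_continuous.
by apply: measurable_funD; apply: measurable_funX.
Qed.

Lemma cmeas_cvg (F : nat -> T -> R[i]) f : (forall n, cmeas (F n)) ->
  (forall x, ccvg (fun n => F n x) (f x)) -> cmeas f.
Proof.
move=> mF h; split.
  apply: (@measurable_fun_cvg _ _ _ setT (fun n x => Re (F n x))) => [n|x _].
    by case: (mF n).
  by case: (h x).
apply: (@measurable_fun_cvg _ _ _ setT (fun n x => Im (F n x))) => [n|x _].
  by case: (mF n).
by case: (h x).
Qed.
End cmeas.

Lemma cmeas_comp d1 d2 (T1 : measurableType d1) (T2 : measurableType d2)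
  (f : T2 -> R[i]) (g : T1 -> T2) : cmeas f -> measurable_fun setT g -> cmeas (f \o g).
Proof.
by move=> [f1 f2] mg; split; [exact: (measurableT_comp f1)|exact: (measurableT_comp f2)].
Qed.

Lemma cmeas_grid_cvg d (f : 'rV[R]_d -> R[i]) :
  (forall x, ccvg (fun n => f (grid n x)) (f x)) -> cmeas f.
Proof.
by move=> h; split; apply: measurable_grid_cvg => x; case: (h x).
Qed.

End cmeasurable.

(** * Integrals of complex-valued functions *)

Section cintegral_theory.
Context {R : realType} {d : nat}.
Local Notation E := 'rV[R]_d.
Local Notation mu := (@lebesgue_rV R d).
Local Notation intR := (fun B : E -> R => mu.-integrable [set: E] (EFin \o B)).
Implicit Types (f g : E -> R[i]) (B : E -> R).

(** The form in which integrability is carried around: an integrable majorant of the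
    modulus serves at the same time for dominated convergence, for Fubini and for
    norm estimates. *)
Definition cdom f B := [/\ cmeas f, intR B & forall x, normc (f x) <= B x].

Lemma integrable_dominated (h B : E -> R) : measurable_fun setT h -> intR B ->
  (forall x, `|h x| <= B x) -> intR h.
Proof.
move=> mh iB hB; apply: (le_integrable _ _ _ iB) => //.
  exact/measurable_EFinP.
move=> x _ /=; rewrite lee_fin (le_trans (hB x))//; exact: ler_norm.
Qed.

Lemma cdom_Re f B : cdom f B -> intR (fun x => Re (f x)).
Proof.
move=> [[m1 m2] iB h]; apply: (integrable_dominated m1 iB) => x.
exact: (le_trans (Re_le_normc _)).
Qed.

Lemma cdom_Im f B : cdom f B -> intR (fun x => Im (f x)).
Proof.
move=> [[m1 m2] iB h]; apply: (integrable_dominated m2 iB) => x.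
exact: (le_trans (Im_le_normc _)).
Qed.

Lemma cdom_cintegrable f B : cdom f B -> cintegrable f.
Proof. by move=> h; split; [exact: cdom_Re h|exact: cdom_Im h]. Qed.

Lemma cintegrable_meas f : cintegrable f -> cmeas f.
Proof.
by move=> [/integrableP[/measurable_EFinP m1 _] /integrableP[/measurable_EFinP m2 _]].
Qed.

(** The modulus of an integrable function is its own integrable majorant, since it
    is at most the sum of the moduli of the real and imaginary parts. *)
Lemma cintegrable_cdom f : cintegrable f -> cdom f (fun x => normc (f x)).
Proof.
move=> h; have mf := cintegrable_meas h; case: h => [i1 i2]; split => //.
have := integrableD measurableT (integrable_norm i1) (integrable_norm i2).
move=> h; apply: (le_integrable _ _ _ h) => //.
  exact/measurable_EFinP/cmeas_normc.
move=> x _ /=; rewrite lee_fin ger0_norm ?normc_ge0// ger0_norm ?addr_ge0//.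
exact: normc_le_ReIm.
Qed.

Lemma cintegrableD f g : cintegrable f -> cintegrable g ->
  cintegrable (fun x => f x + g x).
Proof.
move=> [f1 f2] [g1 g2]; split.
  apply: (eq_integrable measurableT _ _ _ (integrableD measurableT f1 g1)) => // x _ /=.
  by rewrite Re_add.
apply: (eq_integrable measurableT _ _ _ (integrableD measurableT f2 g2)) => // x _ /=.
by rewrite Im_add.
Qed.

Lemma cintegrable_bounded_mul (a : E -> R[i]) f (C : R) : cmeas a ->
  (forall x, normc (a x) <= C) -> cintegrable f -> cintegrable (fun x => a x * f x).
Proof.
move=> ma aC fi; have [mf iB _] := cintegrable_cdom fi.
apply: (@cdom_cintegrable _ (fun x => C * normc (f x))); split.
- exact: cmeasM.
- apply: (eq_integrable measurableT _ _ _ (integrableZl measurableT C iB)) => // x _ /=.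
- by move=> x; rewrite Normc.normcM ler_wpM2r// normc_ge0.
Qed.

Lemma cintegrableZ (a : R[i]) f : cintegrable f -> cintegrable (fun x => a * f x).
Proof.
by move=> fi; apply: (@cintegrable_bounded_mul (fun=> a) f (normc a)) => //; exact: cmeas_cst.
Qed.

Lemma cintegrable0 : cintegrable (fun _ : E => 0 : R[i]).
Proof. by split; exact: (integrable0). Qed.

Lemma cintegrable_sum (I : Type) (r : seq I) (F : I -> E -> R[i]) :
  (forall i, cintegrable (F i)) -> cintegrable (fun x => \sum_(i <- r) F i x).
Proof.
move=> h; elim: r => [|i r ih].
  by under [fun _ => _]eq_fun do rewrite big_nil; exact: cintegrable0.
by under [fun _ => _]eq_fun do rewrite big_cons; exact: cintegrableD.
Qed.

Lemma eq_cintegral f g : f =1 g -> cintegral f = cintegral g.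
Proof. by move=> /funext ->. Qed.

Lemma cintegralD f g : cintegrable f -> cintegrable g ->
  cintegral (fun x => f x + g x) = cintegral f + cintegral g.
Proof.
move=> [f1 f2] [g1 g2]; rewrite /cintegral; apply: complex_eq; rewrite /=.
  by under eq_Rintegral do rewrite Re_add; rewrite RintegralD.
by under eq_Rintegral do rewrite Im_add; rewrite RintegralD.
Qed.

Lemma cintegralZ (a : R[i]) f : cintegrable f ->
  cintegral (fun x => a * f x) = a * cintegral f.
Proof.
move=> [f1 f2]; rewrite /cintegral.
have iZ (c : R) (h : E -> R) : intR h -> intR (fun x => c * h x).
  by move=> ih; apply: (eq_integrable measurableT _ _ _ (integrableZl measurableT c ih)).
apply: complex_eq; rewrite ?Re_mul ?Im_mul/=.
  under eq_Rintegral do rewrite Re_mul.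
  by rewrite RintegralB ?RintegralZl//; exact: iZ.
under eq_Rintegral do rewrite Im_mul.
by rewrite RintegralD ?RintegralZl//; exact: iZ.
Qed.

Lemma cintegral_cst0 : cintegral (fun _ : E => 0 : R[i]) = 0.
Proof.
by apply: complex_eq => /=; rewrite Rintegral_cst//= mul0r.
Qed.

Lemma cintegral_sum (I : Type) (r : seq I) (F : I -> E -> R[i]) :
  (forall i, cintegrable (F i)) ->
  cintegral (fun x => \sum_(i <- r) F i x) = \sum_(i <- r) cintegral (F i).
Proof.
move=> h; elim: r => [|i r ih].
  by under [fun _ => _]eq_fun do rewrite big_nil; rewrite big_nil cintegral_cst0.
under [fun _ => _]eq_fun do rewrite big_cons.
by rewrite cintegralD ?ih ?big_cons//; exact: cintegrable_sum.
Qed.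

(** The real and imaginary parts are estimated separately; this gives the factor 2. *)
Lemma normc_cintegral f B : cdom f B ->
  normc (cintegral f) <= 2 * \int[mu]_x B x.
Proof.
move=> fB; have [mf iB h] := fB; apply: (le_trans (normc_le_ReIm _)) => /=.
rewrite mulr2n mulrDl mul1r; apply: lerD.
  apply: (le_trans (le_normr_Rintegral measurableT (cdom_Re fB))).
  apply: le_Rintegral => //; first exact: (integrable_norm (cdom_Re fB)).
  by move=> x _; exact: (le_trans (Re_le_normc _)).
apply: (le_trans (le_normr_Rintegral measurableT (cdom_Im fB))).
apply: le_Rintegral => //; first exact: (integrable_norm (cdom_Im fB)).
by move=> x _; exact: (le_trans (Im_le_normc _)).
Qed.

Lemma Rintegral_dct (F : nat -> E -> R) (f B : E -> R) :
  (forall n, measurable_fun setT (F n)) -> (forall x, (fun n => F n x) @ \oo --> f x) ->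
  intR B -> (forall n x, `|F n x| <= B x) ->
  intR f /\ (fun n => \int[mu]_x F n x) @ \oo --> \int[mu]_x f x.
Proof.
move=> mF Ff iB FB.
have mf : measurable_fun setT f.
  by apply: (@measurable_fun_cvg _ _ _ setT F) => // x _; exact: Ff.
have := @dominated_convergence _ _ _ mu setT measurableT
  (fun n => EFin \o F n) (EFin \o f) (EFin \o B).
case.
- by move=> n; exact/measurable_EFinP.
- exact/measurable_EFinP.
- apply: nearW => x _; apply: cvg_EFin; first exact: nearW.
  exact: Ff.
- exact: iB.
- by apply: nearW => x n _ /=; rewrite lee_fin.
move=> fi _ h; split => //.
apply: (@fine_cvg _ _ _ _ (fun n => \int[mu]_x (F n x)%:E)%E).
by rewrite [X in _ --> X]fineK//; exact: integrable_fin_num.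
Qed.

Lemma cintegral_dct (F : nat -> E -> R[i]) f B :
  (forall n, cdom (F n) B) -> (forall x, ccvg (fun n => F n x) (f x)) ->
  cdom f B /\ ccvg (fun n => cintegral (F n)) (cintegral f).
Proof.
move=> FB Ff; have [_ iB _] := FB 0%N.
have [||//|| r1 r2] := @Rintegral_dct (fun n x => Re (F n x)) (fun x => Re (f x)) B.
- by move=> n; have [[]] := FB n.
- by move=> x; have [] := Ff x.
- by move=> n x; have [_ _ h] := FB n; exact: (le_trans (Re_le_normc _)).
have [||//|| i1 i2] := @Rintegral_dct (fun n x => Im (F n x)) (fun x => Im (f x)) B.
- by move=> n; have [[]] := FB n.
- by move=> x; have [] := Ff x.
- by move=> n x; have [_ _ h] := FB n; exact: (le_trans (Im_le_normc _)).
split; last by split.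
split => //.
  by apply: (cmeas_cvg (F := F)) => // n; have [] := FB n.
move=> x; apply: (@closed_cvg _ _ _ eventually_filter (fun n => normc (F n x)) (fun y => y <= B x)).
- exact: closed_le.
- by apply: nearW => n; have [_ _] := FB n; exact.
- exact: ccvg_normc.
Qed.

Lemma Rintegral_affine (a : E) (c : R) (f : E -> R) : 0 < c -> intR f ->
  intR (fun x => f (a + c *: x)) /\
  \int[mu]_x f x = c ^+ d * \int[mu]_x f (a + c *: x).
Proof.
move=> c0 fi; have [/measurable_EFinP mf fy] := integrableP _ _ _ fi.
have mfa : measurable_fun setT (fun x : E => f (a + c *: x)).
  by apply: (measurableT_comp mf); exact: measurable_rV_affine.
have cd0 : 0 < c ^+ d by rewrite exprn_gt0.
have fai : intR (fun x => f (a + c *: x)).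
  apply/integrableP; split; first exact/measurable_EFinP.
  move: fy; rewrite (@ge0_integral_rV_affine R d a c)//; last first.
    by apply/measurable_EFinP; exact: measurableT_comp.
  move=> h; rewrite ltNge leye_eq; apply/negP => /eqP e.
  by move: h; rewrite /= e mulry gtr0_sg// mul1e ltxx.
split => //; rewrite /Rintegral.
rewrite [in LHS]integralE [in RHS]integralE.
have mp := measurable_funepos (iffRL (measurable_EFinP _ _) mf).
have mn := measurable_funeneg (iffRL (measurable_EFinP _ _) mf).
rewrite (@ge0_integral_rV_affine R d a c _ c0 mp)//.
rewrite (@ge0_integral_rV_affine R d a c _ c0 mn)//.
have ip := integrable_fin_num measurableT (integrable_funepos measurableT fai).
have im := integrable_fin_num measurableT (integrable_funeneg measurableT fai).
move: ip im; set p := integral _ _ _; set m := integral _ _ _ => ip im.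
have -> : (\int[mu]_x (EFin \o f)^\+ (a + c *: x)%R)%E = p.
  by apply: eq_integral => x _; rewrite !funeposE.
have -> : (\int[mu]_x (EFin \o f)^\- (a + c *: x)%R)%E = m.
  by apply: eq_integral => x _; rewrite !funenegE.
by rewrite -(fineK ip) -(fineK im) -!EFinM -!EFinB /= mulrBr.
Qed.

Lemma cintegral_affine (a : E) (c : R) f : 0 < c -> cintegrable f ->
  cintegrable (fun x => f (a + c *: x)) /\ cintegral f = (c ^+ d)%:C * cintegral (fun x => f (a + c *: x)).
Proof.
move=> c0 [f1 f2].
have [i1 e1] := Rintegral_affine a c0 f1; have [i2 e2] := Rintegral_affine a c0 f2.
split => //; apply: complex_eq; rewrite ?Re_mul ?Im_mul/= ?mul0r ?subr0 ?addr0//.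
Qed.

Lemma cintegral_shift (a : E) f : cintegrable f ->
  cintegrable (fun x => f (a + x)) /\ cintegral f = cintegral (fun x => f (a + x)).
Proof.
move=> fi; have [] := @cintegral_affine a 1 f ltr01 fi.
have -> : (fun x => f (a + 1 *: x)) = (fun x => f (a + x)).
  by apply/funext => x; rewrite scale1r.
by rewrite expr1n mul1r.
Qed.

End cintegral_theory.

Section cfubini.
Context {R : realType} {d : nat}.
Local Notation E := 'rV[R]_d.
Local Notation mu := (@lebesgue_rV R d).
Local Notation intR := (fun B : E -> R => mu.-integrable [set: E] (EFin \o B)).

Lemma Rfubini (F : E -> E -> R) (a b : E -> R) :
  measurable_fun setT (fun z : E * E => F z.1 z.2) -> intR a -> intR b ->
  (forall x y, `|F x y| <= a x * b y) ->
  intR (fun x => \int[mu]_y F x y) /\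
   \int[mu]_x \int[mu]_y F x y = \int[mu]_y \int[mu]_x F x y.
Proof.
move=> mF ia ib hF.
have [iab _] := integrable_tensor2 ia ib.
have iF : (mu \x mu)%E.-integrable setT (fun z : E * E => (F z.1 z.2)%:E).
  apply: (le_integrable _ _ _ iab) => //; first exact/measurable_EFinP.
  by move=> x _ /=; rewrite lee_fin (le_trans (hF _ _))//; exact: ler_norm.
have mF1 x : measurable_fun setT (fun y => F x y).
  have mp : measurable_fun [set: E] (fun y : E => (x, y)).
    by apply: measurable_fun_pair; [exact: measurable_cst|exact: measurable_id].
  exact: (measurableT_comp mF mp).
have mF2 y : measurable_fun setT (fun x => F x y).
  have mp : measurable_fun [set: E] (fun x : E => (x, y)).
    by apply: measurable_fun_pair; [exact: measurable_id|exact: measurable_cst].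
  exact: (measurableT_comp mF mp).
have i1 x : intR (fun y => F x y).
  apply: (integrable_dominated (mF1 x) (B := fun y => a x * b y)) => //.
  by apply: (eq_integrable measurableT _ _ _ (integrableZl measurableT (a x) ib)).
have i2 y : intR (fun x => F x y).
  apply: (integrable_dominated (mF2 y) (B := fun x => a x * b y)) => //.
  apply: (eq_integrable measurableT _ _ _ (integrableZl measurableT (b y) ia)) => // x _ /=.
  by rewrite -EFinM mulrC.
have e1 x : (\int[mu]_y (F x y)%:E = (\int[mu]_y F x y)%:E)%E.
  by rewrite /Rintegral fineK//; exact: (integrable_fin_num measurableT (i1 x)).
have e2 y : (\int[mu]_x (F x y)%:E = (\int[mu]_x F x y)%:E)%E.
  by rewrite /Rintegral fineK//; exact: (integrable_fin_num measurableT (i2 y)).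
split.
- apply: (eq_integrable measurableT _ _ _ (integrable_fubini_F iF)) => // x _.
  by rewrite /fubini_F e1.
- have := Fubini iF => /= h; rewrite /Rintegral; congr fine.
  transitivity (\int[mu]_x \int[mu]_y (F x y)%:E)%E.
    by apply: eq_integral => x _; rewrite e1.
  by rewrite h; apply: eq_integral => y _; rewrite e2.
Qed.

(** A majorant which is a product of two integrable functions makes F integrable on
    the product space, and it gives integrability of all sections as well. *)
Lemma cfubini (F : E -> E -> R[i]) (a b : E -> R) :
  cmeas (fun z : E * E => F z.1 z.2) -> intR a -> intR b ->
  (forall x y, normc (F x y) <= a x * b y) ->
  cintegrable (fun x => cintegral (F x)) /\
  cintegral (fun x => cintegral (F x)) = cintegral (fun y => cintegral (F ^~ y)).
Proof.
move=> [m1 m2] ia ib h.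
have [r1 r2] := Rfubini m1 ia ib (fun x y => le_trans (Re_le_normc _) (h x y)).
have [i1 i2] := Rfubini m2 ia ib (fun x y => le_trans (Im_le_normc _) (h x y)).
split; first by split; [exact: r1|exact: i1].
by apply: complex_eq; [exact: r2|exact: i2].
Qed.

End cfubini.

(** * Smooth functions with bounded support *)

Section smooth_class.
Context {R : realType} {d : nat}.
Local Notation E := 'rV[R]_d.
Implicit Types (f g : E -> R).

Definition evec (i : 'I_d) : E := delta_mx ord0 i.

Definition partial (i : 'I_d) f : E -> R := 'D_(evec i) f.

(** Recursion on the order instead of a quantification over multi-indices, so that
    closure under sums, products and dilations is an induction. *)
Fixpoint Ck (n : nat) f : Prop := (forall x, differentiable f x) /\
  if n is m.+1 then forall i, Ck m (partial i f) else True.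

Definition Cinf f := forall n, Ck n f.

Lemma smooth_partial f i : smooth f -> smooth (partial i f).
Proof.
move=> sf s x; have := sf (rcons s i) x.
by rewrite /pderiv foldr_rcons.
Qed.

Lemma smooth_Cinf f : smooth f -> Cinf f.
Proof.
move=> sf n; elim: n f sf => [|n ih] f sf /=.
  by split => // x; exact: (sf [::]).
by split=> [x|i]; [exact: (sf [::])|apply: ih; exact: smooth_partial].
Qed.

Lemma CkS n f : Ck n.+1 f -> Ck n f.
Proof.
elim: n f => [|n ih] f /= [h1 h2]; split => // i; apply: ih.
exact: h2.
Qed.

Lemma partialD f g i : (forall x, differentiable f x) -> (forall x, differentiable g x) ->
  partial i (f \+ g) = partial i f \+ partial i g.
Proof.
move=> df dg; apply/funext => x; rewrite /partial.
by rewrite (_ : f \+ g = f + g)// deriveD//; exact: diff_derivable.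
Qed.

Lemma partialM f g i : (forall x, differentiable f x) -> (forall x, differentiable g x) ->
  partial i (f \* g) = (f \* partial i g) \+ (partial i f \* g).
Proof.
move=> df dg; apply/funext => x; rewrite /partial/=.
rewrite (_ : f \* g = f * g)// deriveM; last 2 first.
- exact: diff_derivable.
- exact: diff_derivable.
by congr (_ + _); rewrite mulrC.
Qed.

Lemma CkD n f g : Ck n f -> Ck n g -> Ck n (f \+ g).
Proof.
elim: n f g => [|n ih] f g /= [f1 f2] [g1 g2]; split => //.
- by move=> x; exact: differentiableD.
- by move=> x; exact: differentiableD.
by move=> i; rewrite partialD//; exact: ih.
Qed.

Lemma CkM n f g : Ck n f -> Ck n g -> Ck n (f \* g).
Proof.
elim: n f g => [|n ih] f g fn gn.
  case: fn gn => [f1 _] [g1 _]; split => // x; exact: differentiableM.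
split; first by case: fn gn => [f1 _] [g1 _] x; exact: differentiableM.
move=> i; rewrite partialM; [|by case: fn|by case: gn].
apply: CkD; apply: ih.
- exact: (CkS fn).
- exact: gn.2.
- exact: fn.2.
- exact: (CkS gn).
Qed.

Lemma Ck_cst n (c : R) : Ck n (fun=> c).
Proof.
elim: n c => [|n ih] c; first by split => // x; exact: differentiable_cst.
split; first by move=> x; exact: differentiable_cst.
move=> i; rewrite (_ : partial i _ = (fun=> 0)); first exact: ih.
by apply/funext => x; rewrite /partial derive_cst.
Qed.

Lemma partial_dilate f (c : R) i : (forall x, differentiable f x) ->
  partial i (fun x => f (c *: x)) = (fun x => c * partial i f (c *: x)).
Proof.
move=> df; apply/funext => x; rewrite /partial.
have dc : differentiable (c *: (id : E -> E)) x by apply: differentiableZ.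
have dfc : differentiable (f \o (c *: (id : E -> E))) x by exact: differentiable_comp.
rewrite (_ : (fun _ => _) = f \o (c *: (id : E -> E)))//.
have e1 := deriveE (evec i) dfc; have e2 := deriveE (evec i) (df (c *: x)).
have e3 := diff_comp dc (df (c *: x)).
have e4 : 'd (c *: (id : E -> E)) x (evec i) = c *: evec i.
  by have := @diffZ _ _ _ (id : E -> E) c x (ex_diff (f:=id)) => ->; rewrite [LHS]/= diff_val.
apply: (etrans e1); apply: (etrans (congr1 (fun F : E -> R => F (evec i)) e3)).
rewrite [LHS]/= e4 linearZ; congr (_ * _); exact: esym e2.
Qed.

Lemma Ck_dilate n f (c : R) : Ck n f -> Ck n (fun x => f (c *: x)).
Proof.
have D h (x : E) : (forall x, differentiable h x) -> differentiable (fun x : E => h (c *: x) : R) x.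
  move=> dh; apply: (@differentiable_comp _ _ _ _ (c *: (id : E -> E)) h) => //.
elim: n f => [|n ih] f [f1 f2]; first by split => // x; exact: (D f x f1).
split; first by move=> x; exact: (D f x f1).
move=> i; rewrite partial_dilate//.
by apply: (@CkM n (fun=> c)); [exact: Ck_cst|exact: (ih _ (f2 i))].
Qed.

Definition bsupp f := exists r : R, forall x : E, r <= `|x| -> f x = 0.

Definition testfun f := Cinf f /\ bsupp f.

Lemma testfun_diff f : testfun f -> forall x, differentiable f x.
Proof. by move=> [h _] x; have [] := h 0%N. Qed.

Lemma testfun_partial f i : testfun f -> testfun (partial i f).
Proof.
move=> [sf [r hr]]; split.
  by move=> n; have [_] := sf n.+1; exact.
exists (r + 1) => x hx; rewrite /partial.
rewrite (@near_eq_derive _ _ _ f (cst 0)) ?derive_cst//.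
apply/nbhs_ballP; exists 1 => //= y; rewrite mx_norm_ball /ball_/= => hy.
apply: hr; rewrite -(lerD2r 1); apply: (le_trans hx).
rewrite -[x](subrK y) (le_trans (ler_normD _ _))// addrC lerD2l.
exact: ltW.
Qed.

Lemma testfunD f g : testfun f -> testfun g -> testfun (f \+ g).
Proof.
move=> [f1 [r hr]] [g1 [s hs]]; split; first by move=> n; exact: CkD.
exists (Num.max r s) => x; rewrite ge_max => /andP[h1 h2] /=.
by rewrite hr// hs// addr0.
Qed.

Lemma testfunM f g : testfun f -> testfun g -> testfun (f \* g).
Proof.
move=> [f1 [r hr]] [g1 [s hs]]; split; first by move=> n; exact: CkM.
by exists r => x h /=; rewrite hr// mul0r.
Qed.

Lemma testfunZ (c : R) f : testfun f -> testfun (fun x => c * f x).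
Proof.
move=> [f1 [r hr]]; split; first by move=> n; apply: (@CkM n (fun=> c)) => //; exact: Ck_cst.
by exists r => x h /=; rewrite hr// mulr0.
Qed.

Lemma testfun_dilate (c : R) f : 0 < c -> testfun f -> testfun (fun x => f (c *: x)).
Proof.
move=> c0 [f1 [r hr]]; split; first by move=> n; exact: Ck_dilate.
by exists (r / c) => x; rewrite ler_pdivrMr// => h; rewrite hr// normrZ gtr0_norm// mulrC.
Qed.

Lemma testfun_continuous f : testfun f -> continuous f.
Proof. by move=> tf x; apply: differentiable_continuous; exact: testfun_diff. Qed.

Lemma rV_norm_coord (x : E) i : `|x ord0 i| <= `|x|.
Proof.
rewrite [leRHS](_ : _ = mx_norm x)// mx_normrE.
exact: (le_bigmax_cond _ (fun ij : 'I_1 * 'I_d => `|x ij.1 ij.2|) (j := (ord0, i))).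
Qed.

Lemma rV_norm_le (x : E) (r : R) : 0 <= r -> (forall i, `|x ord0 i| <= r) -> `|x| <= r.
Proof.
move=> r0 h; rewrite [leLHS](_ : _ = mx_norm x)// mx_normrE; apply: bigmax_le => // -[a b] _ /=.
by rewrite ord1.
Qed.

(** A continuous function is bounded on a cube, and here it vanishes outside one. *)
Lemma testfun_bounded f : testfun f -> exists M : R, forall x, `|f x| <= M.
Proof.
move=> tf; have [_ [r hr]] := tf.
pose K := [set v : E | forall i, `[- r, r]%classic (v ord0 i)].
have cK : compact K by apply: (@rV_compact R d (fun=> `[- r, r]%classic)) => i; exact: segment_compact.
have cfK : compact (f @` K).
  apply: continuous_compact cK; apply: continuous_subspaceT; exact: testfun_continuous.
have [M [_ hM]] := compact_bounded cfK.
exists (Num.max 0 (M + 1)) => x; have [rx|xr] := leP r `|x|.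
  by rewrite hr// normr0 le_max lexx.
rewrite le_max; apply/orP; right; apply: (hM (M + 1)); first by rewrite ltrDl.
exists x => // i; rewrite /= in_itv/= -ler_norml.
exact: (le_trans (rV_norm_coord _ _) (ltW xr)).
Qed.

End smooth_class.

(** * The inverse Fourier transform *)

Section fourier.
Context {R : realType} {d : nat}.
Local Notation E := 'rV[R]_d.
Local Notation mu := (@lebesgue_rV R d).
Local Notation intR := (fun B : E -> R => mu.-integrable [set: E] (EFin \o B)).
Implicit Types (f g psi : E -> R).

Lemma dotpC (x y : E) : dotp x y = dotp y x.
Proof. by apply: eq_bigr => i _; rewrite mulrC. Qed.

Lemma dotpDl (x y z : E) : dotp (x + y) z = dotp x z + dotp y z.
Proof. by rewrite /dotp -big_split; apply: eq_bigr => i _; rewrite mxE mulrDl. Qed.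

Lemma dotpZl c (x z : E) : dotp (c *: x) z = c * dotp x z.
Proof. by rewrite /dotp mulr_sumr; apply: eq_bigr => i _; rewrite mxE mulrA. Qed.

Lemma dotpDr (x y z : E) : dotp z (x + y) = dotp z x + dotp z y.
Proof. by rewrite dotpC dotpDl !(dotpC z). Qed.

Lemma dotpZr c (x z : E) : dotp z (c *: x) = c * dotp z x.
Proof. by rewrite dotpC dotpZl (dotpC z). Qed.

Lemma dotpNl (x z : E) : dotp (- x) z = - dotp x z.
Proof. by rewrite -scaleN1r dotpZl mulN1r. Qed.

Lemma dotp_evec (x : E) i : dotp x (evec i) = x ord0 i.
Proof.
rewrite /dotp (bigD1 i)//= big1 ?addr0 => [|j ji]; rewrite mxE eqxx/=.
  by rewrite eqxx mulr1.
by rewrite (negbTE ji) mulr0.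
Qed.

Lemma measurable_dotp2 : measurable_fun setT (fun z : E * E => dotp z.1 z.2).
Proof.
apply: measurable_sum => i; apply: measurable_funM.
  exact: (measurableT_comp (measurable_coord i) measurable_fst).
exact: (measurableT_comp (measurable_coord i) measurable_snd).
Qed.

Lemma measurable_dotp (x : E) : measurable_fun [set: E] (fun y : E => dotp x y).
Proof.
by apply: measurable_sum => i; apply: measurable_funM => //; exact: measurable_coord.
Qed.

Lemma cvg_dotpl (u : nat -> E) (x y : E) :
  (forall i, (fun n => u n ord0 i) @ \oo --> x ord0 i) ->
  (fun n => dotp (u n) y) @ \oo --> dotp x y.
Proof.
move=> h; rewrite /dotp; elim: (index_enum _) => [|i r ih].
  by under eq_fun do rewrite big_nil; rewrite big_nil; exact: cvg_cst.
under eq_fun do rewrite big_cons; rewrite big_cons; apply: cvgD => //.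
by apply: cvgM; [exact: h|exact: cvg_cst].
Qed.

Definition box (r : R) (x : E) : R := \prod_i \1_`[- r, r] (x ord0 i).

Lemma intR_box r : intR (box r).
Proof.
have [] // := @integral_tensor R d (fun=> \1_`[- r, r]).
by move=> i; exact: integrable_indic_itv.
Qed.

Lemma box1 r (x : E) : `|x| <= r -> box r x = 1.
Proof.
move=> h; rewrite /box big1// => i _; rewrite indicE mem_set//=.
by rewrite in_itv/= -ler_norml; exact: (le_trans (rV_norm_coord _ _)).
Qed.

Lemma box_ge0 r x : 0 <= box r x.
Proof. by apply: prodr_ge0 => i _; rewrite indicE. Qed.

Lemma bsupp_dominated f r M : (forall x : E, r <= `|x| -> f x = 0) ->
  (forall x, `|f x| <= M) -> forall x, `|f x| <= M * box r x.
Proof.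
move=> fr fM x; have [rx|xr] := leP r `|x|.
  rewrite fr// normr0 mulr_ge0 ?box_ge0//; exact: (le_trans _ (fM 0)).
by rewrite box1 ?mulr1// ltW.
Qed.

Lemma intRZ c f : intR f -> intR (fun x => c * f x).
Proof. by move=> h; apply: (eq_integrable measurableT _ _ _ (integrableZl measurableT c h)). Qed.

Lemma intR_norm f : intR f -> intR (fun x => `|f x|).
Proof. by move/integrable_norm. Qed.

Lemma intR_meas f : intR f -> measurable_fun setT f.
Proof. by move=> /integrableP[/measurable_EFinP]. Qed.

Lemma testfun_measurable f : testfun f -> measurable_fun [set: E] f.
Proof. by move=> /testfun_continuous; exact: continuous_measurable_rV. Qed.

Lemma testfun_intR f : testfun f -> intR f.
Proof.
move=> tf; have [M hM] := testfun_bounded tf; have [_ [r hr]] := tf.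
apply: (integrable_dominated (testfun_measurable tf) (intRZ M (intR_box r))).
exact: bsupp_dominated.
Qed.

Lemma cdom_inv_fourier psi x : intR psi ->
  cdom (fun xi => (psi xi)%:C * expi (dotp x xi)) (fun xi => `|psi xi|).
Proof.
move=> ip; split; last first.
- by move=> xi; rewrite Normc.normcM normc_expi mulr1 normc_real.
- exact: intR_norm.
apply: cmeasM; first exact: (cmeas_real (intR_meas ip)).
exact: (cmeas_expi (measurable_dotp x)).
Qed.

Lemma cintegrable_inv_fourier psi x : intR psi ->
  cintegrable (fun xi => (psi xi)%:C * expi (dotp x xi)).
Proof. by move=> h; exact: cdom_cintegrable (cdom_inv_fourier x h). Qed.

Lemma inv_fourier_bound psi x : intR psi ->
  normc (inv_fourier psi x) <= 2 * \int[mu]_xi `|psi xi|.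
Proof. by move=> h; exact: (normc_cintegral (cdom_inv_fourier x h)). Qed.

Lemma inv_fourier_cvg psi (u : nat -> E) (x : E) : intR psi ->
  (forall i, (fun n => u n ord0 i) @ \oo --> x ord0 i) ->
  ccvg (fun n => inv_fourier psi (u n)) (inv_fourier psi x).
Proof.
move=> ip ux.
have [] := @cintegral_dct R d (fun n xi => (psi xi)%:C * expi (dotp (u n) xi))
  (fun xi => (psi xi)%:C * expi (dotp x xi)) (fun xi => `|psi xi|) => //.
- by move=> n; exact: (cdom_inv_fourier _ ip).
- by move=> xi; apply: ccvgM; [exact: ccvg_cst|apply: ccvg_expi; exact: cvg_dotpl].
Qed.

Lemma cmeas_inv_fourier psi : intR psi -> cmeas (inv_fourier psi).
Proof.
by move=> ip; apply: cmeas_grid_cvg => x; apply: inv_fourier_cvg => // i; exact: grid_cvg_coord.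
Qed.

Lemma inv_fourier_lin psi f a b x : intR psi -> intR f ->
  inv_fourier (fun xi => a * psi xi + b * f xi) x =
  a%:C * inv_fourier psi x + b%:C * inv_fourier f x.
Proof.
move=> ip jf; have p1 := cintegrable_inv_fourier x ip; have f1 := cintegrable_inv_fourier x jf.
rewrite /inv_fourier -!cintegralZ// -cintegralD; try exact: cintegrableZ.
apply: eq_cintegral => xi; rewrite rmorphD !rmorphM mulrDl !mulrA//.
Qed.

(** Translation becomes modulation; differentiating this identity at 0 is what
    replaces integration by parts below. *)
Lemma inv_fourier_shift psi (a x : E) : intR psi ->
  inv_fourier (fun xi => psi (a + xi)) x = expi (- dotp x a) * inv_fourier psi x.
Proof.
move=> ip; have p1 := cintegrable_inv_fourier x ip.
rewrite /inv_fourier; have [i2 ->] := cintegral_shift a p1.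
rewrite -cintegralZ//; apply: eq_cintegral => xi.
rewrite mulrCA -[X in _ * X = _]/(expi (dotp x xi)); congr (_ * _).
by rewrite -expiD dotpDr addrA addNr add0r.
Qed.

Lemma inv_fourier_dilate psi (c : R) (x : E) : 0 < c -> intR psi ->
  inv_fourier psi x = (c ^+ d)%:C * inv_fourier (fun xi => psi (c *: xi)) (c *: x).
Proof.
move=> c0 ip; have p1 := cintegrable_inv_fourier x ip.
rewrite /inv_fourier; have [i2 ->] := cintegral_affine 0 c0 p1.
congr (_ * _); apply: eq_cintegral => xi; rewrite add0r; congr (_ * _).
by rewrite -[RHS]/(expi (dotp (c *: x) xi)) dotpZr dotpZl.
Qed.

Lemma derive_seq (V : normedModType R) (f : V -> R) (a v : V) : derivable f a v ->
  (fun n : nat => n.+1%:R * (f (n.+1%:R^-1 *: v + a) - f a)) @ \oo --> 'D_v f a.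
Proof.
move=> df.
have h : (fun h => h^-1 *: (f (h *: v + a) - f a)) @ 0^' --> 'D_v f a by exact: df.
have /cvgr_dnbhsP := h => /(_ (fun n => n.+1%:R^-1)) H.
rewrite (_ : (fun n : nat => _) =
   (fun n => (n.+1%:R^-1)^-1 *: (f (n.+1%:R^-1 *: v + a) - f a))).
  by apply: H; split; [move=> n; rewrite invr_eq0|exact: cvg_harmonic].
by apply/funext => n; rewrite invrK.
Qed.

Lemma partial_lipschitz f i M : (forall x, differentiable f x) ->
  (forall x, `|partial i f x| <= M) ->
  forall (h : R) (x : E), 0 < h -> `|f (h *: evec i + x) - f x| <= h * M.
Proof.
move=> df hM h x h0.
pose F (t : R) := f (t *: evec i + x).
have dF (t : R) : is_derive t (1 : R) F (partial i f (t *: evec i + x)).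
  have dd : derivable f (t *: evec i + x) (evec i) by exact: diff_derivable.
  have E1 : (fun k : R => k^-1 *: ((F \o shift t) (k *: (1 : R)) - F t)) =
     (fun k : R => k^-1 *: ((f \o shift (t *: evec i + x)) (k *: evec i) - f (t *: evec i + x))).
    by apply/funext => k; rewrite /F/= addrA -scalerDl /GRing.scale/= mulr1.
  apply: DeriveDef; first by rewrite /derivable E1.
  by rewrite /derive E1.
have cF : {within `[0, h], continuous F}.
  by apply: derivable_within_continuous => t _; exact: (@ex_derive _ _ _ _ _ _ _ (dF t)).
have [c _] := @MVT R F (fun t => partial i f (t *: evec i + x)) 0 h h0 (fun t _ => dF t) cF.
rewrite /F scale0r add0r subr0 => ->.
by rewrite normrM (gtr0_norm h0) mulrC ler_wpM2l// ltW.
Qed.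
End fourier.

(** * Rapid decay of the inverse Fourier transform *)

Section decay.
Context {R : realType} {d : nat}.
Local Notation E := 'rV[R]_d.
Local Notation mu := (@lebesgue_rV R d).
Local Notation intR := (fun B : E -> R => mu.-integrable [set: E] (EFin \o B)).
Implicit Types (f g psi : E -> R).

Lemma evec_norm (i : 'I_d) : `|evec i : E| <= 1.
Proof.
by apply: rV_norm_le => // j; rewrite mxE eqxx/=; case: eqP => _; rewrite ?normr1// normr0.
Qed.

Lemma measurable_shift f (a : E) : measurable_fun setT f ->
  measurable_fun [set: E] (fun x => f (a + x)).
Proof.
move=> mf; have := measurableT_comp mf (measurable_rV_affine a 1).
by apply: eq_measurable_fun => x _ /=; rewrite scale1r.
Qed.

Lemma cvg_expi_quotient (t : R) :
  ccvg (fun n => n.+1%:R%:C * (expi (- (n.+1%:R^-1 * t)) - 1)) (0 +i* (- (2 * pi * t))).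
Proof.
pose c := - (2 * pi * t).
have dl : is_derive (0 : R) (1 : R) (c *: (id : R -> R)) c.
  by apply: is_derive_eq; rewrite /GRing.scale/= mulr1.
have l0 : (c *: (id : R -> R)) 0 = 0 by rewrite [LHS](_ : _ = c * 0)// mulr0.
have dcos : is_derive (0 : R) (1 : R) (cos \o (c *: (id : R -> R))) 0.
  by apply: (is_derive_eq (is_derive1_comp _ dl)); rewrite l0 sin0 oppr0 mul0r.
have dsin : is_derive (0 : R) (1 : R) (sin \o (c *: (id : R -> R))) c.
  by apply: (is_derive_eq (is_derive1_comp _ dl)); rewrite l0 cos0 mul1r.
have h1 := derive_seq (@ex_derive _ _ _ _ _ _ _ dcos).
have h2 := derive_seq (@ex_derive _ _ _ _ _ _ _ dsin).
rewrite (@derive_val _ _ _ _ _ _ _ dcos) in h1.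
rewrite (@derive_val _ _ _ _ _ _ _ dsin) in h2.
have E1 n : 2 * pi * - (n.+1%:R^-1 * t) = c * (n.+1%:R^-1 * 1 + 0) by rewrite /c; ring.
have eqR : (fun n => Re (n.+1%:R%:C * (expi (- (n.+1%:R^-1 * t)) - 1))) =
    (fun n : nat => n.+1%:R * ((cos \o (c *: (id : R -> R))) (n.+1%:R^-1 *: (1 : R) + 0)
                       - (cos \o (c *: (id : R -> R))) 0)).
  apply/funext => n; rewrite Re_mul Re_add Re_opp [Im (_%:C)]/= mul0r subr0.
  rewrite [Re (_%:C)]/= [Re (expi _)]/= E1; congr (_ * (cos _ - _)).
  by rewrite [RHS](_ : _ = cos (c * 0))// mulr0 cos0.
have eqI : (fun n => Im (n.+1%:R%:C * (expi (- (n.+1%:R^-1 * t)) - 1))) =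
    (fun n : nat => n.+1%:R * ((sin \o (c *: (id : R -> R))) (n.+1%:R^-1 *: (1 : R) + 0)
                       - (sin \o (c *: (id : R -> R))) 0)).
  apply/funext => n; rewrite Im_mul Im_add Im_opp [Im (_%:C)]/= mul0r addr0.
  rewrite [Re (_%:C)]/= [Im (expi _)]/= E1; congr (_ * (sin _ - _)).
  by rewrite [RHS](_ : _ = sin (c * 0))// mulr0 sin0.
by split; rewrite ?eqR ?eqI.
Qed.

(** The difference quotients of psi converge with a common bounded support and a
    common bound, and their inverse transforms are those of psi times the difference
    quotients of a character.  Dominated convergence does the rest. *)
Lemma inv_fourier_partial psi i x : testfun psi ->
  inv_fourier (partial i psi) x = (0 +i* (- (2 * pi * x ord0 i))) * inv_fourier psi x.
Proof.
move=> tp; have mp := testfun_measurable tp; have ip := testfun_intR tp.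
have [_ [r hr]] := tp.
have [M hM] := testfun_bounded (testfun_partial i tp).
pose h (n : nat) : R := n.+1%:R^-1.
pose F (n : nat) (xi : E) : R := n.+1%:R * (psi (h n *: evec i + xi) - psi xi).
have h0 n : 0 < h n by rewrite invr_gt0.
have h1 n : h n <= 1 by rewrite invf_le1// ler1n.
have FM n xi : `|F n xi| <= M.
  rewrite normrM ger0_norm// -ler_pdivlMl// mulrC.
  by rewrite mulrC; apply: (partial_lipschitz (testfun_diff tp) hM).
have F0 n (xi : E) : r + 1 <= `|xi| -> F n xi = 0.
  move=> rx; rewrite /F !hr ?subrr ?mulr0//; first by rewrite (le_trans _ rx)// lerDl.
  rewrite -(lerD2r 1) (le_trans rx)// -{1}(addKr (h n *: evec i) xi).
  rewrite (le_trans (ler_normD _ _))// addrC lerD2l normrN normrZ.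
  by rewrite gtr0_norm// mulr_ile1// ?evec_norm// ltW.
have mF n : measurable_fun setT (F n).
  apply: measurable_funM => //; apply: measurable_funB => //; exact: measurable_shift.
have FB n xi : `|F n xi| <= M * box (r + 1) xi by apply: bsupp_dominated => //; exact: F0.
have iB := intRZ M (@intR_box R d (r + 1)).
have iF n : intR (F n) by apply: integrable_dominated (mF n) iB (FB n).
have e1 n : inv_fourier (F n) x =
    n.+1%:R%:C * (expi (- (h n * x ord0 i)) - 1) * inv_fourier psi x.
  have ish : intR (fun xi => psi (h n *: evec i + xi)).
    have [] := Rintegral_affine (h n *: evec i) ltr01 ip.
    by under eq_fun do rewrite scale1r.
  have := inv_fourier_lin (n.+1%:R) (- n.+1%:R) x ish ip.
  rewrite inv_fourier_shift// dotpZr dotp_evec.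
  rewrite (_ : (fun xi => _) = F n) => [->|]; last by apply/funext => xi; rewrite /F; ring.
  by rewrite rmorphN/=; ring.
have [] := @cintegral_dct R d (fun n xi => (F n xi)%:C * expi (dotp x xi))
  (fun xi => (partial i psi xi)%:C * expi (dotp x xi)) (fun xi => M * box (r + 1) xi).
- move=> n; have [m1 _ m2] := cdom_inv_fourier x (iF n); split => // xi.
  exact: (le_trans (m2 xi)).
- move=> xi; apply: ccvgM; last exact: ccvg_cst.
  apply: ccvg_real; apply: derive_seq; apply: diff_derivable; exact: testfun_diff.
move=> _ L1; apply: (ccvg_unique L1).
have L2 := ccvgM (cvg_expi_quotient (x ord0 i)) (ccvg_cst (inv_fourier psi x)).
rewrite (_ : (fun n => _) =
  (fun n => n.+1%:R%:C * (expi (- (n.+1%:R^-1 * x ord0 i)) - 1) * inv_fourier psi x))//.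
by apply/funext => n; exact: e1.
Qed.

(** The operator 1 - d_i^2 is preferred to d_i^2 because it becomes multiplication by
    a function which is at least 1. *)
Lemma inv_fourier_oneD2 psi i x : testfun psi ->
  inv_fourier (psi \+ (fun y => -1 * partial i (partial i psi) y)) x =
  (1 + (2 * pi * x ord0 i) ^+ 2)%:C * inv_fourier psi x.
Proof.
move=> tp; have t1 := testfun_partial i tp; have t2 := testfun_partial i t1.
have := inv_fourier_lin 1 (-1) x (testfun_intR tp) (testfun_intR t2).
rewrite (_ : (fun xi => _) = psi \+ (fun y => -1 * partial i (partial i psi) y)); last first.
  by apply/funext => xi; rewrite mul1r.
move=> ->; rewrite !inv_fourier_partial// mul1r mulrA mulrA -{1}[inv_fourier psi x]mul1r -mulrDl.
by congr (_ * _); apply: complex_eq; rewrite ?Re_add ?Im_add ?Re_mul ?Im_mul/=; ring.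
Qed.

Definition sqr_prod (s : seq 'I_d) (x : E) : R := \prod_(i <- s) (1 + (2 * pi * x ord0 i) ^+ 2).

(** Each factor of the product is absorbed by one application of 1 - d_i^2 to psi,
    which stays a test function; the empty product is the trivial bound by the
    integral of the modulus. *)
Lemma decay_sqr_prod (s : seq 'I_d) psi : testfun psi ->
  exists C : R, forall x, sqr_prod s x * normc (inv_fourier psi x) <= C.
Proof.
elim: s psi => [|i s ih] psi tp.
  exists (2 * \int[mu]_xi `|psi xi|) => x; rewrite /sqr_prod big_nil mul1r.
  exact: inv_fourier_bound (testfun_intR tp).
have t2 : testfun (psi \+ (fun y => -1 * partial i (partial i psi) y)).
  by apply: testfunD => //; apply: testfunZ; do 2 apply: testfun_partial.
have [C hC] := ih _ t2; exists C => x; have := hC x.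
rewrite inv_fourier_oneD2// Normc.normcM normc_real ger0_norm; last first.
  by rewrite addr_ge0// sqr_ge0.
by rewrite /sqr_prod big_cons mulrA [X in X * _]mulrC.
Qed.

(** All coordinates, L times over: products along this list are L-th powers. *)
Definition copies (L : nat) : seq 'I_d := iter L (cat (enum 'I_d)) [::].

Lemma big_copies (L : nat) (F : 'I_d -> R) :
  \prod_(i <- copies L) F i = (\prod_i F i) ^+ L.
Proof.
elim: L => [|L ih]; first by rewrite /copies/= big_nil expr0.
by rewrite /copies/= big_cat/= -/(copies L) ih big_enum/= exprS.
Qed.

(** The integrable majorant of all kernels below.  It factorises over the
    coordinates, so its integral is a product of arctangent integrals. *)
Definition weight (x : E) : R := \prod_i (1 + x ord0 i ^+ 2)^-1.

Lemma weight_gt0 x : 0 < weight x.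
Proof. by apply: prodr_gt0 => i _; rewrite invr_gt0 ltr_pwDl// sqr_ge0. Qed.

Lemma weight_le1 x : weight x <= 1.
Proof.
apply: prodr_ile1 => i _; rewrite invr_ge0 addr_ge0 ?sqr_ge0//=.
by rewrite invf_le1 ?lerDl ?sqr_ge0// ltr_pwDl// sqr_ge0.
Qed.

Lemma weight_coord x i : weight x <= (1 + x ord0 i ^+ 2)^-1.
Proof.
rewrite /weight (bigD1 i)//= ler_piMr//.
  by rewrite invr_ge0 addr_ge0 ?sqr_ge0.
apply: prodr_ile1 => j _; rewrite invr_ge0 addr_ge0 ?sqr_ge0//=.
by rewrite invf_le1 ?lerDl ?sqr_ge0// ltr_pwDl// sqr_ge0.
Qed.

Lemma intR_weight : intR weight.
Proof.
have [] // := @integral_tensor R d (fun _ t => (1 + t ^+ 2)^-1).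
move=> i; apply/integrableP; split.
  apply/measurable_EFinP; apply: continuous_measurable_fun; exact: continuous_oneDsqrV.
apply: (le_lt_trans _ (@integral_oneDsqrV R)).
rewrite le_eqVlt; apply/orP; left; apply/eqP; apply: eq_integral => t _ /=.
by rewrite ger0_norm// invr_ge0 addr_ge0// sqr_ge0.
Qed.

Lemma decay psi (L : nat) : testfun psi ->
  exists2 C : R, 0 <= C & forall x, normc (inv_fourier psi x) <= C * weight x ^+ L.
Proof.
move=> tp; have [C hC] := decay_sqr_prod (copies L) tp; exists C.
  apply: (le_trans _ (hC 0)); rewrite mulr_ge0 ?normc_ge0//.
  by apply: prodr_ge0 => i _; rewrite addr_ge0// sqr_ge0.
move=> x; have := hC x; rewrite /sqr_prod big_copies => h.
rewrite -ler_pdivrMr ?exprn_gt0 ?weight_gt0//; apply: le_trans h.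
rewrite mulrC ler_wpM2r ?normc_ge0// -exprVn; apply: lerXn2r.
- by rewrite nnegrE invr_ge0 ltW// weight_gt0.
- by rewrite nnegrE; apply: prodr_ge0 => i _; rewrite addr_ge0// sqr_ge0.
rewrite /weight -prodfV; apply: ler_prod => i _.
rewrite invrK addr_ge0 ?sqr_ge0//= lerD2l exprMn ler_peMl ?sqr_ge0//.
have : 1 <= 2 * pi :> R by have := @pi_ge2 R; lra.
by move=> ?; rewrite exprn_ege1.
Qed.

Lemma cdom_decay psi : testfun psi -> exists2 C : R, 0 <= C &
   cdom (inv_fourier psi) (fun x => C * weight x).
Proof.
move=> tp; have [C C0 hC] := decay 1 tp; exists C => //; split.
- exact: cmeas_inv_fourier (testfun_intR tp).
- exact: intRZ intR_weight.
- by move=> x; have := hC x; rewrite expr1.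
Qed.

Lemma cintegrable_ift psi : testfun psi -> cintegrable (inv_fourier psi).
Proof. by move=> /cdom_decay[C _]; exact: cdom_cintegrable. Qed.

End decay.

(** * Fourier inversion up to a constant *)

Section inversion.
Context {R : realType} {d : nat}.
Local Notation E := 'rV[R]_d.
Local Notation mu := (@lebesgue_rV R d).
Local Notation leb := (@lebesgue_measure R).
Local Notation intR := (fun B : E -> R => mu.-integrable [set: E] (EFin \o B)).
Implicit Types (f g psi : E -> R).

Definition fourier (f : E -> R[i]) (xi : E) : R[i] :=
  cintegral (fun x => f x * expi (- dotp x xi)).

Definition coordcvg (u : nat -> E) (x : E) : Prop :=
  forall i, (fun n => u n ord0 i) @ \oo --> x ord0 i.

Lemma coordcvg_dilate (x y : E) :
  coordcvg (fun n => x + n.+1%:R^-1 *: y) x.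
Proof.
move=> i.
have h : (fun n : nat => x ord0 i + n.+1%:R^-1 * y ord0 i) @ \oo --> x ord0 i + 0 * y ord0 i.
  apply: cvgD; first exact: cvg_cst.
  by apply: cvgM; [exact: cvg_harmonic|exact: cvg_cst].
rewrite mul0r addr0 in h.
by rewrite (_ : (fun n => _) = (fun n : nat => x ord0 i + n.+1%:R^-1 * y ord0 i))//;
   apply/funext => n; rewrite !mxE.
Qed.

Lemma testfun_cvg f (u : nat -> E) x : testfun f -> coordcvg u x ->
  (fun n => f (u n)) @ \oo --> f x.
Proof.
move=> tf ux; apply: continuous_cvg; first exact: testfun_continuous.
exact: cvg_rV.
Qed.

Lemma cmeas_expi_dotp (xi : E) : cmeas (fun x => expi (- dotp x xi)).
Proof.
apply: cmeas_expi; apply: (@measurableT_comp _ _ _ _ _ _ (@GRing.opp R)) => //.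
by under eq_fun do rewrite dotpC; exact: measurable_dotp.
Qed.

Lemma cmeas_expi_dotp2 : cmeas (fun z : E * E => expi (dotp z.1 z.2)).
Proof. by apply: cmeas_expi; exact: measurable_dotp2. Qed.

Lemma measurable_rV_scale (c : R) : measurable_fun [set: E] (fun x : E => c *: x : E).
Proof.
have := @measurable_rV_affine R d 0 c.
by apply: eq_measurable_fun => x _; rewrite add0r.
Qed.

Section inv.
Variable chi : E -> R.
Hypotheses (tchi : testfun chi) (chi0 : chi 0 = 1).

(** Classical Fourier inversion says that this number is chi 0. *)
Definition cst_inv : R[i] := cintegral (inv_fourier chi).

(** Insert a cutoff chi(h x) into the outer integral, exchange the two integrals,
    rescale by h, and let h tend to 0 on both sides.  All the information about chi
    is in the constant, which is therefore the same for every psi. *)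
Lemma inversion psi (xi0 : E) : testfun psi ->
  fourier (inv_fourier psi) xi0 = cst_inv * (psi xi0)%:C.
Proof.
move=> tp.
have ip := testfun_intR tp; have ic := testfun_intR tchi.
have [Cp Cp0 dp] := cdom_decay tp; have [Cc Cc0 dc] := cdom_decay tchi.
have [Mp hMp] := testfun_bounded tp; have [Mc hMc] := testfun_bounded tchi.
have [mgp iwp bp] := dp; have [mgc iwc bc] := dc.
have Mp0 : 0 <= Mp := le_trans (normr_ge0 _) (hMp 0).
have Mc0 : 0 <= Mc := le_trans (normr_ge0 _) (hMc 0).
pose h (n : nat) : R := n.+1%:R^-1.
have h0 n : 0 < h n by rewrite invr_gt0.
pose I n := cintegral (fun x => inv_fourier psi x * expi (- dotp x xi0) * (chi (h n *: x))%:C).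
have hto0 (x : E) : coordcvg (fun n => h n *: x) 0.
  by have := @coordcvg_dilate 0 x; under [X in coordcvg X]eq_fun do rewrite add0r.
have mch n : measurable_fun setT (fun x : E => chi (h n *: x)).
  exact: (measurableT_comp (testfun_measurable tchi) (measurable_rV_scale _)).
have L1 : ccvg I (fourier (inv_fourier psi) xi0).
  have [] // := @cintegral_dct R d
    (fun n x => inv_fourier psi x * expi (- dotp x xi0) * (chi (h n *: x))%:C)
    (fun x => inv_fourier psi x * expi (- dotp x xi0)) (fun x => Mc * (Cp * weight x)).
  - move=> n; split; last first.
    + move=> x; rewrite !Normc.normcM normc_expi mulr1 normc_real mulrC.
      by apply: ler_pM => //; rewrite ?normr_ge0 ?normc_ge0.
    + exact: intRZ.
    + apply: cmeasM; last exact: cmeas_real.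
      by apply: cmeasM => //; exact: cmeas_expi_dotp.
  - move=> x; rewrite -[X in ccvg _ X]mulr1; apply: ccvgM; first exact: ccvg_cst.
    rewrite -[1]/(1%:C) -chi0; apply: ccvg_real; exact: testfun_cvg.
have E2 n : I n = cintegral (fun eta => (psi (xi0 + h n *: eta))%:C * inv_fourier chi eta).
  pose F (x xi : E) : R[i] := (expi (- dotp x xi0) * (chi (h n *: x))%:C) *
     ((psi xi)%:C * expi (dotp x xi)).
  have ich : intR (fun x => `|chi (h n *: x)|).
    apply: intR_norm; have [] := Rintegral_affine 0 (h0 n) ic.
    by under eq_fun do rewrite add0r.
  have mF : cmeas (fun z : E * E => F z.1 z.2).
    have m1 : cmeas (fun x => expi (- dotp x xi0) * (chi (h n *: x))%:C).
      by apply: cmeasM; [exact: cmeas_expi_dotp|exact: cmeas_real].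
    apply: cmeasM; first exact: (cmeas_comp m1 measurable_fst).
    apply: cmeasM; last exact: cmeas_expi_dotp2.
    exact: (cmeas_comp (cmeas_real (intR_meas ip)) measurable_snd).
  have bF x y : normc (F x y) <= `|chi (h n *: x)| * `|psi y|.
    by rewrite !Normc.normcM !normc_expi !normc_real mul1r mulr1.
  have [_ fub] := cfubini mF ich (intR_norm ip) bF.
  transitivity (cintegral (fun x => cintegral (F x))).
    apply: eq_cintegral => x; rewrite /F cintegralZ ?mulrA; last first.
      exact: cintegrable_inv_fourier.
    by rewrite -mulrA mulrC.
  rewrite fub.
  have ichR : intR (fun x => chi (h n *: x)).
    have [] := Rintegral_affine 0 (h0 n) ic.
    by under eq_fun do rewrite add0r.
  have tch : testfun (fun x => chi (h n *: x)) by exact: testfun_dilate.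
  have e3 xi : cintegral (F ^~ xi) = (psi xi)%:C * inv_fourier (fun x => chi (h n *: x)) (xi - xi0).
    rewrite -cintegralZ; last exact: cintegrable_inv_fourier.
    apply: eq_cintegral => x; rewrite /F.
    have e4 : expi (dotp (xi - xi0) x) = expi (- dotp x xi0) * expi (dotp x xi).
      by rewrite dotpDl dotpNl !(dotpC _ x) addrC expiD.
    rewrite -[RHS]/((psi xi)%:C * ((chi (h n *: x))%:C * expi (dotp (xi - xi0) x))) e4.
    by ring.
  rewrite (eq_cintegral e3).
  have ii : cintegrable (fun xi => (psi xi)%:C * inv_fourier (fun x => chi (h n *: x)) (xi - xi0)).
    apply: (@cintegrable_bounded_mul _ _ _ _ Mp).
    - exact: cmeas_real (intR_meas ip).
    - by move=> x; rewrite normc_real.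
    have [] := @cintegral_shift R d (- xi0) _ (cintegrable_ift tch).
    by under eq_fun do rewrite addrC.
  have [i2 ->] := cintegral_affine xi0 (h0 n) ii.
  apply: (etrans (esym (cintegralZ _ i2))); apply: eq_cintegral => eta.
  rewrite (inv_fourier_dilate eta (h0 n) ic) [LHS]mulrCA.
  by rewrite [xi0 + _ - xi0]addrC addKr.
have L2 : ccvg I (cst_inv * (psi xi0)%:C).
  rewrite (_ : I = fun n =>
      cintegral (fun eta => (psi (xi0 + h n *: eta))%:C * inv_fourier chi eta)); last first.
    by apply/funext => n; exact: E2.
  rewrite mulrC -cintegralZ; last exact: cintegrable_ift.
  have [] // := @cintegral_dct R d
    (fun n eta => (psi (xi0 + h n *: eta))%:C * inv_fourier chi eta)
    (fun eta => (psi xi0)%:C * inv_fourier chi eta) (fun x => Mp * (Cc * weight x)).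
  - move=> n; split; last first.
    + move=> x; rewrite !Normc.normcM normc_real.
      by apply: ler_pM => //; rewrite ?normr_ge0 ?normc_ge0.
    + exact: intRZ.
    + apply: cmeasM => //; apply: cmeas_real.
      exact: (measurableT_comp (testfun_measurable tp) (measurable_rV_affine _ _)).
  - move=> eta; apply: ccvgM; last exact: ccvg_cst.
    apply: ccvg_real; apply: testfun_cvg => //; exact: coordcvg_dilate.
exact: ccvg_unique L1 L2.
Qed.

End inv.

Lemma Rintegral_indic_itv (r : R) : 0 <= r -> \int[leb]_t (\1_`[- r, r] t : R) = 2 * r.
Proof.
move=> r0; rewrite /Rintegral integral_indic// setIT; rewrite /= lebesgue_measure_itv/= lte_fin.
case: ltP => h; rewrite /= ?opprK; lra.
Qed.

Lemma Rintegral_box (r : R) : 0 <= r -> \int[mu]_x box r x = (2 * r) ^+ d.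
Proof.
move=> r0; have [_ ->] := @integral_tensor R d (fun=> \1_`[- r, r]) (fun _ => integrable_indic_itv _ _ _ _).
by rewrite Rintegral_indic_itv// prodr_const card_ord.
Qed.

Lemma box_le1 r (x : E) : box r x <= 1.
Proof. by apply: prodr_ile1 => i _; rewrite indicE ler0n lern1; case: (_ \in _). Qed.

(** Blow-up at x0: the integrals of f(x0 + x/n) over a fixed box vanish and converge
    to f(x0) times the volume of the box. *)
Lemma zero_of_integral0 (f : E -> R) (M : R) : intR f -> (forall x, 0 <= f x <= M) ->
  (forall u x, coordcvg u x -> (fun n => f (u n)) @ \oo --> f x) ->
  \int[mu]_x f x = 0 -> forall x, f x = 0.
Proof.
move=> fi fM fc f0 x0.
pose h (n : nat) : R := n.+1%:R^-1.
have h0 n : 0 < h n by rewrite invr_gt0.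
have hs n : \int[mu]_x f (x0 + h n *: x) = 0 /\ intR (fun x => f (x0 + h n *: x)).
  have [i2 e] := Rintegral_affine x0 (h0 n) fi; split => //.
  apply/eqP; move: e; rewrite f0 => /esym/eqP.
  by rewrite mulf_eq0 expf_eq0 gt_eqF// andbF.
have ib := @intR_box R d 1.
have m1 n : measurable_fun setT (fun x => box 1 x * f (x0 + h n *: x)).
  by apply: measurable_funM; [exact: intR_meas ib|exact: intR_meas (hs n).2].
have c1 x : (fun n => box 1 x * f (x0 + h n *: x)) @ \oo --> box 1 x * f x0.
  apply: cvgM; first exact: cvg_cst.
  exact/fc/coordcvg_dilate.
have b1 n x : `|box 1 x * f (x0 + h n *: x)| <= M * box 1 x.
  have /andP[f1 f2] := fM (x0 + h n *: x).
  by rewrite ger0_norm ?mulr_ge0 ?box_ge0// mulrC ler_wpM2r ?box_ge0.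
have [_] := Rintegral_dct m1 c1 (intRZ M ib) b1.
rewrite (_ : (fun n => _) = cst 0); last first.
  apply/funext => n /=; have [e i2] := hs n.
  apply/eqP; rewrite eq_le; apply/andP; split; last first.
    apply: Rintegral_ge0 => x _; rewrite mulr_ge0 ?box_ge0//.
    by have /andP[] := fM (x0 + h n *: x).
  rewrite -[leRHS]e; apply: le_Rintegral => //.
    apply: (integrable_dominated _ i2).
      by apply: measurable_funM; [exact: intR_meas ib|exact: intR_meas i2].
    move=> x; have /andP[f1 f2] := fM (x0 + h n *: x).
    by rewrite ger0_norm ?mulr_ge0 ?box_ge0// ler_piMl// box_le1.
  move=> x _; have /andP[f1 f2] := fM (x0 + h n *: x).
  by rewrite ler_piMl// box_le1.
move=> /(cvg_lim (@Rhausdorff R)); rewrite lim_cst// => /esym.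
under eq_Rintegral do rewrite mulrC.
rewrite RintegralZl// Rintegral_box// => /eqP.
by rewrite mulf_eq0 expf_eq0 mulr1 (_ : (2 : R) == 0 = false) ?andbF ?orbF ?pnatr_eq0// => /eqP.
Qed.

End inversion.

(** * The inversion constant is not zero *)

Section nonvanishing.
Context {R : realType} {d : nat}.
Local Notation E := 'rV[R]_d.
Local Notation mu := (@lebesgue_rV R d).
Local Notation intR := (fun B : E -> R => mu.-integrable [set: E] (EFin \o B)).
Implicit Types (f g psi phi : E -> R).

Lemma enorm_sqr (x : E) : enorm x ^+ 2 = \sum_i x ord0 i ^+ 2.
Proof.
rewrite sqr_sqrtr; first by apply: eq_bigr => i _; rewrite expr2.
by apply: sumr_ge0 => i _; rewrite -expr2 sqr_ge0.
Qed.

Lemma enorm_ge0 (x : E) : 0 <= enorm x.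
Proof. exact: sqrtr_ge0. Qed.

Lemma coord_le_enorm (x : E) i : `|x ord0 i| <= enorm x.
Proof.
rewrite -(@ler_pXn2r _ 2)// ?nnegrE ?enorm_ge0// enorm_sqr -normrX ger0_norm ?sqr_ge0//.
by rewrite (bigD1 i)//= lerDl sumr_ge0// => j _; rewrite sqr_ge0.
Qed.

Lemma norm_le_enorm (x : E) : `|x| <= enorm x.
Proof. by apply: rV_norm_le; [exact: enorm_ge0|exact: coord_le_enorm]. Qed.

Lemma lp_cutoff_testfun phi : lp_cutoff phi -> testfun phi.
Proof.
move=> [sp _ p2]; split; first exact: smooth_Cinf.
by exists 2 => x h; apply: p2; exact: (le_trans h (norm_le_enorm x)).
Qed.

Lemma lp_cutoff0 phi : lp_cutoff phi -> phi 0 = 1.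
Proof.
move=> [_ p1 _]; apply: p1; rewrite -(@ler_pXn2r _ 2)// ?nnegrE ?enorm_ge0//.
by rewrite enorm_sqr big1 ?expr1n// => i _; rewrite mxE expr0n.
Qed.

Lemma Re_mul_conj (z : R[i]) : Re (z * z^*) = normc z ^+ 2.
Proof.
case: z => a b; rewrite Re_mul normcReIm /= sqr_sqrtr; last by rewrite addr_ge0 ?sqr_ge0.
by rewrite !expr2 mulrN opprK.
Qed.

Lemma inv_fourier_conj psi (x : E) : intR psi ->
  inv_fourier psi (- x) = (inv_fourier psi x)^*.
Proof.
move=> ip; have [r i] := cintegrable_inv_fourier x ip.
apply: complex_eq => /=.
  apply: eq_Rintegral => xi _; rewrite !mul0r !subr0 dotpNl mulrN cosN//.
rewrite -mulN1r -RintegralZl//; apply: eq_Rintegral => xi _.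
by rewrite !mul0r !addr0 dotpNl mulrN sinN mulrN mulN1r.
Qed.

Lemma expiN_sum (t : R) : expi t + expi (- t) = (2 * cos (2 * pi * t))%:C.
Proof.
apply: complex_eq; rewrite ?Re_add ?Im_add/= mulrN ?cosN ?sinN ?subrr//.
by ring.
Qed.

(** Multiplication by a trigonometric polynomial on the frequency side is a
    combination of translations. *)
Lemma inv_fourier_oneDcos f (a x : E) : intR f ->
  inv_fourier (fun xi => f xi * (1 + cos (2 * pi * dotp a xi))) x =
  inv_fourier f x + 2^-1%:C * (inv_fourier f (x + a) + inv_fourier f (x - a)).
Proof.
move=> fi.
have i0 := cintegrable_inv_fourier x fi.
have i1 := cintegrable_inv_fourier (x + a) fi.
have i2 := cintegrable_inv_fourier (x - a) fi.
rewrite {2 3 4}/inv_fourier -(cintegralD i1 i2) -(cintegralZ _ (cintegrableD i1 i2)).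
rewrite -(cintegralD i0 (cintegrableZ _ (cintegrableD i1 i2))).
apply: eq_cintegral => xi.
rewrite -[X in X = _]/((f xi * (1 + cos (2 * pi * dotp a xi)))%:C * expi (dotp x xi)).
rewrite -[X in _ = X]/((f xi)%:C * expi (dotp x xi) +
   2^-1%:C * ((f xi)%:C * expi (dotp (x + a) xi) + (f xi)%:C * expi (dotp (x - a) xi))).
rewrite !dotpDl dotpNl !expiD.
have -> : (f xi * (1 + cos (2 * pi * dotp a xi)))%:C = (f xi)%:C *
   (1 + 2^-1%:C * (expi (dotp a xi) + expi (- dotp a xi))).
  by rewrite expiN_sum; apply: complex_eq => /=; field.
by ring.
Qed.

Lemma intR_oneDcos f (a : E) : intR f ->
  intR (fun xi => f xi * (1 + cos (2 * pi * dotp a xi))).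
Proof.
move=> fi; apply: (integrable_dominated _ (intRZ 2 (intR_norm fi))).
  apply: measurable_funM; first exact: intR_meas fi.
  apply: measurable_funD => //.
  by have [] := cmeas_expi (measurable_dotp a).
move=> x; rewrite normrM mulrC ler_wpM2r// ger0_norm; last first.
  by rewrite -lerBlDl sub0r cos_geN1.
by rewrite [leRHS](_ : 2 = 1 + 1)// lerD2l cos_le1.
Qed.

(** One plus a cosine whose period is so long that it decreases on [0, 2], where the
    cutoff lives. *)
Definition bump1 (t : R) : R := 1 + cos (2 * pi * (8^-1 * t)).

Lemma bump1_ge0 t : 0 <= bump1 t.
Proof. by rewrite /bump1 -lerBlDl sub0r cos_geN1. Qed.

Lemma bump1_le2 t : bump1 t <= 2.
Proof. by rewrite /bump1 [leRHS](_ : 2 = 1 + 1)// lerD2l cos_le1. Qed.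

Lemma bump1_anti s t : `|s| <= `|t| -> `|t| <= 2 -> bump1 t <= bump1 s.
Proof.
move=> st t2; rewrite /bump1 lerD2l leNgt -cos_norm -[X in _ < X]cos_norm.
have pi0 := @pi_gt0 R.
have h (y : R) : `|2 * pi * (8^-1 * y)| = 2 * pi * (8^-1 * `|y|).
  by rewrite !normrM (gtr0_norm pi0) (@ger0_norm _ 2)// (@ger0_norm _ 8^-1)// invr_ge0.
have ht := ler_wpM2l (ltW pi0) t2; have ht0 := mulr_ge0 (ltW pi0) (normr_ge0 t).
have hs := ler_wpM2l (ltW pi0) st; have hs0 := mulr_ge0 (ltW pi0) (normr_ge0 s).
rewrite ltr_cos ?h ?in_itv/=; [by apply/negP; lra|by apply/andP; split; lra..].
Qed.

Lemma bump1_lt2 t : 0 < t <= 2 -> bump1 t < 2.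
Proof.
move=> /andP[t0 t2]; rewrite /bump1 [ltRHS](_ : 2 = 1 + cos 0); last by rewrite cos0.
have pi0 := @pi_gt0 R.
have ht := ler_wpM2l (ltW pi0) t2; have ht0 := mulr_gt0 pi0 t0.
by rewrite ltrD2l ltr_cos ?in_itv/=; [lra|apply/andP; split; lra..].
Qed.

(** A trigonometric polynomial with its largest value 2^d at the origin; its powers
    concentrate there. *)
Definition bumpd (x : E) : R := \prod_i bump1 (x ord0 i).

Lemma inv_fourier_bumps f (s : seq 'I_d) : intR f -> (forall x, inv_fourier f x = 0) ->
  intR (fun xi => f xi * \prod_(i <- s) bump1 (xi ord0 i)) /\
  forall x, inv_fourier (fun xi => f xi * \prod_(i <- s) bump1 (xi ord0 i)) x = 0.
Proof.
move=> fi f0; elim: s => [|i s [ih1 ih2]].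
  rewrite (_ : (fun xi => f xi * _) = f); first by split.
  by apply/funext => xi; rewrite big_nil mulr1.
pose a : E := 8^-1 *: evec i.
have E1 : (fun xi : E => f xi * \prod_(j <- (i :: s)) bump1 (xi ord0 j)) =
   (fun xi => (f xi * \prod_(j <- s) bump1 (xi ord0 j)) * (1 + cos (2 * pi * dotp a xi))).
  apply/funext => xi; rewrite big_cons mulrCA mulrC; congr (_ * _).
  by rewrite /bump1 /a dotpZl dotpC dotp_evec.
rewrite E1; split; first exact: (intR_oneDcos a ih1).
by move=> x; rewrite inv_fourier_oneDcos// !ih2 addr0 mulr0 addr0.
Qed.

(** If the inverse transform of phi were 0, so would be that of phi times any power
    of bumpd, and in particular phi * bumpd^N would have integral 0.  But phi = 1
    near the origin, where bumpd is largest: on a small box the power is at least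
    alpha^N, while at points where phi may be negative it is at most beta^N, with
    beta < alpha. *)
Lemma inv_fourier_neq0 phi : (0 < d)%N -> lp_cutoff phi ->
  ~ (forall x, inv_fourier phi x = 0).
Proof.
move=> d0 lp f0; have [_ p1 p2] := lp.
have ip := testfun_intR (lp_cutoff_testfun lp).
pose b : R := bump1 d%:R^-1.
have dR : 0 < d%:R :> R by rewrite ltr0n.
have dV1 : d%:R^-1 <= 1 :> R by rewrite invf_le1// ler1n.
have b2 : b < 2 by rewrite bump1_lt2// invr_gt0 dR/= (le_trans dV1)// ler1n.
have b0 : 0 <= b := bump1_ge0 _.
(* a bound for bumpd when one coordinate is at least 1/d *)
pose beta : R := 2 ^+ d.-1 * b.
have beta0 : 0 <= beta by rewrite mulr_ge0// exprn_ge0.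
have betalt : beta < 2 ^+ d.
  by rewrite -[in ltRHS](prednK d0) exprSr ltr_pM2l// exprn_gt0.
have cb : (fun n : nat => bump1 n.+1%:R^-1 ^+ d) @ \oo --> (2 : R) ^+ d.
  have c1 : (fun n : nat => bump1 n.+1%:R^-1) @ \oo --> (2 : R).
    rewrite (_ : (2 : R) = 1 + cos (2 * pi * (8^-1 * 0))); last by rewrite !mulr0 cos0.
    apply: cvgD; first exact: cvg_cst.
    apply: continuous_cvg; first exact: continuous_cos.
    apply: cvgM; first exact: cvg_cst.
    by apply: cvgM; [exact: cvg_cst|exact: cvg_harmonic].
  elim: {betalt} d => [|k ih]; first by under eq_fun do rewrite expr0; exact: cvg_cst.
  by rewrite exprS; under eq_fun do rewrite exprS; exact: cvgM.
(* a box so small that bumpd exceeds beta on it and phi = 1 there *)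
have [n [nb nd]] : exists n : nat, beta < bump1 n.+1%:R^-1 ^+ d /\ (d <= n)%N.
  have := cvgr_gt _ cb _ betalt => -[m _ hm]; exists (maxn m d).
  by split; [apply: hm => /=; exact: leq_maxl|exact: leq_maxr].
pose delta : R := n.+1%:R^-1; pose alpha := bump1 delta ^+ d.
have de0 : 0 < delta by rewrite invr_gt0.
have ded : delta <= d%:R^-1 by rewrite lef_pV2 ?posrE// ler_nat leqW.
have al0 : 0 < alpha := le_lt_trans beta0 nb.
(* where phi can differ from 1, some coordinate exceeds 1/d *)
have small (xi : E) : (forall i, `|xi ord0 i| <= d%:R^-1) -> enorm xi <= 1.
  move=> h; rewrite -(@ler_pXn2r _ 2)// ?nnegrE ?enorm_ge0// enorm_sqr expr1n.
  apply: (@le_trans _ _ (\sum_(i < d) d%:R^-1)).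
    apply: ler_sum => i _; rewrite -[leLHS]ger0_norm ?sqr_ge0// normrX expr2.
    by rewrite -[leRHS]mulr1 ler_pM// (le_trans (h i)).
  by rewrite sumr_const card_ord -[leLHS]mulr_natr mulVf// gt_eqF.
have pw (N : nat) (xi : E) : alpha ^+ N * box delta xi - beta ^+ N * `|phi xi| <=
     phi xi * bumpd xi ^+ N.
  have bd0 : 0 <= bumpd xi by apply: prodr_ge0 => i _; exact: bump1_ge0.
  have boxE : ~ (forall i, - delta <= xi ord0 i <= delta) -> box delta xi = 0.
    move=> /existsNP[i hi].
    by rewrite /box (bigD1 i)//= indicE memNset ?mul0r//= in_itv/=.
  have [x1|x1] := leP (enorm xi) 1.
    rewrite p1// normr1 mul1r mulr1 lerBlDr ler_wpDr ?exprn_ge0//.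
    have [xd|xd] := pselect (forall i, - delta <= xi ord0 i <= delta); last first.
      by rewrite boxE// mulr0 exprn_ge0.
    apply: (@le_trans _ _ (alpha ^+ N)).
      by apply: ler_piMr; [exact/exprn_ge0/ltW|exact: box_le1].
    apply: lerXn2r; rewrite ?nnegrE ?(ltW al0)//.
    rewrite /alpha -[d in leLHS]card_ord -prodr_const; apply: ler_prod => i _.
    rewrite bump1_ge0/= bump1_anti// (gtr0_norm de0) ?ler_norml//.
    by rewrite (le_trans ded)// (le_trans dV1)// ler1n.
  rewrite boxE; last first.
    move=> h; move: x1; rewrite ltNge => /negP; apply; apply: small => i.
    by apply: le_trans ded; rewrite ler_norml.
  rewrite mulr0 sub0r; have [x2|x2] := leP 2 (enorm xi).
    by rewrite p2// normr0 mulr0 oppr0 mul0r.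
  have [j hj] : exists j, d%:R^-1 < `|xi ord0 j|.
    apply: contrapT => /forallNP h; move: x1; rewrite ltNge => /negP; apply.
    by apply: small => i; rewrite leNgt; apply/negP; exact: h.
  have bb : bumpd xi <= beta.
    rewrite /bumpd (bigD1 j)//= mulrC /beta; apply: ler_pM.
    - by apply: prodr_ge0 => i _; exact: bump1_ge0.
    - exact: bump1_ge0.
    - rewrite -[X in _ <= _ ^+ X](_ : #|predC1 j| = _); last by rewrite cardC1 card_ord.
      by rewrite -prodr_const; apply: ler_prod => i _; rewrite bump1_ge0 bump1_le2.
    - apply: bump1_anti; first by rewrite ger0_norm ?invr_ge0// ltW.
      exact: le_trans (coord_le_enorm _ _) (ltW x2).
  rewrite lerNl -mulNr; apply: (@le_trans _ _ (`|phi xi| * bumpd xi ^+ N)).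
    by rewrite ler_wpM2r ?exprn_ge0// -normrN ler_norm.
  by rewrite mulrC ler_wpM2r// lerXn2r ?nnegrE.
pose A := \int[mu]_x `|phi x|; pose B : R := (2 * delta) ^+ d.
have B0 : 0 < B by rewrite exprn_gt0// mulr_gt0.
have iA := intR_norm ip; have iB := @intR_box R d delta.
have key N : alpha ^+ N * B <= beta ^+ N * A.
  have [iN zN] := inv_fourier_bumps (copies N) ip f0.
  have EN : (fun xi => phi xi * \prod_(i <- copies N) bump1 (xi ord0 i)) =
      (fun xi => phi xi * bumpd xi ^+ N).
    by apply/funext => xi; rewrite big_copies.
  rewrite EN in iN zN.
  have z0 : \int[mu]_x (phi x * bumpd x ^+ N) = 0.
    have /(congr1 (@complex.Re R)) := zN 0; rewrite /= => z0.
    rewrite -[RHS]z0; apply: eq_Rintegral => xi _.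
    rewrite (_ : dotp 0 xi = 0); last by rewrite -(scale0r xi) dotpZl mul0r.
    by rewrite mulr0 cos0 sin0 mulr1 mul0r subr0.
  have -> : B = \int[mu]_x box delta x by rewrite Rintegral_box// ltW.
  rewrite -subr_le0 -[leRHS]z0 -!RintegralZl//.
  rewrite -RintegralB//; last 2 first.
  - exact: intRZ.
  - exact: intRZ.
  have iD := integrableB measurableT (intRZ (alpha ^+ N) iB) (intRZ (beta ^+ N) iA).
  apply: le_Rintegral => //.
have key2 N : B <= (beta / alpha) ^+ N * A.
  by rewrite expr_div_n mulrAC ler_pdivlMr ?(exprn_gt0 N al0)// mulrC; exact: key.
have cz : (fun N : nat => (beta / alpha) ^+ N * A) @ \oo --> 0 * A.
  apply: cvgM; last exact: cvg_cst.
  apply: cvg_expr; rewrite ger0_norm ?divr_ge0// ?(ltW al0)//.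
  by rewrite ltr_pdivrMr// mul1r.
have hB : B <= 0 * A by apply: (ler_cvg_to (cvg_cst B) cz); exact: nearW.
by move: hB; rewrite mul0r; apply/negP; rewrite -ltNge.
Qed.

Lemma sqr_bounds (a b : R) : 0 <= a -> a <= b -> 0 <= a ^+ 2 <= b ^+ 2.
Proof. by move=> a0 ab; rewrite sqr_ge0/= lerXn2r ?nnegrE// (le_trans a0). Qed.

(** With a vanishing constant the Fourier transform of inv_fourier phi is 0, and by
    Fubini so is the integral of its squared modulus.  A continuous function with
    this property is 0, which inv_fourier_neq0 excludes. *)
Lemma cst_inv_neq0 phi : (0 < d)%N -> lp_cutoff phi -> cst_inv phi <> 0.
Proof.
move=> d0 lp c0; apply: (inv_fourier_neq0 d0 lp).
have tp := lp_cutoff_testfun lp; have ip := testfun_intR tp.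
have [C C0 dp] := cdom_decay tp; have [mg iw bg] := dp.
have F0 xi : fourier (inv_fourier phi) xi = 0.
  by rewrite (inversion tp (lp_cutoff0 lp))// c0 mul0r.
pose F (x xi : E) : R[i] := inv_fourier phi x * ((phi xi)%:C * expi (dotp (- x) xi)).
have mF : cmeas (fun z : E * E => F z.1 z.2).
  apply: cmeasM; first exact: (cmeas_comp mg measurable_fst).
  apply: cmeasM; first exact: (cmeas_comp (cmeas_real (intR_meas ip)) measurable_snd).
  apply: cmeas_expi; under eq_fun do rewrite dotpNl.
  by apply: (@measurableT_comp _ _ _ _ _ _ (@GRing.opp R)) => //; exact: measurable_dotp2.
have bF x y : normc (F x y) <= (C * weight x) * `|phi y|.
  by rewrite !Normc.normcM normc_expi mulr1 normc_real ler_wpM2r.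
have [[iR _] fub] := cfubini mF iw (intR_norm ip) bF.
have e1 x : cintegral (F x) = inv_fourier phi x * inv_fourier phi (- x).
  exact: (cintegralZ _ (cintegrable_inv_fourier (- x) ip)).
have e2 xi : cintegral (F ^~ xi) = 0.
  have i2 : cintegrable (fun x => inv_fourier phi x * expi (- dotp x xi)).
    apply: (@cdom_cintegrable _ _ _ (fun x => C * weight x)); split; [|exact: iw|].
      by apply: cmeasM; [exact: mg|exact: cmeas_expi_dotp].
    by move=> x; rewrite Normc.normcM normc_expi mulr1.
  have := cintegralZ (phi xi)%:C i2.
  rewrite -[X in _ = _ * X]/(fourier (inv_fourier phi) xi) F0 mulr0 => <-.
  by apply: eq_cintegral => x; rewrite /F dotpNl mulrCA.
have e3 x : Re (cintegral (F x)) = normc (inv_fourier phi x) ^+ 2.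
  by rewrite e1 (inv_fourier_conj _ ip); exact: Re_mul_conj.
have sq0 := @zero_of_integral0 R d (fun x => normc (inv_fourier phi x) ^+ 2)
  ((2 * \int[mu]_xi `|phi xi|) ^+ 2).
move=> x; apply/eqP; rewrite -normc_eq0 -sqrf_eq0; apply/eqP; apply: sq0.
- exact: (eq_integrable measurableT _ _ (fun y _ => congr1 EFin (e3 y)) iR).
- by move=> y; exact: (sqr_bounds (normc_ge0 _) (inv_fourier_bound y ip)).
- move=> v y vy; have cn := ccvg_normc (inv_fourier_cvg ip vy).
  exact: (cvgM cn cn).
- transitivity (Re (cintegral (fun x => cintegral (F x)))).
    by apply: eq_Rintegral => y _; exact: esym (e3 y).
  by rewrite fub (eq_cintegral e2) cintegral_cst0.
Qed.

End nonvanishing.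

(** * Integrals of p-th powers and critical smoothness *)

Section pnorm.
Context {R : realType} {d : nat}.
Local Notation E := 'rV[R]_d.
Local Notation mu := (@lebesgue_rV R d).
Variables (p : R).
Hypotheses (p0 : 0 < p) (p1 : p <= 1).

Definition pint (F : E -> R) : \bar R := (\int[mu]_x (F x `^ p)%:E)%E.

Lemma pint_ge0 F : (0 <= pint F)%E.
Proof. by apply: integral_ge0 => x _; rewrite lee_fin powR_ge0. Qed.

Lemma LnormE (F : E -> R) : (forall x, 0 <= F x) ->
  Lnorm mu p%:E (fun x => (F x)%:E) = ((pint F) `^ p^-1)%E.
Proof.
move=> F0; rewrite unlock; apply: (congr1 (fun z => z `^ p^-1)%E).
by apply: eq_integral => x _; rewrite /= ger0_norm.
Qed.

Lemma measurable_powR_comp (F : E -> R) : measurable_fun setT F ->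
  measurable_fun setT (fun x => (F x `^ p)%:E).
Proof.
by move=> mF; apply/measurable_EFinP; apply: (measurableT_comp (measurable_powR p)).
Qed.

Lemma pint_le (F G : E -> R) : measurable_fun setT F -> measurable_fun setT G ->
  (forall x, 0 <= F x <= G x) -> (pint F <= pint G)%E.
Proof.
move=> mF mG FG; apply: ge0_le_integral => //.
- by move=> x _; rewrite lee_fin powR_ge0.
- exact: measurable_powR_comp.
- exact: measurable_powR_comp.
- move=> x _; have /andP[F0 FGx] := FG x; rewrite lee_fin.
  by apply: ge0_ler_powR; rewrite ?nnegrE ?(ltW p0) ?(le_trans F0 FGx).
Qed.

Lemma pint_affine (F : E -> R) (a : E) (c : R) : 0 < c -> measurable_fun setT F ->
  pint F = ((c ^+ d)%:E * pint (fun y => F (a + c *: y)%R))%E.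
Proof.
move=> c0 mF; rewrite /pint (@ge0_integral_rV_affine R d a c)//.
  exact: measurable_powR_comp.
by move=> x; rewrite lee_fin powR_ge0.
Qed.

Lemma pint_scale (F : E -> R) (k : R) : 0 <= k -> (forall x, 0 <= F x) ->
  measurable_fun setT F ->
  pint (fun x => k * F x) = ((k `^ p)%:E * pint F)%E.
Proof.
move=> k0 F0 mF; rewrite /pint; under eq_integral do rewrite powRM// EFinM.
rewrite ge0_integralZl//; first exact: measurable_powR_comp.
  by move=> x _; rewrite lee_fin powR_ge0.
by rewrite lee_fin powR_ge0.
Qed.

(** Concavity, in the form t^p >= t on [0, 1] applied to both shares of a + b. *)
Lemma powR_add_le (a b : R) : 0 <= a -> 0 <= b -> (a + b) `^ p <= a `^ p + b `^ p.
Proof.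
move=> a0 b0; have [->|a_neq0] := eqVneq a 0.
  by rewrite powR0 ?gt_eqF// !add0r.
have ab0 : 0 < a + b by rewrite ltr_pwDl// lt_neqAle eq_sym a_neq0.
have h (t : R) : 0 <= t -> t <= a + b -> (a + b) `^ p * (t / (a + b)) <= t `^ p.
  move=> t0 tab; have [->|t_neq0] := eqVneq t 0; first by rewrite mul0r mulr0 powR_ge0.
  have tp : 0 < t by rewrite lt_neqAle eq_sym t_neq0.
  have E : t `^ p = (a + b) `^ p * (t / (a + b)) `^ p.
    by rewrite -powRM ?divr_ge0 ?ltW// mulrCA mulfV ?gt_eqF// mulr1.
  rewrite E ler_wpM2l ?powR_ge0// ger1_powR// divr_gt0//= ler_pdivrMr// mul1r//.
have := lerD (h a a0 _) (h b b0 _); rewrite -mulrDr -mulrDl mulfV ?gt_eqF// mulr1.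
by apply; rewrite ?lerDl ?lerDr.
Qed.

Lemma powR_sum_le (I : Type) (r : seq I) (F : I -> R) : (forall i, 0 <= F i) ->
  (\sum_(i <- r) F i) `^ p <= \sum_(i <- r) F i `^ p.
Proof.
move=> F0; elim: r => [|i r ih]; first by rewrite !big_nil powR0 ?gt_eqF.
rewrite !big_cons; apply: (le_trans (powR_add_le _ _)) => //; first exact: sumr_ge0.
by rewrite lerD2l.
Qed.

Lemma pint_sum_le (I : Type) (r : seq I) (F : I -> E -> R) : (forall i x, 0 <= F i x) ->
  (forall i, measurable_fun setT (F i)) ->
  (pint (fun x => (\sum_(i <- r) F i x)%R) <= \sum_(i <- r) pint (F i))%E.
Proof.
move=> F0 mF.
apply: (@le_trans _ _ (\int[mu]_x (\sum_(i <- r) (F i x `^ p)%:E))%E).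
  apply: ge0_le_integral => //.
  - by move=> x _; rewrite lee_fin powR_ge0.
  - by apply: measurable_powR_comp; apply: measurable_sum.
  - by apply: emeasurable_sum => i; exact: measurable_powR_comp.
  - by move=> x _; rewrite sumEFin lee_fin powR_sum_le.
rewrite ge0_integral_sum//.
- by move=> i; exact: measurable_powR_comp.
- by move=> i x _; rewrite lee_fin powR_ge0.
Qed.

(** The weight 2^(j s) is exactly the factor by which the L^p quasi-norm changes
    under the dilation by 2^j that preserves the L^1 norm.  Each term of the Besov
    norm thus becomes a quantity without j. *)
Lemma critical_Lnorm (F : E -> R) (a : E) (j : nat) :
  (forall x, 0 <= F x) -> measurable_fun setT F ->
  ((2 `^ (j%:R * (d%:R * (p^-1 - 1))))%:E * Lnorm mu p%:E (fun x => (F x)%:E) =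
   pint (fun y => ((2 ^+ j) ^- d * F (a + (2 ^+ j)^-1 *: y))%R) `^ p^-1)%E.
Proof.
move=> F0 mF; rewrite LnormE//.
pose c : R := 2 ^+ j; have c0 : 0 < c by rewrite exprn_gt0.
have cV0 : 0 < c^-1 by rewrite invr_gt0.
rewrite (@pint_affine F a c^-1)// -/c.
have mFa : measurable_fun [set: E] (fun y : E => F (a + c^-1 *: y)).
  exact: (measurableT_comp mF (measurable_rV_affine _ _)).
rewrite pint_scale//; last by rewrite invr_ge0 exprn_ge0// ltW.
rewrite !poweRM ?pint_ge0 ?lee_fin ?powR_ge0 ?exprn_ge0 ?(ltW cV0)//.
rewrite muleA !poweR_EFin -EFinM; congr (_%:E * _)%E.
rewrite -powRrM mulfV ?gt_eqF// powRr1 ?invr_ge0 ?exprn_ge0 ?(ltW c0)//.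
rewrite powRrM powR_mulrn// -/c exprVn -powR_invn ?(ltW c0)// -powRrM -powRD; last first.
  by apply/implyP => _; rewrite gt_eqF.
by congr (_ `^ _); ring.
Qed.

(** Decay of order L with L p >= 1 makes the p-th power smaller than an integrable
    weight. *)
Lemma pint_decay psi : testfun psi ->
  exists2 N : R, 0 <= N & (pint (fun x => normc (inv_fourier psi x)) <= N%:E)%E.
Proof.
move=> tp; have [L hL] : exists L : nat, 1 <= L%:R * p.
  exists (Num.truncn p^-1).+1; rewrite -ler_pdivrMr// div1r ltW//.
  exact: truncnS_gt.
have [C C0 hC] := decay L tp.
have iw : (\int[mu]_x (@weight R d x)%:E < +oo)%E.
  have /integrableP[_] := @intR_weight R d; apply: le_lt_trans.
  by rewrite le_eqVlt; apply/orP; left; apply/eqP; apply: eq_integral => x _ /=;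
     rewrite ger0_norm// ltW// weight_gt0.
have mw : measurable_fun setT (@weight R d) := intR_meas (@intR_weight R d).
have mi : measurable_fun setT (fun x => normc (inv_fourier psi x)).
  exact: (cmeas_normc (cmeas_inv_fourier (testfun_intR tp))).
have w0 x : (0 <= (@weight R d x)%:E)%E by rewrite lee_fin ltW// weight_gt0.
pose W := fine (\int[mu]_x (@weight R d x)%:E)%E.
have WE : (\int[mu]_x (@weight R d x)%:E)%E = W%:E.
  by rewrite fineK// ge0_fin_numE// integral_ge0.
have W0 : 0 <= W by rewrite -lee_fin -WE integral_ge0.
exists (C `^ p * W); first by rewrite mulr_ge0 ?powR_ge0.
rewrite EFinM -WE -ge0_integralZl//; last 2 first.
- exact/measurable_EFinP.
- by rewrite lee_fin powR_ge0.
apply: ge0_le_integral => //.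
- by move=> x _; rewrite lee_fin powR_ge0.
- exact: measurable_powR_comp.
- by apply/measurable_EFinP; apply: measurable_funM.
move=> x _; rewrite lee_fin.
have wx := @weight_gt0 R d x.
apply: (@le_trans _ _ ((C * weight x ^+ L) `^ p)).
  apply: ge0_ler_powR; rewrite ?nnegrE ?(ltW p0) ?normc_ge0//.
  by rewrite mulr_ge0// exprn_ge0// ltW.
rewrite powRM ?exprn_ge0 ?(ltW wx)// ler_wpM2l ?powR_ge0//.
rewrite -powR_mulrn ?(ltW wx)// -powRrM ge1r_powR//.
by rewrite wx weight_le1.
Qed.

End pnorm.

(** * Littlewood-Paley multipliers and kernels *)

Section multipliers.
Context {R : realType} {d : nat}.
Local Notation E := 'rV[R]_d.
Local Notation mu := (@lebesgue_rV R d).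
Local Notation intR := (fun B : E -> R => mu.-integrable [set: E] (EFin \o B)).
Implicit Types psi : E -> R.
Variable phi0 : E -> R.
Hypothesis lp : lp_cutoff phi0.
Let tphi : testfun phi0 := lp_cutoff_testfun lp.
Local Notation c0 := (cst_inv phi0).
Local Notation m := (lp_multiplier phi0).

(** The common profile of all multipliers of index j >= 1, carried by the annulus
    1/2 <= |xi| <= 2. *)
Definition lp_annulus (xi : E) : R := phi0 xi - phi0 (2 *: xi).

Lemma testfun_annulus : testfun lp_annulus.
Proof.
have := testfunD tphi (testfunZ (-1) (testfun_dilate (ltr0n _ 2) tphi)).
rewrite (_ : _ \+ _ = lp_annulus)//; apply/funext => x /=.
by rewrite mulN1r.
Qed.

Lemma lp_multiplierS j : (0 < j)%N -> m j = fun xi => lp_annulus ((2 ^+ j)^-1 *: xi).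
Proof.
case: j => // j _; apply/funext => xi; rewrite /lp_multiplier /lp_annulus.
rewrite scalerA -!exprVn; congr (_ - phi0 (_ *: _)).
by rewrite exprS mulrA mulfV ?mul1r.
Qed.

Lemma testfun_multiplier j : testfun (m j).
Proof.
case: j => [|j]; first exact: tphi.
rewrite lp_multiplierS//; apply: testfun_dilate; last exact: testfun_annulus.
by rewrite invr_gt0 exprn_gt0.
Qed.

Lemma enormZ (c : R) (x : E) : 0 <= c -> enorm (c *: x) = c * enorm x.
Proof.
move=> c0; rewrite /enorm dotpZl dotpZr mulrA -expr2 sqrtrM ?sqr_ge0//.
by rewrite sqrtr_sqr ger0_norm.
Qed.

Lemma annulus_low xi : enorm xi <= 2^-1 -> lp_annulus xi = 0.
Proof.
move=> h; case: lp => _ p1 _; rewrite /lp_annulus !p1 ?subrr//.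
  by rewrite enormZ//; lra.
by lra.
Qed.

Lemma annulus_high xi : 2 <= enorm xi -> lp_annulus xi = 0.
Proof.
move=> h; case: lp => _ _ p2; rewrite /lp_annulus !p2 ?subrr//.
rewrite enormZ//; lra.
Qed.

Lemma annulus_unit xi : enorm xi = 1 -> lp_annulus xi = 1.
Proof.
move=> h; case: lp => _ p1 p2; rewrite /lp_annulus p1 ?h// p2 ?subr0//.
by rewrite enormZ// h mulr1.
Qed.

Lemma multiplier_high j xi : 2 ^+ j.+1 <= enorm xi -> m j xi = 0.
Proof.
case: j => [|j] h; first by case: lp => _ _; apply.
rewrite lp_multiplierS//; apply: annulus_high.
rewrite enormZ ?invr_ge0 ?exprn_ge0// mulrC ler_pdivlMr ?exprn_gt0//.
Qed.

Lemma multiplier_low j xi : enorm xi <= 2 ^+ j -> m j.+1 xi = 0.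
Proof.
move=> h; rewrite lp_multiplierS//; apply: annulus_low.
rewrite enormZ ?invr_ge0 ?exprn_ge0// mulrC ler_pdivrMr ?exprn_gt0//.
by rewrite exprS mulrA mulVf ?mul1r.
Qed.

(** The dyadic annuli of indices at distance 2 meet at most in their boundary. *)
Lemma multiplier_disjoint j k : (j.+2 <= k)%N -> forall xi, m j xi * m k xi = 0.
Proof.
case: k => [//|k]; rewrite ltnS => jk xi.
have [h|h] := leP (enorm xi) (2 ^+ k); first by rewrite (multiplier_low h) mulr0.
rewrite multiplier_high ?mul0r// (le_trans _ (ltW h))// ler_eXn2l//.
by rewrite ltr1n.
Qed.

Definition lp_kernel j : E -> R[i] := inv_fourier (m j).

(** All kernels of index j >= 1 are rescaled copies of this function. *)
Definition mother : E -> R[i] := inv_fourier lp_annulus.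

Lemma inv_fourier_dilateV psi (c : R) (x : E) : 0 < c -> intR psi ->
  inv_fourier (fun xi => psi (c^-1 *: xi)) x = (c ^+ d)%:C * inv_fourier psi (c *: x).
Proof.
move=> cp ip.
have ip2 : intR (fun xi => psi (c^-1 *: xi)).
  have cV : 0 < c^-1 by rewrite invr_gt0.
  have [] := Rintegral_affine 0 cV ip.
  by under eq_fun do rewrite add0r.
rewrite (inv_fourier_dilate x cp ip2); congr (_ * _).
congr (inv_fourier _ _); apply/funext => xi.
by rewrite scalerA mulVf ?scale1r// gt_eqF.
Qed.

Lemma lp_kernelE j x : (0 < j)%N ->
  lp_kernel j x = ((2 ^+ j) ^+ d)%:C * mother (2 ^+ j *: x).
Proof.
move=> j0; rewrite /lp_kernel lp_multiplierS// inv_fourier_dilateV ?exprn_gt0//.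
exact: testfun_intR testfun_annulus.
Qed.

Lemma cmeas_translate (h : E -> R[i]) (x : E) : cmeas h -> cmeas (fun y : E => h (x + y)).
Proof.
move=> mh; have mx := @measurable_rV_affine R d x 1.
have := cmeas_comp mh mx.
by rewrite (_ : h \o _ = fun y => h (x + y))//; apply/funext => y /=; rewrite scale1r.
Qed.

Lemma cmeas_reflect (h : E -> R[i]) (x : E) : cmeas h -> cmeas (fun y : E => h (x - y)).
Proof.
move=> mh; have mx := @measurable_rV_affine R d x (-1).
have := cmeas_comp mh mx.
by rewrite (_ : h \o _ = fun y => h (x - y))//; apply/funext => y /=; rewrite scaleN1r.
Qed.

Lemma bounded_inv_fourier psi : testfun psi ->
  exists2 M : R, 0 <= M & forall x, normc (inv_fourier psi x) <= M.
Proof.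
move=> tp; exists (2 * \int[mu]_xi `|psi xi|).
  by rewrite mulr_ge0// Rintegral_ge0.
by move=> x; exact: (inv_fourier_bound x (testfun_intR tp)).
Qed.

Lemma cintegrable_convol psi (f : E -> R[i]) x : testfun psi -> cintegrable f ->
  cintegrable (fun y => f y * inv_fourier psi (x - y)).
Proof.
move=> tp fi; have [M M0 hM] := bounded_inv_fourier tp.
have mi := cmeas_reflect x (cmeas_inv_fourier (testfun_intR tp)).
have := cintegrable_bounded_mul mi (fun y => hM _) fi.
by under eq_fun do rewrite mulrC.
Qed.

(** The convolution theorem, with the constant of the inversion formula. *)
Lemma convolution psi1 psi2 (a x : E) : testfun psi1 -> testfun psi2 ->
  cintegral (fun y => inv_fourier psi1 (y - a) * inv_fourier psi2 (x - y)) =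
  c0 * inv_fourier (psi1 \* psi2) (x - a).
Proof.
move=> t1 t2.
have ip2 := testfun_intR t2; have [C C0 d1] := cdom_decay t1; have [mg iw bg] := d1.
have ci1 := cintegrable_ift t1.
have iwa : intR (fun y => C * weight (y - a)).
  have [] := Rintegral_affine (- a) ltr01 iw.
  by under eq_fun do rewrite scale1r addrC.
have mga : cmeas (fun y : E => inv_fourier psi1 (y - a)).
  by have := cmeas_translate (- a) mg; under eq_fun do rewrite addrC.
pose F (y xi : E) : R[i] := inv_fourier psi1 (y - a) * ((psi2 xi)%:C * expi (dotp (x - y) xi)).
have mF : cmeas (fun z : E * E => F z.1 z.2).
  apply: cmeasM; first exact: (cmeas_comp mga measurable_fst).
  apply: cmeasM; first exact: (cmeas_comp (cmeas_real (intR_meas ip2)) measurable_snd).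
  apply: cmeas_expi; under eq_fun do rewrite dotpDl dotpNl.
  apply: measurable_funB; last exact: measurable_dotp2.
  exact: (measurableT_comp (measurable_dotp x) measurable_snd).
have bF y xi : normc (F y xi) <= (C * weight (y - a)) * `|psi2 xi|.
  by rewrite !Normc.normcM normc_expi mulr1 normc_real ler_wpM2r.
have [_ fub] := cfubini mF iwa (intR_norm ip2) bF.
have e1 y : cintegral (F y) = inv_fourier psi1 (y - a) * inv_fourier psi2 (x - y).
  exact: (cintegralZ _ (cintegrable_inv_fourier (x - y) ip2)).
rewrite -(eq_cintegral e1) fub.
have ie xi : cintegrable (fun z => inv_fourier psi1 z * expi (- dotp z xi)).
  apply: (@cdom_cintegrable _ _ _ (fun x => C * weight x)); split; [|exact: iw|].
    by apply: cmeasM; [exact: mg|exact: cmeas_expi_dotp].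
  by move=> z; rewrite Normc.normcM normc_expi mulr1; exact: bg.
have e2 xi : cintegral (F ^~ xi) = c0 * ((psi1 xi * psi2 xi)%:C * expi (dotp (x - a) xi)).
  have iF : cintegrable (F ^~ xi).
    apply: (@cdom_cintegrable _ _ _ (fun y => `|psi2 xi| * (C * weight (y - a)))); split.
    - apply: cmeasM; first exact: mga.
      apply: cmeasM; first exact: cmeas_cst.
      apply: cmeas_expi; under eq_fun do rewrite dotpDl dotpNl !(dotpC _ xi).
      by apply: measurable_funB; [exact: measurable_cst|exact: measurable_dotp].
    - exact: intRZ iwa.
    - by move=> y; rewrite [leRHS]mulrC; exact: bF.
  have [_ ->] := cintegral_shift a iF.
  transitivity (((psi2 xi)%:C * expi (dotp (x - a) xi)) * fourier (inv_fourier psi1) xi).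
    apply: etrans (cintegralZ _ (ie xi)).
    apply: eq_cintegral => z; rewrite /F.
    have -> : a + z - a = z by rewrite addrC addKr.
    have -> : dotp (x - (a + z)) xi = dotp (x - a) xi + - dotp z xi.
      by rewrite -dotpNl -(dotpDl (x - a) (- z)) opprD addrA.
    by rewrite expiD; ring.
  rewrite (inversion tphi (lp_cutoff0 lp) xi t1) rmorphM /=; ring.
rewrite (eq_cintegral e2).
exact: (cintegralZ _ (cintegrable_inv_fourier (x - a) (testfun_intR (testfunM t1 t2)))).
Qed.

End multipliers.

(** * Integrable functions as tempered distributions *)

Section test_functions.
Context {R : realType} {d : nat}.
Local Notation E := 'rV[R]_d.
Local Notation mu := (@lebesgue_rV R d).

Lemma schwartz_cmeas (g : E -> R[i]) : schwartz g -> cmeas g.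
Proof.
move=> [s1 s2 _]; split; apply: continuous_measurable_rV => x;
  apply: differentiable_continuous; [exact: (s1 [::])|exact: (s2 [::])].
Qed.

Lemma cpderiv_nil (g : E -> R[i]) x : cpderiv [::] g x = g x.
Proof. by apply: complex_eq. Qed.

Lemma schwartz_bounded (g : E -> R[i]) : schwartz g ->
  exists M : R, forall x, normc (g x) <= M.
Proof.
move=> [_ _ h]; have [M hM] := h 0%N [::]; exists M => x.
by have := hM x; rewrite expr0 mul1r cpderiv_nil.
Qed.

Lemma cintegrable_mul_schwartz (f g : E -> R[i]) : cintegrable f -> schwartz g ->
  cintegrable (fun x => f x * g x).
Proof.
move=> fi sg; have [M hM] := schwartz_bounded sg.
have := cintegrable_bounded_mul (schwartz_cmeas sg) hM fi.
by under eq_fun do rewrite mulrC.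
Qed.

(** The bound uses the Schwartz seminorm of order 0 only: |<f, g>| is at most
    2 |f|_1 sup |g|. *)
Lemma tempered_regular (f : E -> R[i]) : cintegrable f -> tempered (regular_distribution f).
Proof.
move=> fi; split.
  move=> a g h sg sh; rewrite /regular_distribution.
  have ig := cintegrable_mul_schwartz fi sg; have ih := cintegrable_mul_schwartz fi sh.
  transitivity (cintegral (fun x => a * (f x * g x) + f x * h x)).
    by apply: eq_cintegral => x; rewrite mulrDr mulrCA.
  rewrite cintegralD; [|exact: cintegrableZ|exact: ih].
  by rewrite cintegralZ.
have [mf iB _] := cintegrable_cdom fi.
exists (2 * \int[mu]_x normc (f x)), 0%N => g sg M hM.
have gM x : normc (g x) <= M.
  by have := hM [::] isT x; rewrite expr0 mul1r cpderiv_nil.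
have dd : cdom (fun x => f x * g x) (fun x => M * normc (f x)).
  split.
  - by apply: cmeasM; [exact: mf|exact: schwartz_cmeas].
  - exact: intRZ.
  - by move=> x; rewrite Normc.normcM mulrC ler_wpM2r// normc_ge0.
have := normc_cintegral dd.
by rewrite RintegralZl// mulrCA mulrC.
Qed.

End test_functions.

(** * Sums of translated kernels: the upper bound *)

Section upper_bound.
Context {R : realType} {d : nat}.
Local Notation E := 'rV[R]_d.
Local Notation mu := (@lebesgue_rV R d).
Implicit Types psi : E -> R.
Variable phi0 : E -> R.
Hypothesis lp : lp_cutoff phi0.
Local Notation c0 := (cst_inv phi0).
Local Notation m := (lp_multiplier phi0).
Local Notation K := (lp_kernel phi0).
Variables (p q : R).
Hypotheses (p0 : 0 < p) (p1 : p <= 1) (q0 : 0 < q).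
Local Notation s := (d%:R * (p^-1 - 1)).

(** The functions on which the partial sum operators are tested: M copies of one
    kernel, of the same amplitude lam. *)
Definition lp_sum (M : nat) (a : 'I_M -> E) (lam : R) (J : nat) (y : E) : R[i] :=
  lam%:C * \sum_(l < M) K J (y - a l).

Definition besov_term (T : (E -> R[i]) -> R[i]) (j : nat) : \bar R :=
  ((2 `^ (j%:R * s))%:E *
   Lnorm mu p%:E (fun x => (normc (lp_piece phi0 T j x))%:E))%E.

Lemma besov_normE T : besov_norm phi0 s p q T =
  ((\sum_(0 <= j <oo) (besov_term T j `^ q)) `^ q^-1)%E.
Proof. by []. Qed.

Lemma besov_term_ge0 T j : (0 <= besov_term T j)%E.
Proof.
rewrite /besov_term mule_ge0// ?lee_fin ?powR_ge0//.
by rewrite LnormE// ?poweR_ge0// => x; exact: normc_ge0.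
Qed.

Lemma cintegrable_translate (h : E -> R[i]) (a : E) : cintegrable h ->
  cintegrable (fun y : E => h (y - a)).
Proof.
move=> hi; have [+ _] := cintegral_shift (- a) hi.
by under eq_fun do rewrite addrC.
Qed.

Lemma cintegrable_kernel j : cintegrable (K j).
Proof. exact: cintegrable_ift (testfun_multiplier lp j). Qed.

Lemma cintegrable_lp_sum M (a : 'I_M -> E) lam J : cintegrable (lp_sum a lam J).
Proof.
apply: cintegrableZ; apply: cintegrable_sum => l.
exact: cintegrable_translate (cintegrable_kernel J).
Qed.

Lemma lp_piece_lp_sum M (a : 'I_M -> E) lam J j x :
  lp_piece phi0 (regular_distribution (lp_sum a lam J)) j x =
  (lam%:C * c0) * \sum_(l < M) inv_fourier (m J \* m j) (x - a l).
Proof.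
have tJ := testfun_multiplier lp J; have tj := testfun_multiplier lp j.
have i1 l : cintegrable (fun y => K J (y - a l) * K j (x - y)).
  apply: (cintegrable_convol x tj); exact: cintegrable_translate (cintegrable_kernel J).
transitivity (cintegral (fun y => lam%:C * \sum_(l < M) (K J (y - a l) * K j (x - y)))).
  by apply: eq_cintegral => y; rewrite /lp_sum -mulrA mulr_suml.
rewrite cintegralZ; last exact: cintegrable_sum.
rewrite cintegral_sum; last exact: i1.
rewrite -[RHS]mulrA [c0 * _]mulr_sumr; congr (_ * _); apply: eq_bigr => l _.
exact: (convolution lp (a l) x tJ tj).
Qed.

Lemma inv_fourier0 x : inv_fourier (fun _ : E => 0) x = 0.
Proof.
rewrite -[RHS](@cintegral_cst0 R d); apply: eq_cintegral => xi.
by rewrite mul0r.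
Qed.

Lemma pint0 : pint p (fun _ : E => 0) = 0%E.
Proof.
rewrite /pint; under eq_integral do rewrite powR0 ?gt_eqF//.
exact: integral0.
Qed.

(** The Fourier transforms of the two kernels have disjoint supports. *)
Lemma besov_term_far M (a : 'I_M -> E) lam J j : (j.+2 <= J)%N || (J.+2 <= j)%N ->
  besov_term (regular_distribution (lp_sum a lam J)) j = 0%E.
Proof.
move=> far; have mz : m J \* m j = fun=> 0.
  apply/funext => xi /=; case/orP: far => h.
    by rewrite mulrC multiplier_disjoint.
  by rewrite multiplier_disjoint.
rewrite /besov_term (_ : (fun x => _) = (fun=> 0%:E)).
  by rewrite LnormE// pint0 poweR0r ?mule0// invr_neq0// gt_eqF.
apply/funext => x; rewrite lp_piece_lp_sum mz big1 => [|l _]; last exact: inv_fourier0.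
by rewrite mulr0 normc_real normr0.
Qed.

(** The product of two neighbouring multipliers, rescaled; c is the quotient of the
    frequencies and takes the values 1, 2, 1/2. *)
Definition overlap (c : R) : E -> R := (fun xi => lp_annulus phi0 (c *: xi)) \* lp_annulus phi0.

Lemma testfun_overlap c : 0 < c -> testfun (overlap c).
Proof.
move=> cp; apply: testfunM; last exact: testfun_annulus.
by apply: testfun_dilate => //; exact: testfun_annulus.
Qed.

Lemma multiplier_overlap J j : (0 < J)%N -> (0 < j)%N ->
  m J \* m j = fun xi => overlap ((2 ^+ J) / 2 ^+ j) ((2 ^+ J)^-1 *: xi).
Proof.
move=> J0 j0; apply/funext => xi; rewrite /= !lp_multiplierS// /overlap/= mulrC.
congr (lp_annulus phi0 _ * _); rewrite scalerA; congr (_ *: _).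
by rewrite mulrAC mulfV ?mul1r// gt_eqF// exprn_gt0.
Qed.

(** After rescaling, the piece is a sum of M translates of one fixed function, and
    p-subadditivity gives M times the integral of the p-th power of that function. *)
Lemma besov_term_near (c : R) : 0 < c -> exists2 D : R, 0 <= D &
  forall M (a : 'I_M -> E) (lam : R) J j, 0 <= lam -> (0 < J)%N -> (0 < j)%N -> (j <= J.+1)%N ->
  2 ^+ J / 2 ^+ j = c ->
  (besov_term (regular_distribution (lp_sum a lam J)) j <=
   (lam * D * M%:R `^ p^-1)%:E)%E.
Proof.
move=> cp; have tc := testfun_overlap cp.
have [N N0 hN] := pint_decay p0 tc.
have s0 : 0 <= s by rewrite mulr_ge0// subr_ge0 invf_ge1.
exists (2 `^ s * normc c0 * N `^ p^-1).
  by rewrite !mulr_ge0 ?powR_ge0 ?normc_ge0.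
move=> M a lam J j lam0 J0 j0 jJ Jj.
have cJ : 0 < (2 : R) ^+ J by rewrite exprn_gt0.
pose F (x : E) : R := normc (lp_piece phi0 (regular_distribution (lp_sum a lam J)) j x).
have F0 x : 0 <= F x by exact: normc_ge0.
have FE x : F x = lam * normc c0 * normc (\sum_(l < M) inv_fourier (m J \* m j) (x - a l)).
  by rewrite /F lp_piece_lp_sum !Normc.normcM normc_real ger0_norm.
have itc := testfun_intR tc.
have mi := cmeas_inv_fourier itc.
have tt := testfunM (testfun_multiplier lp J) (testfun_multiplier lp j).
have mF : measurable_fun [set: E] F.
  rewrite (_ : F = fun x => lam * normc c0 * normc (\sum_(l < M) inv_fourier (m J \* m j) (x - a l)));
    last exact/funext.
  apply: measurable_funM; first exact: measurable_cst.
  apply: cmeas_normc; apply: cmeas_sum => l.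
  have := cmeas_translate (- a l) (cmeas_inv_fourier (testfun_intR tt)).
  by under eq_fun do rewrite addrC.
pose G (l : 'I_M) (y : E) : R := normc (inv_fourier (overlap c) (y - 2 ^+ J *: a l)).
have mG l : measurable_fun [set: E] (G l).
  apply: cmeas_normc; have := cmeas_translate (- (2 ^+ J *: a l)) mi.
  by under eq_fun do rewrite addrC.
have G0 l y : 0 <= G l y by exact: normc_ge0.
have FG y : (2 ^+ J) ^- d * F (0 + (2 ^+ J)^-1 *: y) <= lam * normc c0 * \sum_(l < M) G l y.
  rewrite FE mulrCA ler_wpM2l ?mulr_ge0 ?normc_ge0//.
  rewrite ler_pdivrMl ?exprn_gt0// mulr_sumr.
  apply: (le_trans (le_normc_sum _ _ _)); apply: ler_sum => l _.
  rewrite multiplier_overlap// Jj inv_fourier_dilateV// Normc.normcM normc_real.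
  rewrite ger0_norm ?exprn_ge0 ?(ltW cJ)// add0r scalerBr scalerA mulfV ?scale1r ?gt_eqF//.
rewrite /besov_term.
have wj : 2 `^ (j%:R * s) <= 2 `^ s * 2 `^ (J%:R * s) :> R.
  rewrite -powRD; last by rewrite pnatr_eq0 implybT.
  rewrite ler_powR ?ler1n// -{2}[s]mul1r -mulrDl ler_wpM2r//.
  by rewrite addrC natr1 ler_nat.
apply: (@le_trans _ _ ((2 `^ s)%:E * ((2 `^ (J%:R * s))%:E * Lnorm mu p%:E (fun x => (F x)%:E)))%E).
  rewrite muleA -EFinM; apply: lee_wpmul2r; last by rewrite lee_fin.
  by rewrite LnormE// poweR_ge0.
rewrite (critical_Lnorm p0 0 J F0 mF).
have bnd : (pint p (fun y => (2 ^+ J) ^- d * F (0 + (2 ^+ J)^-1 *: y))%R <=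
   ((lam * normc c0) `^ p * (M%:R * N))%:E)%E.
  apply: (@le_trans _ _ (pint p (fun y => (lam * normc c0 * \sum_(l < M) G l y)%R))).
    have msum : measurable_fun [set: E] (fun y => \sum_(l < M) G l y).
      by apply: measurable_sum => l; exact: mG.
    have mFa : measurable_fun [set: E] (fun y : E => F (0 + (2 ^+ J)^-1 *: y)).
      exact: (measurableT_comp mF (measurable_rV_affine _ _)).
    apply: (pint_le p0).
    - by apply: measurable_funM; [exact: measurable_cst|exact: mFa].
    - by apply: measurable_funM; [exact: measurable_cst|exact: msum].
    - by move=> y; rewrite FG andbT mulr_ge0 ?invr_ge0 ?exprn_ge0// ltW.
  have msum : measurable_fun [set: E] (fun y => \sum_(l < M) G l y).
    by apply: measurable_sum => l; exact: mG.
  have k0 : 0 <= lam * normc c0 by rewrite mulr_ge0 ?normc_ge0.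
  have sum0 y : 0 <= \sum_(l < M) G l y by apply: sumr_ge0 => l _; exact: G0.
  rewrite (pint_scale p k0 sum0 msum).
  rewrite EFinM; apply: lee_wpmul2l; first by rewrite lee_fin powR_ge0.
  apply: (le_trans (pint_sum_le p0 p1 _ G0 mG)).
  apply: (@le_trans _ _ (\sum_(l < M) N%:E)%E); last first.
    by rewrite sumEFin lee_fin sumr_const card_ord mulr_natl.
  apply: lee_sum => l _; apply: le_trans hN.
  rewrite [leRHS](@pint_affine _ _ p _ (- (2 ^+ J *: a l)) 1 ltr01 (cmeas_normc mi)).
  rewrite expr1n mul1e le_eqVlt; apply/orP; left; apply/eqP; apply: (congr1 (pint p)).
  by apply/funext => y; rewrite /G scale1r addrC.
apply: (@le_trans _ _ ((2 `^ s)%:E * (((lam * normc c0) `^ p * (M%:R * N))%:E `^ p^-1))%E).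
  apply: lee_wpmul2l; first by rewrite lee_fin powR_ge0.
  apply: gt0_ler_poweR => //; first by rewrite invr_ge0 ltW.
    by rewrite in_itv/= pint_ge0 leey.
  by rewrite in_itv/= lee_fin leey andbT mulr_ge0 ?powR_ge0// mulr_ge0.
rewrite poweR_EFin -EFinM lee_fin !powRM ?powR_ge0 ?mulr_ge0 ?normc_ge0//.
rewrite -!powRrM mulfV ?gt_eqF// !powRr1 ?mulr_ge0 ?normc_ge0//.
rewrite le_eqVlt; apply/orP; left; apply/eqP; ring.
all: exact: powR_ge0.
Qed.

Lemma three_consecutive (J j : nat) : (J < j)%N -> (j < J.+4)%N ->
  [|| j == J.+1, j == J.+2 | j == J.+3].
Proof. by lia. Qed.

(** Only the terms j = J - 1, J, J + 1 of the norm are different from 0. *)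
Lemma besov_upper : exists2 D : R, 0 < D &
  forall M (a : 'I_M -> E) (lam : R) J, 0 <= lam -> (2 <= J)%N ->
  (besov_norm phi0 s p q (regular_distribution (lp_sum a lam J)) <=
   (lam * D * M%:R `^ p^-1)%:E)%E.
Proof.
have [D1 D10 h1] := besov_term_near (ltr0n R 1).
have [D2 D20 h2] := besov_term_near (ltr0n R 2).
have hp : 0 < (2^-1 : R) by rewrite invr_gt0.
have [D3 D30 h3] := besov_term_near hp.
pose D := 1 + D1 + D2 + D3; have D0 : 0 < D by rewrite /D; lra.
(* three terms, each at most lam D M^(1/p) *)
exists (3 `^ q^-1 * D); first by rewrite mulr_gt0// powR_gt0.
move=> M a lam J lam0; case: J => [//|[//|J]] _.
set T := regular_distribution _.
pose B := lam * D * M%:R `^ p^-1.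
have B0 : 0 <= B by rewrite !mulr_ge0 ?powR_ge0// ltW.
have pw0 n : (2 : R) ^+ n != 0 by rewrite gt_eqF// exprn_gt0.
have k1 : (J.+1 <= J.+3)%N := leqW (leqnSn _).
have k2 : (J.+2 <= J.+3)%N := leqnSn _.
have k3 : (J.+3 <= J.+3)%N by [].
have le1 (D' : R) : 0 <= D' -> D' <= D -> ((lam * D' * M%:R `^ p^-1)%:E <= B%:E)%E.
  move=> D'0 D'D; rewrite lee_fin /B ler_wpM2r ?powR_ge0// ler_wpM2l//.
have bt j : (besov_term T j <= B%:E)%E /\
    ((j < J.+1)%N || (J.+4 <= j)%N -> besov_term T j = 0%E).
  have z : (j < J.+1)%N || (J.+4 <= j)%N -> besov_term T j = 0%E.
    by move=> h; apply: besov_term_far; rewrite !ltnS in h *.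
  split=> //; have [h|] := boolP ((j < J.+1)%N || (J.+4 <= j)%N).
    by rewrite z// lee_fin.
  rewrite negb_or -leqNgt -ltnNge => /andP[j1 j2].
  case/or3P: (three_consecutive j1 j2) => /eqP ->.
  - have e : 2 ^+ J.+2 / 2 ^+ J.+1 = 2 :> R by rewrite [X in X / _]exprS mulfK// pw0.
    apply: (le_trans (h2 M a lam J.+2 J.+1 lam0 isT isT k1 e)).
    by apply: le1 => //; rewrite /D; lra.
  - have e : 2 ^+ J.+2 / 2 ^+ J.+2 = 1 :> R by rewrite mulfV// pw0.
    apply: (le_trans (h1 M a lam J.+2 J.+2 lam0 isT isT k2 e)).
    by apply: le1 => //; rewrite /D; lra.
  - have e : 2 ^+ J.+2 / 2 ^+ J.+3 = 2^-1 :> R.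
      by rewrite [X in _ / X]exprS invfM mulrCA mulfV ?mulr1 ?pw0.
    apply: (le_trans (h3 M a lam J.+2 J.+3 lam0 isT isT k3 e)).
    by apply: le1 => //; rewrite /D; lra.
rewrite besov_normE.
have sumE : (\sum_(0 <= j <oo) (besov_term T j `^ q) =
    besov_term T J.+1 `^ q + besov_term T J.+2 `^ q + besov_term T J.+3 `^ q)%E.
  rewrite (nneseries_split 0 J.+4); last by move=> k _; exact: poweR_ge0.
  rewrite add0n [X in (_ + X)%E]eseries0 ?adde0; last first.
    move=> k /= hk _; have [_ ->] := bt k; rewrite ?poweR0r ?gt_eqF//.
    by rewrite hk orbT.
  do 3 rewrite big_nat_recr//=.
  rewrite big_nat_cond big1 ?add0e// => k /andP[/andP[_ hk] _].
  by have [_ ->] := bt k; rewrite ?poweR0r ?gt_eqF// hk.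
rewrite sumE.
have bq j : (besov_term T j `^ q <= (B `^ q)%:E)%E.
  rewrite -poweR_EFin; apply: gt0_ler_poweR; first exact: ltW.
  - by rewrite in_itv/= besov_term_ge0 leey.
  - by rewrite in_itv/= lee_fin B0 leey.
  - by have [] := bt j.
apply: (@le_trans _ _ (((3 * B `^ q)%:E) `^ q^-1)%E).
  apply: gt0_ler_poweR; first by rewrite invr_ge0 ltW.
  - by rewrite in_itv/= leey andbT !adde_ge0// poweR_ge0.
  - by rewrite in_itv/= lee_fin leey andbT mulr_ge0// powR_ge0.
  - rewrite (_ : 3 * B `^ q = B `^ q + B `^ q + B `^ q); last by ring.
    by rewrite !EFinD; apply: leeD; [apply: leeD|].
rewrite poweR_EFin lee_fin powRM ?powR_ge0// -powRrM mulfV ?gt_eqF// powRr1//.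
by rewrite /B le_eqVlt; apply/orP; left; apply/eqP; ring.
Qed.

End upper_bound.

(** * Haar coefficients of shrinking bumps *)

Section haar_limits.
Context {R : realType} {d : nat}.
Local Notation E := 'rV[R]_d.
Local Notation mu := (@lebesgue_rV R d).
Implicit Types (a : haar_index d).

Lemma haar1T (t : R) : haar1 true t = if (0 <= t < 2^-1) then 1 else if (2^-1 <= t < 1) then -1 else 0.
Proof.
rewrite /haar1/= !indicE !mem_setE !in_itv/=.
have [/andP[h1 h2]|_] := boolP (0 <= t < 2^-1); last by case: ifP => _; rewrite sub0r ?oppr0.
rewrite (_ : (2^-1 <= t) = false) ?subr0//; apply/negbTE; rewrite -ltNge//.
Qed.

Lemma haar1F (t : R) : haar1 false t = if (0 <= t < 1) then 1 else 0.
Proof. by rewrite /haar1/= !indicE !mem_setE !in_itv/=; case: ifP. Qed.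

Lemma haar1_out e (t : R) : (t < 0) || (1 <= t) -> haar1 e t = 0.
Proof.
move=> h; case: e; rewrite ?haar1T ?haar1F.
  case: ifPn => [/andP[]|_]; first by move: h => /orP[]; lra.
  by case: ifPn => [/andP[]|_//]; move: h => /orP[]; lra.
by case: ifPn => [/andP[]|_//]; move: h => /orP[]; lra.
Qed.

Lemma haar1_bound e (t : R) : `|haar1 e t| <= 1.
Proof.
by case: e; rewrite ?haar1T ?haar1F; do ?case: ifP => _; rewrite ?normrN ?normr1 ?normr0.
Qed.

Lemma measurable_haar1 e : measurable_fun [set: R] (haar1 e : R -> R).
Proof. by case: e => //=; apply: measurable_funB. Qed.

Lemma haar_bound a (x : E) : `|haar a x| <= 1.
Proof.
rewrite /haar normr_prod; apply: prodr_ile1 => i _.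
by rewrite normr_ge0 haar1_bound.
Qed.

Lemma measurable_haar a : measurable_fun [set: E] (haar a : E -> R).
Proof.
apply: measurable_prod => i _; apply: (measurableT_comp (measurable_haar1 _)).
apply: measurable_funB => //; apply: measurable_funM => //; exact: measurable_coord.
Qed.

(** The two values of the one-dimensional Haar profiles on the left and on the right
    of the midpoint of their support; on this scale the profile looks like a sign or
    like a constant. *)
Definition side (e : bool) (w : R) : R := if e then (if w < 0 then 1 else -1) else 1.

Lemma haar1_mid e (w : R) : `|w| < 2^-1 -> haar1 e (2^-1 + w) = side e w.
Proof.
rewrite ltr_norml => /andP[w1 w2]; case: e; rewrite ?haar1T ?haar1F /side.
  case: (ltP w 0) => w0.
    by rewrite ifT//; apply/andP; split; lra.
  rewrite ifF; last by apply/negP => /andP[]; lra.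
  by rewrite ifT//; apply/andP; split; lra.
by rewrite ifT//; apply/andP; split; lra.
Qed.

Lemma sideZ e (c w : R) : 0 < c -> side e (c * w) = side e w.
Proof. by move=> c0; rewrite /side pmulr_rlt0. Qed.

Lemma side_bound e w : `|side e w| <= 1.
Proof. by rewrite /side; case: e; [case: ifP|]; rewrite ?normrN normr1. Qed.

Lemma measurable_side e : measurable_fun [set: R] (side e).
Proof.
case: e; rewrite /side; last exact: measurable_cst.
apply: measurable_fun_ifT => //; exact: measurable_fun_ltr.
Qed.

(** Stability is required for both profiles at once; it is a property of the
    position relative to the dyadic points. *)
Definition locally_cst (v : R) := exists2 del : R, 0 < del &
  forall w, `|w| < del -> forall e, haar1 e (v + w) = haar1 e v.

Definition locally_zero (v : R) := exists2 del : R, 0 < del &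
  forall w, `|w| < del -> forall e, haar1 e (v + w) = 0.

Lemma locally_zero_out (v : R) : (v < 0) || (1 < v) -> locally_zero v.
Proof.
case/orP => h.
  exists (- v); first by rewrite oppr_gt0.
  by move=> w hw e; apply: haar1_out; move: hw; rewrite ltr_norml => /andP[? ?]; apply/orP; left; lra.
exists (v - 1); first by rewrite subr_gt0.
by move=> w hw e; apply: haar1_out; move: hw; rewrite ltr_norml => /andP[? ?]; apply/orP; right; lra.
Qed.

(** A fraction strictly between 0 and 1/2 stays away from the jumps at the integers
    and at the midpoints. *)
Lemma locally_cst_frac (z : int) (f : R) : 0 < f < 2^-1 -> locally_cst (z%:~R + f).
Proof.
move=> /andP[f0 f2]; have [->|z0] := eqVneq z 0.
  exists (Num.min f (2^-1 - f)); first by rewrite lt_min f0 subr_gt0.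
  move=> w; rewrite lt_min !ltr_norml => /andP[/andP[w1 w2] /andP[w3 w4]] e.
  case: e; rewrite ?haar1T ?haar1F !ifT//; apply/andP; split; lra.
have [del del0 h] : locally_zero (z%:~R + f).
  apply: locally_zero_out; case: (ltP z 0) => hz; apply/orP; [left|right].
    have : z%:~R <= -1 :> R by rewrite -[-1]/((-1)%:~R) ler_int; lia.
    by lra.
  have : 1 <= z%:~R :> R by rewrite -[1]/(1%:~R) ler_int; lia.
  by lra.
exists del => // w hw e; rewrite h// -[X in haar1 e X]addr0 h// normr0//.
Qed.

Lemma cvg_pow2 (c w : R) : (fun J : nat => c * ((2 ^+ J)^-1 * w)) @ \oo --> (0 : R).
Proof.
rewrite -[X in _ --> X](mulr0 c); apply: cvgM; first exact: cvg_cst.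
by rewrite -[X in _ --> X](mul0r w); apply: cvgM; [exact: cvg_inv2n|exact: cvg_cst].
Qed.

Section at_point.
Variables (a : haar_index d) (X : E).
Local Notation k := (haar_freq a).
(** The argument at which the i-th one-dimensional profile of a Haar function is
    evaluated at the point X. *)
Definition haar_arg (i : 'I_d) : R := 2 ^+ k * X ord0 i - (haar_shift a ord0 i)%:~R.

Lemma haar_near J (zt : E) : haar a (X + (2 ^+ J)^-1 *: zt) =
  \prod_(i < d) haar1 (haar_eps a i) (haar_arg i + 2 ^+ k * ((2 ^+ J)^-1 * zt ord0 i)).
Proof.
apply: eq_bigr => i _; rewrite !mxE; congr haar1; rewrite /haar_arg; ring.
Qed.

Lemma small_arg (zt : E) i (del : R) : 0 < del ->
  \forall J \near \oo, `|2 ^+ k * ((2 ^+ J)^-1 * zt ord0 i)| < del.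
Proof.
move=> d0; have /cvgr0_norm_lt := cvg_pow2 (2 ^+ k) (zt ord0 i).
exact.
Qed.

Lemma haar_limit_zero i (zt : E) : locally_zero (haar_arg i) ->
  (fun J => haar a (X + (2 ^+ J)^-1 *: zt)) @ \oo --> (0 : R).
Proof.
move=> [del d0 h]; apply: cvg_near_cst.
have := small_arg zt i d0; apply: filterS => J hJ.
by rewrite haar_near (bigD1 i)//= h// mul0r.
Qed.

Lemma haar_limit_cst (zt : E) : (forall i, locally_cst (haar_arg i)) ->
  (fun J => haar a (X + (2 ^+ J)^-1 *: zt)) @ \oo --> haar a X.
Proof.
move=> h; apply: cvg_near_cst.
have : \forall J \near \oo, forall i, haar1 (haar_eps a i)
    (haar_arg i + 2 ^+ k * ((2 ^+ J)^-1 * zt ord0 i)) = haar1 (haar_eps a i) (haar_arg i).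
  apply: filter_forall => i; have [del d0 hi] := h i.
  by have := small_arg zt i d0; apply: filterS => J hJ; exact: hi.
by apply: filterS => J hJ; rewrite haar_near; apply: eq_bigr => i _; exact: hJ.
Qed.

Lemma haar_limit_mid (zt : E) : (forall i, haar_arg i = 2^-1) ->
  (fun J => haar a (X + (2 ^+ J)^-1 *: zt)) @ \oo --> \prod_i side (haar_eps a i) (zt ord0 i).
Proof.
move=> h; apply: cvg_near_cst.
have : \forall J \near \oo, forall i, `|2 ^+ k * ((2 ^+ J)^-1 * zt ord0 i)| < 2^-1.
  by apply: filter_forall => i; apply: small_arg; rewrite invr_gt0.
apply: filterS => J hJ; rewrite haar_near; apply: eq_bigr => i _.
rewrite h haar1_mid// mulrA sideZ//.
Qed.

End at_point.

Section coefficients.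
Variables (phi0 : E -> R) (lp : lp_cutoff phi0) (i0 : 'I_d).
Local Notation c0 := (cst_inv phi0).
Local Notation g := (mother phi0).
Local Notation K := (lp_kernel phi0).

Lemma cintegrable_mother : cintegrable g.
Proof. exact: cintegrable_ift (testfun_annulus lp). Qed.

Lemma fourier_mother xi : fourier g xi = c0 * (lp_annulus phi0 xi)%:C.
Proof. exact: (inversion (lp_cutoff_testfun lp) (lp_cutoff0 lp) xi (testfun_annulus lp)). Qed.

(** The integral is the Fourier transform at 0, where the annulus function vanishes. *)
Lemma cintegral_mother : cintegral g = 0.
Proof.
have := fourier_mother 0; rewrite annulus_low// => [|]; last first.
  rewrite (_ : enorm 0 = 0) ?invr_ge0// /enorm /dotp big1 ?sqrtr0// => i _.
  by rewrite mxE mul0r.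
rewrite mulr0 => <-; apply: eq_cintegral => x.
by rewrite /dotp big1 ?oppr0 ?expi0 ?mulr1// => i _; rewrite mxE mulr0.
Qed.

Lemma cintegral_pairing (f : E -> R[i]) (h : nat -> E -> R) (l : E -> R) : cintegrable f ->
  (forall n, measurable_fun setT (h n)) -> (forall n x, `|h n x| <= 1) ->
  (forall x, (fun n => h n x) @ \oo --> l x) ->
  ccvg (fun n => cintegral (fun x => f x * (h n x)%:C)) (cintegral (fun x => f x * (l x)%:C)).
Proof.
move=> fi mh h1 hl; have [mf iB _] := cintegrable_cdom fi.
have [] // := @cintegral_dct R d (fun n x => f x * (h n x)%:C) (fun x => f x * (l x)%:C)
  (fun x => normc (f x)).
- move=> n; split; [|exact: iB|].
    by apply: cmeasM; [exact: mf|exact: cmeas_real (mh n)].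
  move=> x; rewrite Normc.normcM normc_real ler_piMr ?normc_ge0//; exact: h1.
- move=> x; apply: ccvgM; [exact: ccvg_cst|exact: ccvg_real (hl x)].
Qed.

Definition haar_coef (f : E -> R[i]) a := cintegral (fun y => f y * (haar a y)%:C).

Lemma cintegrable_mul_haar (f : E -> R[i]) a : cintegrable f ->
  cintegrable (fun y => f y * (haar a y)%:C).
Proof.
move=> fi.
have mh : cmeas (fun y : E => (haar a y)%:C) := cmeas_real (measurable_haar a).
have h1 (y : E) : normc (haar a y)%:C <= 1 by rewrite normc_real haar_bound.
have := cintegrable_bounded_mul mh h1 fi.
by under eq_fun do rewrite mulrC.
Qed.

(** The bump of frequency 2^J around X, moved by v on its own scale, tests the Haar
    function in a window of size 2^-J around X. *)
Lemma haar_coef_kernel a J (X v : E) : (0 < J)%N ->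
  haar_coef (fun y => K J (y - (X + (2 ^+ J)^-1 *: v))) a =
  cintegral (fun z => g z * (haar a (X + (2 ^+ J)^-1 *: (v + z)))%:C).
Proof.
move=> J0; have ik := cintegrable_translate (X + (2 ^+ J)^-1 *: v) (cintegrable_kernel lp J).
have cJ : 0 < (2 : R) ^+ J by rewrite exprn_gt0.
have cV : 0 < ((2 : R) ^+ J)^-1 by rewrite invr_gt0.
have [i2 e] := cintegral_affine (X + (2 ^+ J)^-1 *: v) cV (cintegrable_mul_haar a ik).
rewrite /haar_coef e -(cintegralZ _ i2); apply: eq_cintegral => z.
rewrite [X + _ + _ - _]addrC addKr lp_kernelE// scalerA mulfV ?gt_eqF// scale1r.
rewrite scalerDr addrA mulrA mulrA -rmorphM/= exprVn mulVf ?mul1r//.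
Qed.

(** Once the Haar function has a limit in the rescaled window around X, dominated
    convergence passes to the limit under the integral against the fixed kernel. *)
Lemma haar_coef_limit a (X v : E) (l : E -> R) :
  (forall zt, (fun J => haar a (X + (2 ^+ J)^-1 *: zt)) @ \oo --> l zt) ->
  ccvg (fun J => haar_coef (fun y => K J.+1 (y - (X + (2 ^+ J.+1)^-1 *: v))) a)
    (cintegral (fun z => g z * (l (v + z))%:C)).
Proof.
move=> hl.
rewrite (_ : (fun J => _) = fun J => cintegral (fun z =>
  g z * (haar a (X + (2 ^+ J.+1)^-1 *: (v + z)))%:C)); last first.
  by apply/funext => J; exact: haar_coef_kernel.
apply: cintegral_pairing.
- exact: cintegrable_mother.
- move=> J; have := measurableT_comp (measurable_haar a)
     (measurableT_comp (@measurable_rV_affine R d X (2 ^+ J.+1)^-1) (@measurable_rV_affine R d v 1)).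
  apply: eq_measurable_fun => z _ /=; by rewrite scale1r.
- by move=> J z; exact: haar_bound.
- move=> z; have := hl (v + z); rewrite -(cvg_shiftS (fun J => haar a (X + (2 ^+ J)^-1 *: (v + z)))).
  exact.
Qed.

Definition tensor_side (e : {ffun 'I_d -> bool}) (zt : E) : R := \prod_i side (e i) (zt ord0 i).

(** The limit of the coefficients at the midpoint of the support, where the Haar
    function looks like a product of signs; t is the displacement of the bump along
    one axis, measured in its own scale. *)
Definition central_coef (t : R) (e : {ffun 'I_d -> bool}) : R[i] :=
  cintegral (fun z => g z * (tensor_side e (t *: evec i0 + z))%:C).

Lemma haar_coef_limit_mid a (X : E) t : (forall i, haar_arg a X i = 2^-1) ->
  ccvg (fun J => haar_coef (fun y => K J.+1 (y - (X + (2 ^+ J.+1)^-1 *: (t *: evec i0)))) a)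
    (central_coef t (haar_eps a)).
Proof. by move=> h; apply: haar_coef_limit => zt; exact: haar_limit_mid. Qed.

(** The kernel has integral 0, so a function which is constant near X is not seen. *)
Lemma haar_coef_limit_cst a (X v : E) : (forall i, locally_cst (haar_arg a X i)) ->
  ccvg (fun J => haar_coef (fun y => K J.+1 (y - (X + (2 ^+ J.+1)^-1 *: v))) a) 0.
Proof.
move=> h; have := haar_coef_limit v (fun zt => haar_limit_cst zt h).
have -> : cintegral (fun z => g z * (haar a X)%:C) = 0; last by [].
have := cintegralZ (haar a X)%:C cintegrable_mother; rewrite cintegral_mother mulr0 => <-.
by apply: eq_cintegral => z; rewrite mulrC.
Qed.

Lemma haar_coef_limit_zero a (X v : E) i : locally_zero (haar_arg a X i) ->
  ccvg (fun J => haar_coef (fun y => K J.+1 (y - (X + (2 ^+ J.+1)^-1 *: v))) a) 0.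
Proof.
move=> h; have := haar_coef_limit v (fun zt => haar_limit_zero zt h).
have -> // : cintegral (fun z => g z * 0%:C) = 0.
rewrite -[RHS](@cintegral_cst0 R d); apply: eq_cintegral => z.
exact: mulr0.
Qed.

(** The type of the Haar functions that oscillate in one direction only. *)
Definition unit_eps : {ffun 'I_d -> bool} := [ffun i => i == i0].

Lemma tensor_side_unit t z : tensor_side unit_eps (t *: evec i0 + z) = side true (z ord0 i0 + t).
Proof.
rewrite /tensor_side (bigD1 i0)//= big1 => [|i ii]; last by rewrite ffunE (negbTE ii).
by rewrite ffunE eqxx mulr1 !mxE !eqxx/= mulr1 addrC.
Qed.

Definition sign_pairing (h : R -> R) : R[i] :=
  cintegral (fun z => inv_fourier phi0 z * (h (z ord0 i0))%:C).

Let tphi : testfun phi0 := lp_cutoff_testfun lp.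

(** The annulus function is the difference of two dilates of the cutoff, and so is
    its inverse transform. *)
Lemma mother_split z : g z = inv_fourier phi0 z - (2^-1 ^+ d)%:C * inv_fourier phi0 (2^-1 *: z).
Proof.
have ip := testfun_intR tphi.
have t2 : testfun (fun xi => phi0 (2 *: xi)) by exact: testfun_dilate.
have h2 : 0 < (2^-1 : R) by rewrite invr_gt0.
have := inv_fourier_dilateV z h2 ip; rewrite invrK => <-.
have := inv_fourier_lin 1 (-1) z ip (testfun_intR t2).
rewrite (_ : (fun xi => _) = lp_annulus phi0); last first.
  by apply/funext => xi; rewrite mul1r mulN1r.
by move=> e; apply: (etrans e); rewrite rmorphN1 rmorph1 mul1r mulN1r.
Qed.

Lemma cintegrable_sign (h : R -> R) : measurable_fun setT h -> (forall t, `|h t| <= 1) ->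
  cintegrable (fun z : E => inv_fourier phi0 z * (h (z ord0 i0))%:C).
Proof.
move=> mh h1.
have mh2 : cmeas (fun z : E => (h (z ord0 i0))%:C).
  apply: cmeas_real; exact: (measurableT_comp mh (measurable_coord i0)).
have b (z : E) : normc (h (z ord0 i0))%:C <= 1 by rewrite normc_real h1.
have := cintegrable_bounded_mul mh2 b (cintegrable_ift tphi).
by under eq_fun do rewrite mulrC.
Qed.

Lemma measurable_side_shift t : measurable_fun [set: R] (fun u => side true (u + t)).
Proof.
apply: (measurableT_comp (measurable_side true)).
by apply: measurable_funD.
Qed.

(** The sign is invariant under dilations, so the two terms of mother_split give the
    same function of the displacement at t and at t / 2. *)
Lemma central_coef_unit t : central_coef t unit_eps =
  sign_pairing (fun u => side true (u + t)) - sign_pairing (fun u => side true (u + t / 2)).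
Proof.
have m1 := measurable_side_shift t; have m2 := measurable_side_shift (t / 2).
have b1 u : `|side true (u + t)| <= 1 by exact: side_bound.
have b2 u : `|side true (u + t / 2)| <= 1 by exact: side_bound.
have i1 := cintegrable_sign m1 b1; have i2 := cintegrable_sign m2 b2.
have h2 : 0 < (2^-1 : R) by rewrite invr_gt0.
have [i3 e3] := cintegral_affine 0 h2 i2.
have E3 : (fun x : E => inv_fourier phi0 (0 + 2^-1 *: x) * (side true ((0 + 2^-1 *: x) ord0 i0 + t / 2))%:C)
   = (fun x : E => inv_fourier phi0 (2^-1 *: x) * (side true (x ord0 i0 + t))%:C).
  apply/funext => x; rewrite add0r; congr (_ * (_)%:C).
  by rewrite !mxE mulrC [t / 2]mulrC [x ord0 i0 * _]mulrC -mulrDr sideZ.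
rewrite /sign_pairing; rewrite e3 E3 -mulN1r mulrA.
rewrite E3 in i3.
rewrite -(cintegralZ _ i3) -(cintegralD i1 (cintegrableZ _ i3)).
apply: eq_cintegral => z; rewrite mother_split tensor_side_unit; ring.
Qed.

End coefficients.

End haar_limits.

(** * A nonzero limit coefficient *)

Section nonzero_coefficient.
Context {R : realType} {d : nat}.
Local Notation E := 'rV[R]_d.
Local Notation mu := (@lebesgue_rV R d).
Local Notation leb := (@lebesgue_measure R).
Variables (phi0 : E -> R) (lp : lp_cutoff phi0) (i0 : 'I_d).
Local Notation c0 := (cst_inv phi0).
Local Notation SP := (sign_pairing phi0 i0).

Let ikap : cintegrable (inv_fourier phi0) := cintegrable_ift (lp_cutoff_testfun lp).

Lemma sign_pairing_cvg (h : nat -> R -> R) (l : R -> R) :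
  (forall n, measurable_fun setT (h n)) -> (forall n x, `|h n x| <= 1) ->
  (forall x, (fun n => h n x) @ \oo --> l x) ->
  ccvg (fun n => SP (h n)) (SP l).
Proof.
move=> mh h1 hl; apply: (cintegral_pairing (h := fun n z => h n (z ord0 i0)) ikap).
- by move=> n; exact: (measurableT_comp (mh n) (measurable_coord i0)).
- by move=> n z; exact: h1.
- by move=> z; exact: hl.
Qed.

Lemma sign_pairing_cst (c : R) : SP (fun=> c) = c%:C * c0.
Proof.
rewrite -(cintegralZ _ ikap); apply: eq_cintegral => z.
exact: mulrC.
Qed.

(** The sign with the opposite value at 0, which is the limit from the left of the
    shifted signs. *)
Definition side_left (w : R) : R := if w <= 0 then 1 else -1.

Lemma measurable_side_left : measurable_fun [set: R] side_left.
Proof.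
rewrite (_ : side_left = fun w => - side true (- w)); last first.
  by apply/funext => w; rewrite /side_left /side oppr_lt0 leNgt; case: ltP => _; rewrite ?opprK.
apply: (@measurableT_comp _ _ _ _ _ _ (@GRing.opp R)) => //.
by apply: (measurableT_comp (measurable_side true)).
Qed.

(** The two signs differ on a hyperplane, which is a null set. *)
Lemma sign_pairing_left : SP side_left = SP (side true).
Proof.
have [C C0 [mg iw bg]] := cdom_decay (lp_cutoff_testfun lp).
have b1 t : `|side_left t| <= 1 by rewrite /side_left; case: ifP => _; rewrite ?normrN normr1.
have il := cintegrable_sign lp i0 measurable_side_left b1.
have is0 := cintegrable_sign lp i0 (measurable_side true) (side_bound true).
apply/eqP; rewrite -subr_eq0; apply/eqP; rewrite /sign_pairing -mulN1r.
rewrite -(cintegralZ _ is0) -(cintegralD il (cintegrableZ _ is0)).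
(* a product majorant supported by the hyperplane, hence of integral 0 *)
pose f (i : 'I_d) (t : R) : R := (if i == i0 then \1_[set (0 : R)] t else 1) * (1 + t ^+ 2)^-1.
pose W (z : E) : R := \prod_i f i (z ord0 i).
have ioD : leb.-integrable setT (EFin \o (fun t : R => (1 + t ^+ 2)^-1)).
  apply/integrableP; split.
    apply/measurable_EFinP; apply: continuous_measurable_fun; exact: continuous_oneDsqrV.
  apply: (le_lt_trans _ (@integral_oneDsqrV R)).
  rewrite le_eqVlt; apply/orP; left; apply/eqP; apply: eq_integral => t _ /=.
  by rewrite ger0_norm// invr_ge0 addr_ge0// sqr_ge0.
have fi i : leb.-integrable setT (EFin \o f i).
  apply: (le_integrable _ _ _ ioD) => //.
    apply/measurable_EFinP; rewrite /f; apply: measurable_funM.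
      by case: eqP => _; [exact: measurable_indic|exact: measurable_cst].
    by apply: continuous_measurable_fun; exact: continuous_oneDsqrV.
  move=> t _ /=; rewrite lee_fin normrM ler_piMl//.
  by rewrite /f; case: eqP => _; rewrite ?normr1// indicE; case: (_ \in _); rewrite ?normr1 ?normr0.
have [iW eW] := integral_tensor fi.
have eW0 : \int[mu]_z W z = 0.
  rewrite eW (bigD1 i0)//= [X in X * _](_ : _ = 0) ?mul0r//.
  rewrite (_ : f i0 = \1_[set (0 : R)]).
    rewrite /Rintegral integral_indic// setIT.
    by rewrite [X in fine X](@lebesgue_measure_set1 R 0).
  apply/funext => t; rewrite /f eqxx indicE.
  have [->|t0] := eqVneq t 0; first by rewrite expr0n addr0 invr1 mulr1.
  by rewrite memNset ?mul0r//= => /eqP; rewrite (negbTE t0).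
have dW : cdom (fun z : E => inv_fourier phi0 z * (side_left (z ord0 i0))%:C +
   (-1) * (inv_fourier phi0 z * (side true (z ord0 i0))%:C)) (fun z => 2 * C * W z).
  split.
  - exact: cintegrable_meas (cintegrableD il (cintegrableZ _ is0)).
  - exact: intRZ iW.
  move=> z; rewrite mulN1r -mulrBr -rmorphB Normc.normcM normc_real.
  have [z0|z0] := eqVneq (z ord0 i0) 0; last first.
    rewrite (_ : side_left _ - side true _ = 0); last first.
      by rewrite /side_left /side le_eqVlt (negbTE z0)/= subrr.
    rewrite normr0 mulr0 !mulr_ge0//; apply: prodr_ge0 => i _.
    rewrite /f mulr_ge0 ?invr_ge0 ?addr_ge0 ?sqr_ge0//.
    by case: eqP => _ //; rewrite indicE.
  have -> : W z = weight z.
    apply: eq_bigr => i _; rewrite /f; case: eqP => [->|_]; last by rewrite mul1r.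
    by rewrite z0 indicE mem_set ?mul1r.
  have hd : `|side_left (z ord0 i0) - side true (z ord0 i0)| <= 2.
    by rewrite z0 /side_left /side lexx ltxx opprK ger0_norm.
  rewrite [leLHS]mulrC -[leRHS]mulrA.
  exact: (ler_pM (normr_ge0 _) (normc_ge0 _) hd (bg z)).
have := normc_cintegral dW; rewrite RintegralZl// eW0 !mulr0 => h.
by apply: Normc.eq0_normc; apply/eqP; rewrite eq_le h normc_ge0.
Qed.

Lemma pow2_growth (x : R) : \forall n \near \oo, x < (2 : R) ^+ n.
Proof.
have [x0|x0] := leP x 0.
  by apply: nearW => n; apply: (le_lt_trans x0); rewrite exprn_gt0.
have := cvgr0_norm_lt _ (@cvg_inv2n R) x^-1; rewrite invr_gt0 => /(_ _ x0).
apply: filterS => n; rewrite ger0_norm ?invr_ge0 ?exprn_ge0//.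
by rewrite ltf_pV2// posrE exprn_gt0.
Qed.

(** Otherwise S t = S (t / 2) for the pairing S of the inverse transform of the cutoff
    with the sign shifted by t.  Halving t repeatedly shows that S is constant on
    each half-line, with a common value by sign_pairing_left.  But doubling t
    repeatedly turns the sign into the constants -1 and 1, and S into -c0 and c0. *)
Lemma central_coef_unit_neq0 : c0 <> 0 -> exists t, central_coef phi0 i0 t (unit_eps i0) <> 0.
Proof.
move=> c0n0; apply: contrapT => /forallNP h; apply: c0n0.
pose S t := SP (fun u => side true (u + t)).
have hS t : S t = S (t / 2).
  have /contrapT := h t; rewrite central_coef_unit// => /eqP.
  by rewrite subr_eq0 => /eqP.
have hSn n t : S t = S (t / 2 ^+ n).
  elim: n => [|n ih]; first by rewrite expr0 divr1.
  by rewrite ih hS exprS invfM mulrA mulrAC.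
have mS t : measurable_fun [set: R] (fun u => side true (u + t)) by exact: measurable_side_shift.
have bS (t u : R) : `|side true (u + t)| <= 1 by exact: side_bound.
(* t / 2^n tends to 0 from the right *)
have pos t : 0 < t -> S t = S 0.
  move=> t0; apply: (ccvg_unique (u := fun n : nat => S (t / 2 ^+ n))).
    by rewrite (_ : (fun n => _) = fun=> S t); [exact: ccvg_cst|apply/funext => n; rewrite -hSn].
  apply: (sign_pairing_cvg (h := fun n u => side true (u + t / 2 ^+ n))) => // u.
  apply: cvg_near_cst; rewrite addr0; have [u0|u0] := ltP u 0.
    have := pow2_growth (t / - u); apply: filterS => n hn.
    rewrite /side u0 ifT// addrC -ltrBrDr sub0r ltr_pdivrMr ?exprn_gt0//.
    by rewrite mulrC -ltr_pdivrMr// oppr_gt0.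
  apply: nearW => n; rewrite /side !ltNge u0 addr_ge0//.
  by rewrite divr_ge0 ?exprn_ge0// ltW.
(* - t / 2^n tends to 0 from the left *)
have neg t : 0 < t -> S (- t) = SP side_left.
  move=> t0; apply: (ccvg_unique (u := fun n : nat => S (- t / 2 ^+ n))).
    by rewrite (_ : (fun n => _) = fun=> S (- t)); [exact: ccvg_cst|apply/funext => n; rewrite -hSn].
  apply: (sign_pairing_cvg (h := fun n u => side true (u + - t / 2 ^+ n))) => // u.
  apply: cvg_near_cst; have [u0|u0] := leP u 0.
    apply: nearW => n; rewrite /side /side_left u0 ifT//.
    by rewrite mulNr subr_lt0 (le_lt_trans u0)// divr_gt0// exprn_gt0.
  have := pow2_growth (t / u); apply: filterS => n hn.
  rewrite /side /side_left leNgt u0/= ifF//; apply/negbTE; rewrite -leNgt mulNr subr_ge0.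
  by rewrite ler_pdivrMr ?exprn_gt0// mulrC -ler_pdivrMr// ltW.
(* S 0 = S (2^n), and the sign shifted by 2^n tends to the constant -1 *)
have limp : S 0 = (-1)%:C * c0.
  rewrite -sign_pairing_cst; apply: (ccvg_unique (u := fun n : nat => S (2 ^+ n))).
    rewrite (_ : (fun n => _) = fun=> S 0); first exact: ccvg_cst.
    by apply/funext => n; rewrite pos// exprn_gt0.
  apply: (sign_pairing_cvg (h := fun n u => side true (u + 2 ^+ n))) => // u.
  apply: cvg_near_cst; have := pow2_growth (- u); apply: filterS => n hn.
  by rewrite /side ltNge ifF//; apply/negbTE; rewrite negbK -lerBlDl sub0r ltW.
have limn : SP side_left = 1%:C * c0.
  rewrite -sign_pairing_cst; apply: (ccvg_unique (u := fun n : nat => S (- 2 ^+ n))).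
    rewrite (_ : (fun n => _) = fun=> SP side_left); first exact: ccvg_cst.
    by apply/funext => n; rewrite neg// exprn_gt0.
  apply: (sign_pairing_cvg (h := fun n u => side true (u + - 2 ^+ n))) => // u.
  apply: cvg_near_cst; have := pow2_growth u; apply: filterS => n hn.
  by rewrite /side subr_lt0 hn.
have e0 : S 0 = SP (side true).
  by congr (SP _); apply/funext => u; rewrite addr0.
move: limn; rewrite sign_pairing_left -e0 limp => e1.
have e2 : - c0 = c0 by move: e1; rewrite rmorphN1 rmorph1 mulN1r mul1r.
apply: complex_eq; rewrite [RHS]/=.
  by have e3 := congr1 (@complex.Re R) e2; rewrite Re_opp in e3; lra.
by have e3 := congr1 (@complex.Im R) e2; rewrite Im_opp in e3; lra.
Qed.

End nonzero_coefficient.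

(** * Fourier transforms of Haar functions *)

Section haar_fourier.
Context {R : realType} {d : nat}.
Local Notation E := 'rV[R]_d.
Local Notation mu := (@lebesgue_rV R d).
Local Notation leb := (@lebesgue_measure R).
Local Notation intR := (fun B : E -> R => mu.-integrable [set: E] (EFin \o B)).

Lemma integrable_haar1 e (c m : R) : 0 < c ->
  leb.-integrable setT (EFin \o (fun t : R => haar1 e (c * t - m))).
Proof.
move=> c0; apply: (le_integrable _ _ _ (integrable_indic_itv (m / c) ((m + 1) / c) true false)) => //.
  apply/measurable_EFinP; apply: (measurableT_comp (measurable_haar1 e)).
  by apply: measurable_funB => //; apply: measurable_funM.
move=> t _; rewrite /= lee_fin indicE.
have [h|h] := boolP (t \in _); first by rewrite normr1 haar1_bound.
rewrite haar1_out ?normr0// ; move: h; rewrite mem_setE in_itv/= negb_and -ltNge -ltNge.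
rewrite ltr_pdivlMr// ltr_pdivrMr// => /orP[h|h]; apply/orP; [left|right]; lra.
Qed.

Lemma intR_haar (a : haar_index d) : intR (haar a).
Proof.
have [] // := @integral_tensor R d
  (fun i t => haar1 (haar_eps a i) (2 ^+ haar_freq a * t - (haar_shift a ord0 i)%:~R)).
by move=> i; apply: integrable_haar1; rewrite exprn_gt0.
Qed.

Lemma cintegrable_haar (a : haar_index d) : cintegrable (fun y : E => (haar a y)%:C).
Proof. by split; [exact: intR_haar|exact: integrable0]. Qed.

Definition root_index (e : {ffun 'I_d -> bool}) : haar_index d := HaarIndex e 0 0.

Lemma haar_root e (y : E) : haar (root_index e) y = \prod_i haar1 (e i) (y ord0 i).
Proof. by apply: eq_bigr => i _; rewrite /= expr0 mul1r mxE subr0. Qed.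

Lemma integral_haar1T : \int[leb]_t (haar1 true t : R) = 0.
Proof.
rewrite /haar1/=.
have i1 := @integrable_indic_itv R 0 2^-1 true true.
have i2 := @integrable_indic_itv R 2^-1 1 true true.
rewrite RintegralB//.
rewrite /Rintegral !integral_indic//= !setIT !lebesgue_measure_itv/= !lte_fin.
rewrite invr_gt0 ltr0n invf_lt1// ltr1n -!EFinB/=; lra.
Qed.

Variable i0 : 'I_d.

(** The second factor involves one coordinate only, so the integral factorises. *)
Lemma integral_haar_root (e : {ffun 'I_d -> bool}) (c : R -> R) : measurable_fun setT c ->
  (forall t, `|c t| <= 1) ->
  \int[mu]_y (haar (root_index e) y * c (y ord0 i0)) =
  \prod_i \int[leb]_t (haar1 (e i) t * (if i == i0 then c t else 1)).
Proof.
move=> mc c1.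
have [i|_ <-] := @integral_tensor R d (fun i t => haar1 (e i) t * (if i == i0 then c t else 1)).
  have := @integrable_haar1 (e i) 1 0 ltr01; apply: le_integrable => //.
    apply/measurable_EFinP; apply: measurable_funM; first exact: measurable_haar1.
    by case: eqP.
  move=> t _; rewrite /= mul1r subr0 lee_fin normrM ler_piMr//.
  by case: eqP => _; rewrite ?c1// normr1.
apply: eq_Rintegral => y _; rewrite haar_root big_split/=; congr (_ * _).
by rewrite (bigD1 i0)//= eqxx big1 ?mulr1// => i /negbTE ->.
Qed.

Lemma ReIm_fourier_root e : fourier (fun y : E => (haar (root_index e) y)%:C) (evec i0) =
  (\int[mu]_y (haar (root_index e) y * cos (2 * pi * - y ord0 i0))) +i*
  (\int[mu]_y (haar (root_index e) y * sin (2 * pi * - y ord0 i0))).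
Proof.
rewrite /fourier /cintegral; congr (_ +i* _); apply: eq_Rintegral => y _.
  by rewrite dotp_evec Re_mul/= mul0r subr0.
by rewrite dotp_evec Im_mul/= mul0r addr0.
Qed.

Lemma measurable_trig (c : R -> R) : continuous c ->
  measurable_fun setT (fun t : R => c (2 * pi * - t)).
Proof.
move=> cc; apply: (measurableT_comp (continuous_measurable_fun cc)).
by apply: measurable_funM => //; exact: measurableT_comp.
Qed.

(** One factor is the integral of the oscillating profile, which is 0. *)
Lemma fourier_root0 (e : {ffun 'I_d -> bool}) i : i != i0 -> e i ->
  fourier (fun y : E => (haar (root_index e) y)%:C) (evec i0) = 0.
Proof.
move=> ii ei; rewrite ReIm_fourier_root.
have h (c : R -> R) : measurable_fun setT c -> (forall t : R, `|c t| <= 1) ->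
    \int[mu]_y (haar (root_index e) y * c (y ord0 i0)) = 0.
  move=> mc c1; rewrite integral_haar_root// (bigD1 i)//= ei (negbTE ii).
  by under eq_Rintegral do rewrite mulr1; rewrite integral_haar1T mul0r.
rewrite (h (fun t => cos (2 * pi * - t))); last 2 first.
- exact: (measurable_trig (@continuous_cos R)).
- by move=> t; exact: cos_max.
rewrite (h (fun t => sin (2 * pi * - t))) //.
- exact: (measurable_trig (@continuous_sin R)).
- by move=> t; exact: sin_max.
Qed.

(** The profile changes sign exactly where the sine does, so the integrand has a
    constant sign. *)
Lemma integral_haar1T_sin : \int[leb]_t (haar1 true t * sin (2 * pi * - t) : R) <> 0.
Proof.
pose f (t : R) : R := haar1 true t * sin (2 * pi * - t).
have pi0 := @pi_gt0 R.
have mf : measurable_fun setT f.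
  by apply: measurable_funM; [exact: measurable_haar1|exact: (measurable_trig (@continuous_sin R))].
have fneg t : 0 < t < 2^-1 -> f t < 0.
  move=> /andP[t0 t1]; rewrite /f haar1T ifT ?mul1r; last by rewrite ltW.
  rewrite mulrN sinN oppr_lt0; apply: sin_gt0_pi.
  by apply/andP; split; nra.
have fneg2 t : 2^-1 < t < 1 -> f t < 0.
  move=> /andP[t0 t1]; rewrite /f haar1T ifF; last by apply/negP => /andP[]; lra.
  rewrite ifT; last by rewrite ltW.
  rewrite mulN1r mulrN sinN opprK -[ltRHS]oppr0 ltrNr -sinDpi.
  have -> : sin (2 * pi * t + pi) = sin (2 * pi * t - pi).
    by rewrite sinDpi -[2 * pi * t in LHS](subrK pi) sinDpi opprK.
  by apply: sin_gt0_pi; apply/andP; split; nra.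
have f0 t : f t <= 0.
  have [h|h] := boolP ((t < 0) || (1 <= t)); first by rewrite /f haar1_out// mul0r.
  move: h; rewrite negb_or -leNgt -ltNge => /andP[t0 t1].
  have [->|t0'] := eqVneq t 0; first by rewrite /f oppr0 mulr0 sin0 mulr0.
  have [->|t2] := eqVneq t 2^-1.
    by rewrite /f mulrN sinN [2 * pi * _]mulrAC mulfV// mul1r sinpi oppr0 mulr0.
  have [h|h] := ltP t 2^-1; apply: ltW; first by apply: fneg; rewrite lt_neqAle eq_sym t0' t0.
  by apply: fneg2; rewrite lt_neqAle eq_sym t2 h.
have fi : leb.-integrable setT (EFin \o f).
  have := @integrable_haar1 true 1 0 ltr01; apply: le_integrable => //.
    exact/measurable_EFinP.
  move=> t _; rewrite /= mul1r subr0 lee_fin normrM ler_piMr//; exact: sin_max.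
move=> I0.
have I1 : (\int[leb]_t `|(EFin \o f) t| = 0)%E.
  transitivity (\int[leb]_t (- (EFin \o f) t))%E.
    by apply: eq_integral => t _; rewrite /= ler0_norm.
  rewrite integralN; last exact: integrable_add_def.
  have /fineK <- := integrable_fin_num measurableT fi.
  by move: I0; rewrite /Rintegral => ->; rewrite oppe0.
have mEf : measurable_fun setT (EFin \o f) by exact/measurable_EFinP.
have [+ _] := ae_eq_integral_abs leb measurableT mEf; move=> /(_ I1)[A [mA A0 sA]].
have : (leb `]0%R, 2^-1%R[ <= leb A)%E.
  apply: le_measure; rewrite ?inE//=.
  move=> t; rewrite /= in_itv/= => /fneg ft; apply: sA => /= /(_ I)[] ft0.
  by rewrite ft0 ltxx in ft.
rewrite A0 lebesgue_measure_itv/= lte_fin invr_gt0 ltr0n -EFinB lee_fin subr0.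
by rewrite invr_le0 leNgt ltr0n.
Qed.

Lemma fourier_root_neq0 : fourier (fun y : E => (haar (root_index (unit_eps i0)) y)%:C) (evec i0) <> 0.
Proof.
rewrite ReIm_fourier_root => /(congr1 (@complex.Im R)) /=.
rewrite (integral_haar_root _ (c := fun t => sin (2 * pi * - t))); last 2 first.
- exact: (measurable_trig (@continuous_sin R)).
- by move=> t; exact: sin_max.
move/eqP; rewrite (bigD1 i0)//= !ffunE eqxx mulf_eq0 => /orP[/eqP|]; first exact: integral_haar1T_sin.
rewrite big1 ?oner_eq0// => i /negbTE ii; rewrite ffunE ii.
under eq_Rintegral do rewrite mulr1.
by rewrite /Rintegral/haar1/= integral_indic//= setIT lebesgue_measure_itv/= lte_fin ltr01 -EFinB subr0.
Qed.

End haar_fourier.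

(** * The limit profile *)

Section central_profile.
Context {R : realType} {d : nat}.
Local Notation E := 'rV[R]_d.
Local Notation mu := (@lebesgue_rV R d).
Local Notation intR := (fun B : E -> R => mu.-integrable [set: E] (EFin \o B)).

(** By x^2 <= 2 (x - y)^2 + 2 y^2 in each coordinate. *)
Lemma weight_shift (x y : E) : (forall i, `|y ord0 i| <= 1) -> weight (x - y) <= 3 ^+ d * weight x.
Proof.
move=> y1; rewrite /weight.
have <- : \prod_(i < d) 3 = 3 ^+ d :> R by rewrite prodr_const card_ord.
rewrite -big_split /=; apply: ler_prod => i _; rewrite !mxE.
rewrite invr_ge0 addr_ge0 ?sqr_ge0//=.
set a := x ord0 i; set b := y ord0 i.
have b1 : b ^+ 2 <= 1 by rewrite -real_normK ?num_real// expr_le1//; exact: y1.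
have h1 : 0 < 1 + a ^+ 2 by rewrite ltr_pwDl// sqr_ge0.
have h2 : 0 < 1 + (a - b) ^+ 2 by rewrite ltr_pwDl// sqr_ge0.
rewrite ler_pdivlMr// mulrC ler_pdivrMr//.
have h3 := sqr_ge0 (2 * (a - b) - b); have h4 := sqr_ge0 (a - b - b).
have -> : a ^+ 2 = 2 * (a - b) ^+ 2 + 2 * b ^+ 2 - (a - b - b) ^+ 2 by ring.
have h5 := sqr_ge0 (a - b).
by lra.
Qed.

Lemma measurable_subr2 : measurable_fun setT (fun z : E * E => z.1 - z.2).
Proof.
apply: measurable_fun_rV => i.
rewrite (_ : (fun z : E * E => _) = (fun z : E * E => z.1 ord0 i - z.2 ord0 i : R)); last first.
  by apply/funext => z; rewrite !mxE.
apply: measurable_funB.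
  exact: (measurableT_comp (measurable_coord i) measurable_fst).
exact: (measurableT_comp (measurable_coord i) measurable_snd).
Qed.

Variables (psi : E -> R) (H : E -> R[i]).
Hypotheses (tp : testfun psi) (iH : cintegrable H)
  (sH : forall (w : E) i, 1 < `|w ord0 i| -> H w = 0).
Local Notation g := (inv_fourier psi).

(** Convolution of H with the kernel whose Fourier multiplier is psi. *)
Definition convol (y : E) : R[i] := cintegral (fun w => H w * g (y - w)).

(** For H with bounded support the convolution is dominated by the weight, so it is
    integrable and Fubini applies to its Fourier transform. *)
Lemma fourier_convol xi : cintegrable convol /\ fourier convol xi = fourier g xi * fourier H xi.
Proof.
have [C C0 [mg iw bg]] := cdom_decay tp.
have [mH iB _] := cintegrable_cdom iH.
pose a (x : E) : R := C * 3 ^+ d * weight x.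
have ia : intR a by apply: intRZ; exact: intR_weight.
have bHg x w : normc (H w * g (x - w)) <= a x * normc (H w).
  rewrite Normc.normcM mulrC; have [h|/existsNP[i /negP]] := pselect (forall i, `|w ord0 i| <= 1).
    rewrite ler_wpM2r ?normc_ge0//; apply: (le_trans (bg _)).
    by rewrite /a -mulrA ler_wpM2l// weight_shift.
  by rewrite -ltNge => /sH ->; rewrite normc_real normr0 !mulr0.
have mg2 : cmeas (fun z : E * E => g (z.1 - z.2)).
  exact: (cmeas_comp mg measurable_subr2).
have mH2 : cmeas (fun z : E * E => H z.2) by exact: (cmeas_comp mH measurable_snd).
have eb (x : E) : normc (expi (- dotp x xi)) <= 1 by rewrite normc_expi.
have [ic _] := cfubini (cmeasM mH2 mg2) ia iB bHg.
split; first exact: ic.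
pose F (x w : E) : R[i] := expi (- dotp x xi) * (H w * g (x - w)).
have mF : cmeas (fun z : E * E => F z.1 z.2).
  apply: cmeasM; last exact: cmeasM mH2 mg2.
  exact: (cmeas_comp (cmeas_expi_dotp xi) measurable_fst).
have bF x w : normc (F x w) <= a x * normc (H w).
  by rewrite Normc.normcM normc_expi mul1r.
have [_ fub] := cfubini mF ia iB bF.
have e1 x : cintegral (F x) = convol x * expi (- dotp x xi).
  rewrite mulrC; exact: (cintegralZ _ (cintegrable_convol x tp iH)).
rewrite /fourier -(eq_cintegral e1) fub.
have ig : cintegrable (fun x => g x * expi (- dotp x xi)).
  have := cintegrable_bounded_mul (cmeas_expi_dotp xi) eb (cintegrable_ift tp).
  by under eq_fun do rewrite mulrC.
have e2 w : cintegral (F ^~ w) = fourier g xi * (H w * expi (- dotp w xi)).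
  have iF : cintegrable (F ^~ w).
    apply: (@cdom_cintegrable _ _ _ (fun x => normc (H w) * a x)); split.
    - apply: cmeasM; first exact: cmeas_expi_dotp.
      apply: cmeasM; first exact: cmeas_cst.
      have := cmeas_translate (- w) mg.
      by under eq_fun do rewrite addrC.
    - exact: intRZ ia.
    - by move=> x; rewrite [leRHS]mulrC; exact: bF.
  have [_ ->] := cintegral_shift w iF.
  transitivity ((H w * expi (- dotp w xi)) * fourier g xi); last exact: mulrC.
  transitivity (cintegral (fun z => (H w * expi (- dotp w xi)) * (g z * expi (- dotp z xi))));
    last exact: (cintegralZ _ ig).
  apply: eq_cintegral => z; rewrite /F.
  have -> : w + z - w = z by rewrite addrC addKr.
  by rewrite dotpDl opprD expiD; ring.
rewrite (eq_cintegral e2).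
have iHe : cintegrable (fun w => H w * expi (- dotp w xi)).
  have := cintegrable_bounded_mul (cmeas_expi_dotp xi) eb iH.
  by under eq_fun do rewrite mulrC.
exact: (cintegralZ _ iHe).
Qed.

End central_profile.

Section positivity.
Context {R : realType} {d : nat}.
Local Notation E := 'rV[R]_d.
Local Notation mu := (@lebesgue_rV R d).
Variables (p : R).

(** A function which is 0 almost everywhere has Fourier transform 0. *)
Lemma pint_gt0 (f : E -> R[i]) xi : cintegrable f -> fourier f xi <> 0 ->
  (0 < pint p (fun x => normc (f x)))%E.
Proof.
move=> fi fn; rewrite lt_neqAle pint_ge0 andbT; apply/eqP => e; apply: fn.
have [mf iB _] := cintegrable_cdom fi.
have mn := cmeas_normc mf.
have mp := measurable_powR_comp p mn.
have I1 : (\int[mu]_x `|(normc (f x) `^ p)%:E| = 0)%E.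
  rewrite e; apply: eq_integral => x _; by rewrite /= ger0_norm// powR_ge0.
have [+ _] := ae_eq_integral_abs mu measurableT mp; move=> /(_ I1)[A [mA A0 sA]].
have I2 : (\int[mu]_x (normc (f x))%:E = 0)%E.
  transitivity (\int[mu]_x `|(normc (f x))%:E|)%E.
    by apply: eq_integral => x _; rewrite /= ger0_norm// normc_ge0.
  apply/ae_eq_integral_abs => //; first exact/measurable_EFinP.
  exists A; split => //; apply: subset_trans sA => x /= h h2; apply: h => _.
  have [] := h2 I => /eqP; rewrite powR_eq0 => /andP[/eqP -> _].
  by [].
have dd : cdom (fun x => f x * expi (- dotp x xi)) (fun x => normc (f x)).
  split; [apply: cmeasM => //; exact: cmeas_expi_dotp|exact: iB|].
  by move=> x; rewrite Normc.normcM normc_expi mulr1.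
have := normc_cintegral dd; rewrite /Rintegral I2 /= mulr0 => h.
by apply: Normc.eq0_normc; apply/eqP; rewrite eq_le h normc_ge0.
Qed.

End positivity.

Section central_conv.
Context {R : realType} {d : nat}.
Local Notation E := 'rV[R]_d.
Variables (phi0 : E -> R) (lp : lp_cutoff phi0) (i0 : 'I_d) (t : R).

(** Set to 0 at the type without oscillation, which occurs in the Haar system only
    at frequency 1 and never among the selected functions. *)
Definition limit_coef (e : {ffun 'I_d -> bool}) : R[i] :=
  if [exists i, e i] then central_coef phi0 i0 t e else 0.

Definition limit_fun (w : E) : R[i] := \sum_e limit_coef e * (haar (root_index e) w)%:C.

Lemma cintegrable_limit_fun : cintegrable limit_fun.
Proof. apply: cintegrable_sum => e; apply: cintegrableZ; exact: cintegrable_haar. Qed.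

Lemma limit_fun_out (w : E) i : 1 < `|w ord0 i| -> limit_fun w = 0.
Proof.
move=> h; rewrite /limit_fun big1// => e _.
rewrite haar_root (bigD1 i)//= haar1_out ?mul0r ?mulr0//.
by move: h; rewrite lter_normr => /orP[h|h]; apply/orP; [right|left]; lra.
Qed.

(** The shape that every selected Littlewood-Paley piece takes in the limit. *)
Definition limit_piece : E -> R[i] := convol (lp_annulus phi0) limit_fun.

(** Evaluate the Fourier transform at the unit vector of the axis i0.  The annulus
    function equals 1 there, and among the types with oscillation only unit_eps has
    a nonzero Fourier transform at this vector. *)
Lemma limit_piece_gt0 p : cst_inv phi0 <> 0 ->
  central_coef phi0 i0 t (unit_eps i0) <> 0 ->
  (0 < pint p (fun x => normc (limit_piece x)))%E.
Proof.
move=> c0 cu.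
have tp := testfun_annulus lp.
have [ic fc] := fourier_convol tp cintegrable_limit_fun limit_fun_out (evec i0).
have gt0 := @pint_gt0 R d p limit_piece (evec i0) ic; apply: gt0.
rewrite [X in X <> _]fc.
have := @fourier_mother R d phi0 lp (evec i0); rewrite /mother => ->.
rewrite annulus_unit//; last first.
  by rewrite /enorm dotp_evec mxE !eqxx sqrtr1.
have eb (x : E) : normc (expi (- dotp x (evec i0))) <= 1 by rewrite normc_expi.
have -> : fourier limit_fun (evec i0) = \sum_e limit_coef e *
    fourier (fun y => (haar (root_index e) y)%:C) (evec i0).
  have ie e : cintegrable (fun y : E => (haar (root_index e) y)%:C * expi (- dotp y (evec i0))).
    have := cintegrable_bounded_mul (cmeas_expi_dotp (evec i0)) eb (cintegrable_haar (root_index e)).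
    by under eq_fun do rewrite mulrC.
  transitivity (cintegral (fun y => \sum_e limit_coef e *
    ((haar (root_index e) y)%:C * expi (- dotp y (evec i0))))).
    by apply: eq_cintegral => y; rewrite /limit_fun mulr_suml; apply: eq_bigr => e _; rewrite mulrA.
  rewrite cintegral_sum; last by move=> e; apply: cintegrableZ; exact: ie.
  apply: eq_bigr => e _; exact: (cintegralZ _ (ie e)).
rewrite (bigD1 (unit_eps i0))//= big1 ?addr0; last first.
  move=> e eu; rewrite /limit_coef; case: ifPn => [/existsP[j ej]|_]; last by rewrite mul0r.
  have [i ii ei] : exists2 i, i != i0 & e i.
    apply: contrapT => h; have hn i : i != i0 -> e i = false.
      by move=> ii; apply/negbTE/negP => ei; apply: h; exists i.
    move/eqP: eu; apply; apply/ffunP => i; rewrite ffunE; have [->|/hn//] := eqVneq i i0.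
    by have [<-//|/hn] := eqVneq j i0; rewrite ej.
  by rewrite (fourier_root0 ii ei) mulr0.
have lu : limit_coef (unit_eps i0) = central_coef phi0 i0 t (unit_eps i0).
  by rewrite /limit_coef ifT//; apply/existsP; exists i0; rewrite ffunE eqxx.
rewrite lu mulr1; apply/eqP; rewrite !mulf_neq0//; [exact/eqP|exact/eqP|].
exact/eqP/fourier_root_neq0.
Qed.

End central_conv.

(** * Corridors and blocks *)

Section corridors.
Context {R : realType} {d : nat}.
Local Notation E := 'rV[R]_d.

(** The families increase strictly, so each corridor contains a cube; cubes from
    different corridors are different. *)
Lemma corridor_sequence (Q : nat -> set 'rV[int]_d) : @corridor_family R d Q ->
  exists kap : nat -> 'rV[int]_d, injective kap /\
    forall l, @cube5 R d (kap l) `<=` @corridor R d Q l.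
Proof.
move=> [Q0 _ Qlt _ _].
have Qle l l' : (l <= l')%N -> Q l `<=` Q l'.
  elim: l' => [|l' ih]; first by rewrite leqn0 => /eqP ->.
  rewrite leq_eqVlt => /orP[/eqP -> //|]; rewrite ltnS => /ih h.
  by apply: (subset_trans h); case: (Qlt l').
have /choice[f hf] : forall l, exists kappa, Q l.+1 kappa /\ ~ Q l kappa.
  move=> l; have [_ /existsNP[kappa /not_implyP[h1 h2]]] := Qlt l.
  by exists kappa.
pose kap l := if l is l'.+1 then f l' else 0.
have Qkap l : Q l (kap l) by case: l => [|l]; [rewrite Q0|case: (hf l)].
have kap_lt l l' : (l < l')%N -> kap l <> kap l'.
  case: l' => // l'; rewrite ltnS => ll e; have [_ ] := hf l'; apply.
  by rewrite -[f l']/(kap l'.+1) -e; exact: (Qle _ _ ll _ (Qkap l)).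
exists kap; split.
  move=> l l' e; apply/eqP; rewrite eqn_leq (leqNgt l) (leqNgt l'); apply/andP; split; apply/negP => h.
    by case: (kap_lt _ _ h).
  by case: (kap_lt _ _ h).
case=> [|l]; first by [].
move=> x hx; exists (kap l.+1); last exact: hx.
by split; [case: (hf l)|case: (hf l)].
Qed.

(** A closed box contains the closure of each of its subsets; used for the supports
    in the definition of the blocks. *)
Lemma closure_box (S : set E) (a b : 'I_d -> R) :
  (forall x, S x -> forall i, a i <= x ord0 i <= b i) ->
  forall x, closure S x -> forall i, a i <= x ord0 i <= b i.
Proof.
move=> h x cx i; apply/andP; split; rewrite leNgt; apply/negP => hx.
  have e0 : 0 < a i - x ord0 i by rewrite subr_gt0.
  have [y [/h/(_ i)/andP[ya _] yx]] := cx _ (nbhsx_ballx x _ e0).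
  move: yx; rewrite -ball_normE/= => yx.
  have := le_lt_trans (rV_norm_coord (x - y) i) yx.
  by rewrite !mxE distrC ltr_norml => /andP[_]; lra.
have e0 : 0 < x ord0 i - b i by rewrite subr_gt0.
have [y [/h/(_ i)/andP[_ ya] yx]] := cx _ (nbhsx_ballx x _ e0).
move: yx; rewrite -ball_normE/= => yx.
have := le_lt_trans (rV_norm_coord (x - y) i) yx.
by rewrite !mxE ltr_norml => /andP[_]; lra.
Qed.

(** Closing the support adds only points of the closed unit cube at the centre of
    the cube of side 10, where there is room left. *)
Lemma haar_block_cube Q l (kappa : 'rV[int]_d) (a : haar_index d) :
  @cube5 R d kappa `<=` @corridor R d Q l -> haar_mean_zero a ->
  (forall i, 10 * (kappa ord0 i)%:~R <= (haar_shift a ord0 i)%:~R / 2 ^+ haar_freq a :> R /\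
    ((haar_shift a ord0 i)%:~R + 1) / 2 ^+ haar_freq a <= 10 * (kappa ord0 i)%:~R + 1 :> R) ->
  @haar_block R d Q l (haar_freq a).+1 a.
Proof.
move=> kQ mz ha; split => //; apply: (subset_trans (@interior_subset _ _)).
have p2 : 0 < (2 : R) ^+ haar_freq a by rewrite exprn_gt0.
move=> x cx; apply: kQ => i.
have h (y : E) : haar a y != 0 -> forall i, 10 * (kappa ord0 i)%:~R <= y ord0 i <= 10 * (kappa ord0 i)%:~R + 1.
  move=> hy j; have [h1 h2] := ha j; move: h1 h2; rewrite ler_pdivlMr// ler_pdivrMr// => h1 h2.
  have [h|h] := boolP ((2 ^+ haar_freq a * y ord0 j - (haar_shift a ord0 j)%:~R < 0) ||
      (1 <= 2 ^+ haar_freq a * y ord0 j - (haar_shift a ord0 j)%:~R)).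
    by move: hy; rewrite /haar (bigD1 j)//= haar1_out// mul0r eqxx.
  move: h; rewrite negb_or -leNgt -ltNge => /andP[h3 h4].
  by apply/andP; split; rewrite -(ler_pM2r p2); lra.
have /andP[] := closure_box (S := [set x | haar a x != 0]) h cx i.
lra.
Qed.

End corridors.

(** * Which coefficients survive in the limit *)

Section selection.
Context {R : realType} {d : nat}.
Local Notation E := 'rV[R]_d.
Variables (phi0 : E -> R) (lp : lp_cutoff phi0) (i0 : 'I_d) (t : R).
Local Notation K := (lp_kernel phi0).
Local Notation lcoef := (limit_coef phi0 i0 t).

(** The Haar functions of frequency 2^k on the dyadic cube whose lowest corner is
    the centre 10 kappa of a cube of side 10. *)
Definition center_index (k : nat) (kappa : 'rV[int]_d) (e : {ffun 'I_d -> bool}) : haar_index d :=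
  HaarIndex e k (\row_i (2 ^+ k * 10 * kappa ord0 i)).

(** The midpoint of that dyadic cube. *)
Definition center_point (k : nat) (kappa : 'rV[int]_d) : E :=
  \row_i (10 * (kappa ord0 i)%:~R + (2 ^+ k.+1)^-1).

Lemma haar_arg_center (a : haar_index d) k kappa i :
  haar_arg a (center_point k kappa) i =
  (2 ^+ haar_freq a * 10 * kappa ord0 i - haar_shift a ord0 i)%:~R + 2 ^+ haar_freq a / 2 ^+ k.+1.
Proof.
rewrite /haar_arg mxE intrB !intrM rmorphXn/= mulrDr mulrA.
rewrite [_%:~R ^+ _](_ : _ = 2 ^+ haar_freq a)//; ring.
Qed.

Lemma ccvg_eq_lim (v : nat -> R[i]) a b : ccvg v a -> a = b -> ccvg v b.
Proof. by move=> h <-. Qed.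

(** Three cases, by comparing frequencies.  Lower: the midpoint is a fraction
    2^(f-k-1) < 1/2 beyond a dyadic point of the coarser grid.  Equal: it is a
    midpoint of the finer cubes, and only the cube around it counts.  Higher: it is a
    vertex of the finer grid, and a Haar function that touches it is supported
    inside the cube of side 10, hence in the block excluded by the hypothesis. *)
Lemma haar_coef_center Q l k kappa (a : haar_index d) : (0 < k)%N ->
  @cube5 R d kappa `<=` @corridor R d Q l -> haar_system a ->
  ((k < haar_freq a)%N -> ~ @haar_block R d Q l (haar_freq a).+1 a) ->
  ccvg (fun J => haar_coef (fun y => K J.+1 (y - (center_point k kappa + (2 ^+ J.+1)^-1 *: (t *: evec i0)))) a)
    (\sum_e lcoef e * (`[< a = center_index k kappa e >])%:R).
Proof.
move=> k0 kQ sa hblock.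
have p2 (n : nat) : 0 < (2 : R) ^+ n by rewrite exprn_gt0.
set X := center_point k kappa.
have zero_sum : (forall e, a <> center_index k kappa e) ->
    \sum_e lcoef e * (`[< a = center_index k kappa e >])%:R = 0.
  by move=> h; apply: big1 => e _; rewrite asboolF ?mulr0//; exact: h.
have [fk|kf|fk] := ltngtP (haar_freq a) k.
- apply: (ccvg_eq_lim (a := 0)); last first.
    by rewrite zero_sum// => e ae; rewrite ae/= ltnn in fk.
  apply: haar_coef_limit_cst => // i; rewrite haar_arg_center.
  apply: locally_cst_frac; rewrite divr_gt0//=.
  rewrite ltr_pdivrMr// mulrC ltr_pdivlMr// -exprSr.
  by rewrite ltr_eXn2l ?ltr1n.
(* the point is a vertex of the finer grid *)
- have [z hz] : exists z : 'I_d -> int, forall i, haar_arg a X i = (z i)%:~R.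
    exists (fun i => 2 ^+ haar_freq a * 10 * kappa ord0 i - haar_shift a ord0 i + 2 ^+ (haar_freq a - k.+1)).
    move=> i; rewrite haar_arg_center [in RHS]intrD; congr (_ + _).
    rewrite rmorphXn/= [_%:~R](_ : _ = 2)// -exprB ?unitfE//.
  have nidx e : a <> center_index k kappa e by move=> ae; rewrite ae/= ltnn in kf.
  apply: (ccvg_eq_lim (a := 0)); last by rewrite zero_sum.
  have mz : haar_mean_zero a by case: sa => // f0; rewrite f0 in kf.
  have [[i hi]|/forallNP h] := pselect (exists i, (z i < 0) || (1 < z i)).
    have lz : locally_zero (haar_arg a X i).
      rewrite hz; apply: locally_zero_out.
      by rewrite ltrz0 ltr1z.
    exact: (haar_coef_limit_zero lp _ lz).
  case: (hblock kf); apply: (haar_block_cube kQ mz) => i.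
  have /negP := h i; rewrite negb_or -!leNgt => /andP[z0 z1].
  have : 0 <= haar_arg a X i <= 1.
    by rewrite hz ler0z z0/= lerz1.
  rewrite /haar_arg mxE mulrDr => /andP[h1 h2].
  have q1 : 2 ^+ haar_freq a / 2 ^+ k.+1 >= 1 :> R.
    by rewrite ler_pdivlMr// mul1r ler_eXn2l// ltr1n.
  (* the displacement of the midpoint from the corner is at most 1/2 *)
  have q2 : 2 * (2 ^+ haar_freq a / 2 ^+ k.+1) <= 2 ^+ haar_freq a :> R.
    rewrite mulrA ler_pdivrMr// mulrC ler_wpM2l ?exprn_ge0// exprS ler_peMr//.
    by rewrite exprn_ege1// ler1n.
  have p2f := p2 (haar_freq a).
  move: h1 h2; set A := 2 ^+ haar_freq a in q1 q2 p2f *.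
  by rewrite ler_pdivlMr// ler_pdivrMr// => h1 h2; split; lra.
have mz : haar_mean_zero a by case: sa => // f0; rewrite f0 in fk; rewrite -fk in k0.
have argE i : haar_arg a X i = (2 ^+ k * 10 * kappa ord0 i - haar_shift a ord0 i)%:~R + 2^-1.
  rewrite haar_arg_center fk; congr (_ + _).
  by rewrite exprS invfM mulrCA mulfV ?mulr1// gt_eqF.
have [h|/existsNP[i hi]] := pselect (forall i, haar_shift a ord0 i = 2 ^+ k * 10 * kappa ord0 i).
  have ae : a = center_index k kappa (haar_eps a).
    case: a fk h {sa hblock zero_sum mz argE} => e f s /= <- h; congr HaarIndex.
    by apply/rowP => i; rewrite mxE h.
  apply: (ccvg_eq_lim (a := central_coef phi0 i0 t (haar_eps a))).
    by apply: haar_coef_limit_mid => // i; rewrite argE h subrr add0r.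
  rewrite (bigD1 (haar_eps a))//= big1 ?addr0 => [|e ee]; last first.
    by rewrite asboolF ?mulr0// => aee; move/eqP: ee; apply; rewrite aee.
  rewrite asboolT// mulr1 /limit_coef ifT//; apply/existsP; exact: mz.
apply: (ccvg_eq_lim (a := 0)); last first.
  by rewrite zero_sum// => e ae; apply: hi; rewrite ae mxE.
have lz : locally_zero (haar_arg a X i).
  rewrite argE; apply: locally_zero_out.
  set z := (_ - _ : int).
  have : z != 0 by rewrite subr_eq0 eq_sym; exact/eqP.
  case: (ltP z 0) => z0 zn; apply/orP; [left|right].
    have : z%:~R <= -1 :> R by rewrite -[-1]/((-1)%:~R) ler_int; lia.
    by lra.
  have : 1 <= z%:~R :> R by rewrite -[1]/(1%:~R) ler_int; lia.
  by lra.
exact: (haar_coef_limit_zero lp _ lz).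
Qed.

End selection.

Section choice_of_N.
Context {R : realType} {d : nat}.
Local Notation E := 'rV[R]_d.
Variables (phi0 : E -> R) (lp : lp_cutoff phi0) (i0 : 'I_d) (t : R).
Local Notation K := (lp_kernel phi0).
Local Notation lcoef := (limit_coef phi0 i0 t).

Lemma center_index_block Q l k kappa (e : {ffun 'I_d -> bool}) : @cube5 R d kappa `<=` @corridor R d Q l ->
  [exists i, e i] -> @haar_block R d Q l k.+1 (center_index k kappa e).
Proof.
move=> kQ /existsP ee; apply: (@haar_block_cube R d Q l kappa (center_index k kappa e) kQ ee) => i; rewrite /=.
have p2 : 0 < (2 : R) ^+ k by rewrite exprn_gt0.
have q2 : 1 <= (2 : R) ^+ k by rewrite exprn_ege1// ler1n.
have -> : ((\row_i0 (2 ^+ k * 10 * kappa ord0 i0)) ord0 i)%:~R = 2 ^+ k * 10 * (kappa ord0 i)%:~R :> R.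
  by rewrite mxE !intrM rmorphXn.
split; first by rewrite ler_pdivlMr// mulrC mulrA.
by rewrite ler_pdivrMr//; lra.
Qed.

Definition point_sequence M (kap : nat -> 'rV[int]_d) (m J : nat) (l : 'I_M) : E :=
  center_point (m - l.+1) (kap l) + (2 ^+ J.+1)^-1 *: (t *: evec i0).

Lemma haar_coef_lp_sum M (x : 'I_M -> E) lam J (a : haar_index d) :
  haar_coef (lp_sum phi0 x lam J) a = lam%:C * \sum_(l < M) haar_coef (fun y => K J (y - x l)) a.
Proof.
have ik l := cintegrable_mul_haar a (cintegrable_translate (x l) (cintegrable_kernel lp J)).
rewrite /haar_coef -(cintegral_sum _ ik) -(cintegralZ _ (cintegrable_sum _ ik)).
by apply: eq_cintegral => y; rewrite /lp_sum -mulrA mulr_suml.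
Qed.

(** N is one more than the largest position of the selected Haar functions.  By the
    order of the blocks no function listed before N lies in a block with index sum
    above m, which is the hypothesis of haar_coef_center.  The sum over n is
    collapsed by injectivity of the enumeration. *)
Lemma partial_sum_selection (u : nat -> haar_index d) : corridor_enumeration R u ->
  exists kap : nat -> 'rV[int]_d, injective kap /\
  forall M m, (0 < M)%N -> (M < m)%N -> exists2 N : nat, (1 <= N)%N &
  forall (F : haar_index d -> R[i]) lam,
  ccvg (fun J => \sum_(n < N) haar_coef (lp_sum phi0 (point_sequence kap m J (M := M)) lam J.+1) (u n) *
     F (u n))
    (lam%:C * \sum_(l < M) \sum_e lcoef e * F (center_index (m - l.+1) (kap l) e)).
Proof.
move=> [[uim uinj usurj] [Q [cQ hQ]]].
have [kap [kinj kQ]] := corridor_sequence cQ; exists kap; split => // M m M0 Mm.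
have /choice[nu hnu] : forall le : 'I_M * {ffun 'I_d -> bool}, exists n,
    [exists i, le.2 i] -> u n = center_index (m - le.1.+1) (kap le.1) le.2.
  move=> [l e]; have [/= ee|_] := boolP [exists i, e i]; last by exists 0%N.
  have /= [|n _ hn] := usurj (center_index (m - l.+1) (kap l) e); last by exists n.
  by left; have /existsP[i ei] := ee; exists i.
pose N := (\max_(le : 'I_M * {ffun 'I_d -> bool} | [exists i, le.2 i]) (nu le).+1)%N.
have ltN (le : 'I_M * {ffun 'I_d -> bool}) : [exists i, le.2 i] -> (nu le < N)%N.
  by move=> h; apply: (@leq_bigmax_cond _ _ (fun le => (nu le).+1)).
have Nlt n : (n < N)%N -> exists2 le : 'I_M * {ffun 'I_d -> bool}, [exists i, le.2 i] & (n <= nu le)%N.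
  move=> nN; apply: contrapT => h; move: nN; rewrite ltnNge => /negP; apply.
  apply/bigmax_leqP => le hle; rewrite ltnNge; apply/negP => h2.
  by apply: h; exists le.
have e0 : [exists i, unit_eps i0 i] by apply/existsP; exists i0; rewrite ffunE.
exists N; first by apply: leq_trans (ltN (Ordinal M0, unit_eps i0) e0).
move=> F lam.
have kpos (l : 'I_M) : (0 < m - l.+1)%N by rewrite subn_gt0 (leq_trans _ Mm)// ltnS.
have nblock (n : 'I_N) (l : 'I_M) : (m - l.+1 < haar_freq (u n))%N ->
    ~ @haar_block R d Q l (haar_freq (u n)).+1 (u n).
  move=> kf hb; have [[l' e'] he' nn] := Nlt n (ltn_ord n).
  have hb' := center_index_block (m - l'.+1) (kQ l') he'.
  rewrite -(hnu (l', e') he') in hb'.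
  have : (nu (l', e') < n)%N.
    apply: (hQ _ _ _ _ _ _ hb' hb); left; have := ltn_ord l'; have := ltn_ord l; lia.
  by rewrite ltnNge nn.
apply: (ccvg_eq_lim (a := \sum_(n < N) (lam%:C * \sum_(l < M) \sum_e lcoef e *
    (`[< u n = center_index (m - l.+1) (kap l) e >])%:R) * F (u n))).
  apply: ccvg_sum => n; apply: ccvgM; last exact: ccvg_cst.
  under eq_fun do rewrite haar_coef_lp_sum.
  apply: ccvgM; first exact: ccvg_cst.
  apply: ccvg_sum => l; apply: (haar_coef_center lp i0 t (kpos l) (kQ l)).
    exact: uim.
  exact: nblock.
under eq_bigr do rewrite -mulrA; rewrite -mulr_sumr; congr (_ * _).
under eq_bigr do rewrite mulr_suml; rewrite exchange_big/=; apply: eq_bigr => l _.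
under eq_bigr do rewrite mulr_suml; rewrite exchange_big/=; apply: eq_bigr => e _.
have [ee|ne] := boolP [exists i, e i]; last first.
  have -> : lcoef e = 0 by rewrite /limit_coef (negbTE ne).
  by rewrite mul0r; apply: big1 => n _; rewrite !mul0r.
have hn := hnu (l, e) ee; rewrite /= in hn.
rewrite (bigD1 (Ordinal (ltN (l, e) ee)))//= big1 ?addr0 => [|n nn]; last first.
  rewrite asboolF ?mulr0 ?mul0r// -hn => unn.
  move/eqP: nn; apply; apply: val_inj => /=.
  by apply: uinj => //; rewrite inE.
by rewrite asboolT ?mulr1 hn.
Qed.

End choice_of_N.

(** * Littlewood-Paley pieces of partial sums *)

Section pieces.
Context {R : realType} {d : nat}.
Local Notation E := 'rV[R]_d.

Lemma cmeas_convol (psi : E -> R) (H : E -> R[i]) : testfun psi -> cintegrable H ->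
  cmeas (convol psi H).
Proof.
move=> tp iH; have [B B0 hB] := bounded_inv_fourier tp.
have [mH iN _] := cintegrable_cdom iH.
have ip := testfun_intR tp.
apply: cmeas_grid_cvg => x.
have [] // := @cintegral_dct R d (fun n w => H w * inv_fourier psi (grid n x - w))
  (fun w => H w * inv_fourier psi (x - w)) (fun w => B * normc (H w)).
- move=> n; split.
  + apply: cmeasM => //; exact: cmeas_reflect (cmeas_inv_fourier ip).
  + exact: intRZ iN.
  + by move=> w; rewrite Normc.normcM mulrC ler_wpM2r ?normc_ge0.
- move=> w; apply: ccvgM; first exact: ccvg_cst.
  apply: inv_fourier_cvg => // i.
  rewrite (_ : (fun n => _) = fun n => grid n x ord0 i - w ord0 i); last first.
    by apply/funext => n; rewrite !mxE.
  rewrite (_ : (x - w) ord0 i = x ord0 i - w ord0 i); last by rewrite !mxE.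
  by apply: cvgB; [exact: grid_cvg_coord|exact: cvg_cst].
Qed.

Variables (phi0 : E -> R) (lp : lp_cutoff phi0).
Local Notation g := (mother phi0).

(** The contribution of the a-th Haar function with coefficient 1, in the
    normalisation of the partial sums. *)
Definition piece_coef (j : nat) (x : E) (a : haar_index d) : R[i] :=
  (2 ^+ (haar_freq a * d))%:C * convol (lp_multiplier phi0 j) (fun y => (haar a y)%:C) x.

Lemma lp_piece_partial_sum u N (f : E -> R[i]) j x :
  lp_piece phi0 (regular_distribution (haar_partial_sum u N f)) j x =
  \sum_(n < N) haar_coef f (u n) * piece_coef j x (u n).
Proof.
have ih (n : 'I_N) := cintegrable_convol x (testfun_multiplier lp j) (cintegrable_haar (u n)).
transitivity (\sum_(n < N) (haar_coef f (u n) * (2 ^+ (haar_freq (u n) * d))%:C) *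
   convol (lp_multiplier phi0 j) (fun y => (haar (u n) y)%:C) x); last first.
  by apply: eq_bigr => n _; rewrite mulrA.
have iz (n : 'I_N) := cintegrableZ (haar_coef f (u n) * (2 ^+ (haar_freq (u n) * d))%:C) (ih n).
transitivity (\sum_(n < N) cintegral (fun y => (haar_coef f (u n) * (2 ^+ (haar_freq (u n) * d))%:C) *
   ((haar (u n) y)%:C * inv_fourier (lp_multiplier phi0 j) (x - y)))); last first.
  by apply: eq_bigr => n _; exact: (cintegralZ _ (ih n)).
rewrite -(cintegral_sum _ iz); apply: eq_cintegral => y.
rewrite /haar_partial_sum mulr_suml; apply: eq_bigr => n _.
by rewrite [_ * cintegral _]mulrC -!mulrA.
Qed.

Lemma cmeas_lp_piece_partial_sum u N (f : E -> R[i]) j :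
  cmeas (lp_piece phi0 (regular_distribution (haar_partial_sum u N f)) j).
Proof.
rewrite (_ : lp_piece phi0 _ j = fun x => \sum_(n < N) haar_coef f (u n) * piece_coef j x (u n)); last first.
  by apply/funext => x; exact: lp_piece_partial_sum.
apply: cmeas_sum => n; apply: cmeasM; first exact: cmeas_cst.
apply: cmeasM; first exact: cmeas_cst.
exact: cmeas_convol (testfun_multiplier lp j) (cintegrable_haar (u n)).
Qed.

Definition cube_center (kappa : 'rV[int]_d) : E := \row_i (10 * (kappa ord0 i)%:~R).

(** Zooming in at the centre of one cube by its own frequency 2^j, the Haar function
    at the centre of another cube, of frequency 2^k, becomes one on the unit cube,
    seen from the rescaled distance of the centres. *)
Lemma rescaled_piece j k kappa kappa' e (y : E) : (0 < j)%N ->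
  ((2 ^+ j) ^- d)%:C * piece_coef j (cube_center kappa + (2 ^+ j)^-1 *: y) (center_index k kappa' e) =
  cintegral (fun w => (haar (root_index e) w)%:C *
    g (y + 2 ^+ j *: (cube_center kappa - cube_center kappa') - (2 ^+ j / 2 ^+ k) *: w)).
Proof.
move=> j0; set x := cube_center kappa + _.
have p2 n : 0 < (2 : R) ^+ n by rewrite exprn_gt0.
have ic := cintegrable_convol x (testfun_multiplier lp j) (cintegrable_haar (center_index k kappa' e)).
have kV : 0 < ((2 : R) ^+ k)^-1 by rewrite invr_gt0.
have [i2 e2] := cintegral_affine (cube_center kappa') kV ic.
have fE w : (haar (center_index k kappa' e) (cube_center kappa' + (2 ^+ k)^-1 *: w))%:C *
    inv_fourier (lp_multiplier phi0 j) (x - (cube_center kappa' + (2 ^+ k)^-1 *: w)) =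
  ((2 ^+ j) ^+ d)%:C * ((haar (root_index e) w)%:C *
    g (y + 2 ^+ j *: (cube_center kappa - cube_center kappa') - (2 ^+ j / 2 ^+ k) *: w)).
  have -> : haar (center_index k kappa' e) (cube_center kappa' + (2 ^+ k)^-1 *: w) = haar (root_index e) w.
    apply: eq_bigr => i _; rewrite /= !mxE !intrM rmorphXn/= expr0 mul1r subr0; congr haar1.
    rewrite mulrDr mulVKf ?gt_eqF// mulrA.
    by rewrite [X in X - _]addrC addrK.
  have -> : inv_fourier (lp_multiplier phi0 j) (x - (cube_center kappa' + (2 ^+ k)^-1 *: w)) =
    ((2 ^+ j) ^+ d)%:C * g (y + 2 ^+ j *: (cube_center kappa - cube_center kappa') - (2 ^+ j / 2 ^+ k) *: w).
    apply: (etrans (lp_kernelE lp _ j0)); apply: (congr1 (fun z => ((2 ^+ j) ^+ d)%:C * g z)).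
    rewrite /x opprD !scalerDr !scalerN !scalerA mulfV ?gt_eqF// scale1r.
    by rewrite addrA; congr (_ - _); rewrite addrAC [LHS]addrC addrA.
  exact: mulrCA.
have i3 : cintegrable (fun w => (haar (root_index e) w)%:C *
    g (y + 2 ^+ j *: (cube_center kappa - cube_center kappa') - (2 ^+ j / 2 ^+ k) *: w)).
  have := cintegrableZ (((2 ^+ j) ^- d)%:C) i2.
  rewrite (_ : (fun w => _) = fun w => (haar (root_index e) w)%:C *
    g (y + 2 ^+ j *: (cube_center kappa - cube_center kappa') - (2 ^+ j / 2 ^+ k) *: w)) //.
  apply/funext => w; rewrite fE mulrA -rmorphM/= mulVf; last by rewrite gt_eqF// exprn_gt0.
  by rewrite mul1r.
have e4 := etrans e2 (congr1 ( *%R _) (etrans (eq_cintegral fE) (cintegralZ _ i3))).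
apply: (etrans (congr1 (fun z => ((2 ^+ j) ^- d)%:C * ((2 ^+ (k * d))%:C * z)) e4)).
move: (cintegral _) => I; rewrite !mulrA -!rmorphM.
rewrite [X in X%:C * _](_ : _ = 1); first exact: mul1r.
have -> : (2 ^- k ^+ d : R) = (2 ^+ k ^+ d)^-1 by rewrite exprVn.
rewrite exprM -mulrA [_ * ((2 ^+ j) ^+ d)]mulrC.
rewrite mulrACA mulVf ?mul1r ?mulfV// expf_neq0// gt_eqF//.
Qed.

End pieces.

Section piece_limits.
Context {R : realType} {d : nat}.
Local Notation E := 'rV[R]_d.
Variables (phi0 : E -> R) (lp : lp_cutoff phi0).
Local Notation g := (mother phi0).

(** One coordinate of size 2^i suffices, by the bound with the weight. *)
Lemma mother_far (v : nat -> E) (a : 'I_d) :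
  (\forall i \near \oo, 2 ^+ i <= `|v i ord0 a|) -> ccvg (fun i => g (v i)) 0.
Proof.
move=> hv; have [C C0 [_ _ bg]] := cdom_decay (testfun_annulus lp).
apply: ccvg0_normc.
apply: (@squeeze_cvgr _ _ _ _ (cst 0) (fun i : nat => C * (2 ^+ i)^-1)); last 2 first.
- exact: cvg_cst.
- rewrite -[X in _ --> X](mulr0 C); apply: cvgM; [exact: cvg_cst|exact: cvg_inv2n].
move: hv; apply: filterS => i hi; rewrite normc_ge0/=.
apply: (le_trans (bg _)); rewrite ler_wpM2l//; apply: (le_trans (weight_coord _ a)).
have p2 : 1 <= (2 : R) ^+ i by rewrite exprn_ege1// ler1n.
have q2 : 0 < 1 + v i ord0 a ^+ 2 by rewrite ltr_pwDl// sqr_ge0.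
rewrite lef_pV2 ?posrE ?exprn_gt0//.
rewrite -(real_normK (num_real (v i ord0 a))).
move: hi; set c := `|_| => hi.
have c1 : 1 <= c := le_trans p2 hi.
have h1 : 2 ^+ i * 1 <= c * c by apply: ler_pM => //; rewrite exprn_ge0.
by rewrite expr2; lra.
Qed.

(** Centres of different cubes differ by at least 10 in some coordinate, and the
    zoom by 2^j sends this distance to infinity while the frequencies stay
    comparable. *)
Lemma far_piece kappa kappa' (j k : nat -> nat) (B : R) e (y : E) : kappa <> kappa' ->
  (forall i, (i <= j i)%N) -> (forall i, 2 ^+ j i / 2 ^+ k i <= B) ->
  ccvg (fun i => cintegral (fun w => (haar (root_index e) w)%:C *
    g (y + 2 ^+ j i *: (cube_center kappa - cube_center kappa') - (2 ^+ j i / 2 ^+ k i) *: w))) 0.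
Proof.
move=> kk hj hB.
have [a ka] : exists a, kappa ord0 a != kappa' ord0 a.
  apply: contrapT => /forallNP h; apply: kk; apply/rowP => a.
  by apply/eqP/negPn/negP; exact: h.
have tp := testfun_annulus lp.
have [Mg M0 hM] := bounded_inv_fourier tp.
have mg := cmeas_inv_fourier (testfun_intR tp).
have [mh iN _] := cintegrable_cdom (cintegrable_haar (R := R) (root_index e)).
(* the argument of the kernel; its coordinate a is at least 10 * 2^j - O(1) *)
pose v i w : E := y + 2 ^+ j i *: (cube_center kappa - cube_center kappa') - (2 ^+ j i / 2 ^+ k i) *: w.
have [] := @cintegral_dct R d (fun i w => (haar (root_index e) w)%:C * g (v i w))
   (fun w => (haar (root_index e) w)%:C * 0) (fun w => Mg * normc (haar (root_index e) w)%:C).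
- move=> i; split.
  + apply: cmeasM; first exact: mh.
    have := cmeas_comp mg (@measurable_rV_affine R d
      (y + 2 ^+ j i *: (cube_center kappa - cube_center kappa')) (- (2 ^+ j i / 2 ^+ k i))).
    congr cmeas; apply/funext => w; apply: (congr1 g).
    by rewrite /v scaleNr.
  + exact: intRZ iN.
  + by move=> w; rewrite Normc.normcM mulrC ler_wpM2r ?normc_ge0//; exact: hM.
- move=> w; apply: ccvgM; first exact: ccvg_cst.
  apply: (mother_far (a := a)).
  have := pow2_growth (`|y ord0 a| + B * `|w ord0 a|); apply: filterS => i hi.
  have h2 : 2 ^+ i <= (2 : R) ^+ j i by rewrite ler_weXn2l// ?ler1n.
  have r0 : 0 <= (2 : R) ^+ j i / 2 ^+ k i by rewrite divr_ge0// exprn_ge0.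
  have h3 : 1 <= `|(kappa ord0 a - kappa' ord0 a)%:~R| :> R.
    rewrite -intr_norm -[leLHS]/(1%:~R) ler_int; move: ka; rewrite -subr_eq0.
    by rewrite -normr_gt0; lia.
  have h4 : `|(2 ^+ j i / 2 ^+ k i) * w ord0 a| <= B * `|w ord0 a|.
    by rewrite normrM (ger0_norm r0) ler_wpM2r.
  rewrite /v !mxE -mulrBr -intrB.
  set D := (_%:~R : R) in h3 *; set r := (_ / _) in h4 *; set A := 2 ^+ j i in h2 *.
  have A0 : 0 < A by rewrite exprn_gt0.
  have h5 : 10 * A <= `|A * (10 * D)|.
    by rewrite !normrM (gtr0_norm A0) (@ger0_norm _ 10)//; nra.
  have h6 : `|A * (10 * D)| <= `|y ord0 a + A * (10 * D) - r * w ord0 a| + `|y ord0 a| + `|r * w ord0 a|.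
    have -> : A * (10 * D) = (y ord0 a + A * (10 * D) - r * w ord0 a) + (- y ord0 a) + r * w ord0 a by ring.
    apply: (le_trans (ler_normD _ _)); rewrite lerD2r (le_trans (ler_normD _ _))// normrN.
    by rewrite [_ + - y ord0 a + _](_ : _ = A * (10 * D)) //; ring.
  by lra.
move=> _; rewrite (_ : cintegral _ = 0)//.
rewrite -[RHS](@cintegral_cst0 R d); apply: eq_cintegral => w.
exact: mulr0.
Qed.

Variables (i0 : 'I_d) (t : R) (kap : nat -> 'rV[int]_d) (kinj : injective kap).
Local Notation lcoef := (limit_coef phi0 i0 t).
Variables (M : nat) (l : 'I_M).

Let jm (i : nat) (l' : 'I_M) := (M.+1 + i - l'.+1)%N.

(** The term of the cube at which one zooms in does not depend on i; the terms of
    the other cubes tend to 0. *)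
Lemma piece_limit (y : E) :
  ccvg (fun i => ((2 ^+ jm i l) ^- d)%:C * \sum_(l' < M) \sum_e lcoef e *
     piece_coef phi0 (jm i l) (cube_center (kap l) + (2 ^+ jm i l)^-1 *: y)
       (center_index (jm i l') (kap l') e))
   (limit_piece phi0 i0 t y).
Proof.
have j0 i (l' : 'I_M) : (0 < jm i l')%N by rewrite /jm; have := ltn_ord l'; lia.
pose T (l' : 'I_M) e i := cintegral (fun w : E => (haar (root_index e) w)%:C *
    g (y + 2 ^+ jm i l *: (cube_center (kap l) - cube_center (kap l')) - (2 ^+ jm i l / 2 ^+ jm i l') *: w)).
rewrite (_ : (fun i => _) = fun i => \sum_(l' < M) \sum_e lcoef e * T l' e i); last first.
  apply/funext => i; rewrite mulr_sumr; apply: eq_bigr => l' _.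
  rewrite mulr_sumr; apply: eq_bigr => e _; rewrite mulrCA; congr (_ * _).
  exact: rescaled_piece.
have -> : limit_piece phi0 i0 t y = \sum_(l' < M) \sum_e lcoef e *
   (if l' == l then cintegral (fun w => (haar (root_index e) w)%:C * g (y - w)) else 0).
  rewrite (bigD1 l)//= [X in _ + X]big1 ?addr0; last first.
    by move=> l' ll; rewrite (negbTE ll); apply: big1 => e _; exact: mulr0.
  rewrite eqxx /limit_piece /convol.
  have ih e := cintegrable_convol y (testfun_annulus lp) (cintegrable_haar (R := R) (root_index e)).
  transitivity (cintegral (fun w => \sum_e lcoef e * ((haar (root_index e) w)%:C * g (y - w)))).
    by apply: eq_cintegral => w; rewrite mulr_suml; apply: eq_bigr => e _; rewrite mulrA.
  rewrite cintegral_sum; last by move=> e; apply: cintegrableZ; exact: ih.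
  by apply: eq_bigr => e _; exact: (cintegralZ _ (ih e)).
apply: ccvg_sum => l'; apply: ccvg_sum => e; apply: ccvgM; first exact: ccvg_cst.
have [->|ll] := eqVneq l' l.
  rewrite (_ : T l e = fun=> cintegral (fun w => (haar (root_index e) w)%:C * g (y - w))).
    exact: ccvg_cst.
  apply/funext => i; apply: eq_cintegral => w.
  by rewrite subrr scaler0 addr0 mulfV ?scale1r// gt_eqF// exprn_gt0.
have nk : kap l <> kap l' by move/kinj/val_inj => h; rewrite h eqxx in ll.
apply: (far_piece (B := 2 ^+ M) e y nk).
  by move=> i; rewrite /jm; have := ltn_ord l; lia.
move=> i; rewrite ler_pdivrMr ?exprn_gt0// -exprD ler_weXn2l ?ler1n//.
by rewrite /jm; have := ltn_ord l'; lia.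
Qed.

End piece_limits.

(** * The lower bound *)

Section fatou_pint.
Context {R : realType} {d : nat}.
Local Notation E := 'rV[R]_d.
Local Notation mu := (@lebesgue_rV R d).
Variables (p : R).
Hypotheses (p0 : 0 < p).

(** At the limit 0 the logarithm is not available, and the estimate is made
    directly. *)
Lemma cvg_powR_ge0 (u : nat -> R) (l : R) : (forall n, 0 <= u n) -> u @ \oo --> l ->
  (fun n => u n `^ p) @ \oo --> l `^ p.
Proof.
move=> u0 ul; have l0 : 0 <= l by rewrite -(cvg_lim _ ul)//; apply: limr_ge;
   [apply/cvg_ex; exists l|exact: nearW].
have [le0|ln0] := eqVneq l 0.
  rewrite le0 powR0 ?gt_eqF//; apply/cvgrPdist_lt => e e0.
  have e1 : 0 < e `^ p^-1 by rewrite powR_gt0.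
  have /cvgrPdist_lt/(_ _ e1) := ul; apply: filterS => n.
  rewrite le0 !sub0r !normrN !ger0_norm ?powR_ge0// => h.
  have -> : e = (e `^ p^-1) `^ p by rewrite -powRrM mulVf ?gt_eqF// powRr1// ltW.
  by apply: gt0_ltr_powR; rewrite ?nnegrE// powR_ge0.
have lp : 0 < l by rewrite lt_neqAle eq_sym ln0.
rewrite /powR (negbTE ln0).
have h : (fun n => expR (p * ln (u n))) @ \oo --> expR (p * ln l).
  apply: continuous_cvg; first exact: continuous_expR.
  apply: cvgM; first exact: cvg_cst.
  by apply: continuous_cvg => //; exact: continuous_ln.
apply: cvg_trans h; apply: near_eq_cvg.
near=> n; rewrite gt_eqF//; near: n; exact: (cvgr_gt _ ul _ lp).
Unshelve. all: by end_near.
Qed.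

(** Fatou's lemma as a lower semicontinuity: every number below the integral of the
    limit is eventually below the integrals. *)
Lemma pint_fatou (F : nat -> E -> R) (G : E -> R) (gam : R) :
  (forall n, measurable_fun setT (F n)) -> (forall n x, 0 <= F n x) ->
  (forall x, (fun n => F n x) @ \oo --> G x) -> (gam%:E < pint p G)%E ->
  \forall n \near \oo, (gam%:E < pint p (F n))%E.
Proof.
move=> mF F0 FG; rewrite {1}/pint.
have -> : (\int[mu]_x (G x `^ p)%:E = \int[mu]_x limn_einf (fun n => (F n x `^ p)%:E))%E.
  apply: eq_integral => x _; apply/esym.
  have h : (fun n => (F n x `^ p)%:E) @ \oo --> (G x `^ p)%:E.
    by apply: cvg_EFin; [exact: nearW|exact: cvg_powR_ge0].
  rewrite is_cvg_limn_einfE; first exact/cvg_lim.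
  by apply/cvg_ex; exists (G x `^ p)%:E.
move=> h.
have : (gam%:E < limn_einf (fun n => pint p (F n)))%E.
  apply: (lt_le_trans h); apply: fatou => //.
    by move=> n; exact: measurable_powR_comp.
  by move=> n x _; rewrite lee_fin powR_ge0.
have hc := @cvg_einfs_sup R (fun n => pint p (F n)).
rewrite limn_einf_lim (cvg_lim _ hc)// => /ereal_sup_gt[_ [n _ <-] hn].
exists n => // k /= nk; apply: (lt_le_trans hn).
by apply: ereal_inf_lbound; exists k.
Qed.

End fatou_pint.

Section norm_from_terms.
Context {R : realType} {d : nat}.
Local Notation E := 'rV[R]_d.
Variables (phi0 : E -> R) (p q : R).
Hypotheses (q0 : 0 < q).

Lemma besov_norm_lower (T : (E -> R[i]) -> R[i]) M m (b : R) : (M < m)%N -> 0 <= b ->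
  (forall l : 'I_M, (b%:E <= besov_term phi0 p T (m - l.+1))%E) ->
  ((M%:R `^ q^-1 * b)%:E <= besov_norm phi0 (d%:R * (p^-1 - 1)) p q T)%E.
Proof.
move=> Mm b0 hb; rewrite besov_normE.
have h : ((M%:R * b `^ q)%:E <= \sum_(0 <= j <oo) (besov_term phi0 p T j `^ q))%E.
  apply: (@le_trans _ _ (\sum_(0 <= j < m) (besov_term phi0 p T j `^ q))%E); last first.
    by apply: nneseries_lim_ge => j _ _; exact: poweR_ge0.
  have lt_m (l : 'I_M) : (m - l.+1 < m)%N by have := ltn_ord l; lia.
  pose h (l : 'I_M) : 'I_m := Ordinal (lt_m l).
  have hinj : {in [set: 'I_M]%SET &, injective h}.
    move=> l l' _ _ /(congr1 val)/= e; apply: val_inj => /=.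
    by have := ltn_ord l; have := ltn_ord l'; lia.
  pose A : {set 'I_m} := [set h l | l in [set: 'I_M]%SET]%SET.
  rewrite big_mkord.
  apply: (@le_trans _ _ (\sum_(j in A) (besov_term phi0 p T j `^ q))%E); last first.
    by apply: lee_sum_nneg_subset => // j _; exact: poweR_ge0.
  rewrite big_imset//=.
  apply: (@le_trans _ _ (\sum_(l in [set: 'I_M]%SET) (b `^ q)%:E)%E).
    by rewrite sumEFin sumr_const cardsT card_ord mulr_natl.
  apply: lee_sum => l _; rewrite -poweR_EFin; apply: gt0_ler_poweR => //; first exact: ltW.
  - by rewrite in_itv/= leey lee_fin b0.
  - by rewrite in_itv/= leey besov_term_ge0.
apply: (@le_trans _ _ ((M%:R * b `^ q)%:E `^ q^-1)%E).
  rewrite poweR_EFin lee_fin powRM ?powR_ge0// -powRrM mulfV ?gt_eqF// powRr1//.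
apply: gt0_ler_poweR => //; first by rewrite invr_ge0 ltW.
- by rewrite in_itv/= leey lee_fin mulr_ge0// powR_ge0.
- rewrite in_itv/= leey andbT; apply: nneseries_ge0 => j _ _; exact: poweR_ge0.
Qed.

End norm_from_terms.

Section lower.
Context {R : realType} {d : nat}.
Local Notation E := 'rV[R]_d.
Variables (phi0 : E -> R) (lp : lp_cutoff phi0) (p : R).
Hypotheses (p0 : 0 < p).
Variables (i0 : 'I_d) (t gam : R).
Local Notation lcoef := (limit_coef phi0 i0 t).
Local Notation profile := (limit_piece phi0 i0 t).
Hypothesis gamP : (gam%:E < pint p (fun y => normc (profile y)))%E.

Lemma normc_realM (c : R) (z : R[i]) : 0 <= c -> normc (c%:C * z) = c * normc z.
Proof. by move=> c0; rewrite Normc.normcM normc_real ger0_norm. Qed.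

Lemma cmeas_piece_coef j a : cmeas (fun x => piece_coef phi0 j x a).
Proof.
apply: cmeasM; first exact: cmeas_cst.
exact: cmeas_convol (testfun_multiplier lp j) (cintegrable_haar a).
Qed.

Lemma cmeas_affine (f : E -> R[i]) (a : E) (c : R) : cmeas f -> cmeas (fun y : E => f (a + c *: y)).
Proof. by move=> mf; exact: (cmeas_comp mf (measurable_rV_affine a c)). Qed.

(** Two limits are taken one after the other: first m tends to infinity in the
    limiting combination of Haar functions, which fixes m and N, and then J tends to
    infinity in the partial sum of length N. *)
Lemma besov_terms_lower (u : nat -> haar_index d) M lam :
  corridor_enumeration R u -> (0 < M)%N -> 0 < lam -> 0 <= gam ->
  exists m N J (x : 'I_M -> E), [/\ (M < m)%N, (1 <= N)%N, (2 <= J)%N &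
    forall l : 'I_M, ((lam * gam `^ p^-1)%:E <=
      besov_term phi0 p (regular_distribution (haar_partial_sum u N (lp_sum phi0 x lam J))) (m - l.+1))%E].
Proof.
move=> hu M0 lam0 gam0.
have [kap [kinj hsel]] := partial_sum_selection lp i0 t hu.
(* the rescaled piece at the l-th cube of the limiting combination, m = M + 1 + i *)
pose G i (l : 'I_M) (y : E) : R[i] := ((2 ^+ (M.+1 + i - l.+1)) ^- d)%:C *
  \sum_(l' < M) \sum_e lcoef e * piece_coef phi0 (M.+1 + i - l.+1)
    (cube_center (kap l) + (2 ^+ (M.+1 + i - l.+1))^-1 *: y) (center_index (M.+1 + i - l'.+1) (kap l') e).
have mG i l : measurable_fun setT (fun y => normc (G i l y)).
  apply: cmeas_normc; apply: cmeasM; first exact: cmeas_cst.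
  apply: cmeas_sum => l'; apply: cmeas_sum => e; apply: cmeasM; first exact: cmeas_cst.
  exact: cmeas_affine (cmeas_piece_coef _ _).
have h1 : \forall i \near \oo, forall l, (gam%:E < pint p (fun y => normc (G i l y)))%E.
  apply: filter_forall => l.
  apply: (pint_fatou p0 (F := fun i y => normc (G i l y)) (fun i => mG i l) _ _ gamP).
    by move=> i y; exact: normc_ge0.
  by move=> y; apply: ccvg_normc; exact: piece_limit.
have [i _ /(_ i (leqnn i)) hi] := h1.
set m := (M.+1 + i)%N in hi *.
have Mm : (M < m)%N by rewrite /m; lia.
have [N N1 hN] := hsel M m M0 Mm.
pose S J := haar_partial_sum u N (lp_sum phi0 (point_sequence i0 t kap m J (M := M)) lam J.+1).
pose P J (l : 'I_M) (y : E) : R := (2 ^+ (m - l.+1)) ^- d *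
  normc (lp_piece phi0 (regular_distribution (S J)) (m - l.+1)
    (cube_center (kap l) + (2 ^+ (m - l.+1))^-1 *: y)).
have c_ge0 (l : 'I_M) : 0 <= (2 ^+ (m - l.+1)) ^- d :> R by rewrite invr_ge0 !exprn_ge0.
have mP J l : measurable_fun setT (P J l).
  apply: measurable_funM; first exact: measurable_cst.
  apply: cmeas_normc; apply: cmeas_affine; exact: cmeas_lp_piece_partial_sum.
have P_ge0 J l y : 0 <= P J l y by rewrite mulr_ge0// normc_ge0.
have h2 : \forall J \near \oo, forall l, ((lam `^ p * gam)%:E < pint p (P J l))%E.
  apply: filter_forall => l.
  apply: (pint_fatou p0 (F := fun J => P J l) (G := fun y => lam * normc (G i l y)) (fun J => mP J l) _ _ _).
  - by move=> J y; exact: P_ge0.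
  - move=> y; rewrite /P.
    have hc := hN (piece_coef phi0 (m - l.+1) (cube_center (kap l) + (2 ^+ (m - l.+1))^-1 *: y)) lam.
    rewrite [X in _ --> X](_ : _ = (2 ^+ (m - l.+1)) ^- d * normc (lam%:C *
      \sum_(l' < M) \sum_e lcoef e * piece_coef phi0 (m - l.+1)
        (cube_center (kap l) + (2 ^+ (m - l.+1))^-1 *: y) (center_index (m - l'.+1) (kap l') e))).
      apply: cvgM; first exact: cvg_cst.
      rewrite (_ : (fun J => _) = fun J => normc (\sum_(n < N)
         haar_coef (lp_sum phi0 (point_sequence i0 t kap m J (M := M)) lam J.+1) (u n) *
         piece_coef phi0 (m - l.+1) (cube_center (kap l) + (2 ^+ (m - l.+1))^-1 *: y) (u n))).
        exact: ccvg_normc hc.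
      apply/funext => J; congr normc; exact: lp_piece_partial_sum.
    by rewrite /G -/m !normc_realM ?(ltW lam0)// mulrCA.
  - rewrite (pint_scale p (ltW lam0) (fun y => normc_ge0 _) (mG i l)) EFinM.
    rewrite lte_pmul2l; [exact: hi|by []|by rewrite lte_fin powR_gt0].
have [J [/= J1 hJ]] : exists J, (1 <= J)%N /\ forall l, ((lam `^ p * gam)%:E < pint p (P J l))%E.
  have [n _ hn] := h2; exists n.+1; split; [exact: isT|apply: hn; exact: leqnSn].
exists m, N, J.+1, (point_sequence i0 t kap m J (M := M)); split => // l.
rewrite /besov_term (critical_Lnorm p0 (cube_center (kap l)) (m - l.+1)); last 2 first.
- by move=> x; exact: normc_ge0.
- apply: cmeas_normc; exact: cmeas_lp_piece_partial_sum.
have -> : (lam * gam `^ p^-1)%:E = ((lam `^ p * gam)%:E `^ p^-1)%E.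
  by rewrite poweR_EFin powRM ?powR_ge0// -powRrM mulfV ?gt_eqF// powRr1// ltW.
apply: gt0_ler_poweR; first by rewrite invr_ge0 ltW.
- by rewrite in_itv/= leey andbT lee_fin mulr_ge0// powR_ge0.
- by rewrite in_itv/= leey andbT pint_ge0.
- exact: ltW (hJ l).
Qed.

End lower.

Theorem proposition12p1 (R : realType) (d : nat) (hd : (1 <= d)%N)
    (p q : R) (hq : 0 < q) (hqp : q < p) (hp : p <= 1)
    (phi0 : 'rV[R]_d -> R) (hphi0 : lp_cutoff phi0)
    (u : nat -> haar_index d) (hu : corridor_enumeration R u) :
  let s := d%:R * (p^-1 - 1) in
  ereal_sup [set ereal_sup
      [set besov_norm phi0 s p q
             (regular_distribution (haar_partial_sum u N f)) |
       f in besov_unit_ball_L1 phi0 s p q] |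
     N in [set N : nat | (1 <= N)%N]] = +oo%E.
Proof.
move=> s; have p0 : 0 < p := lt_trans hq hqp.
have c0 := cst_inv_neq0 hd hphi0.
have [t ht] := central_coef_unit_neq0 hphi0 (Ordinal hd) c0.
have := @limit_piece_gt0 R d phi0 hphi0 (Ordinal hd) t p c0 ht.
set I := pint p _ => I0.
have [gam gam0 gamI] : exists2 gam : R, 0 < gam & (gam%:E < I)%E.
  case: I I0 => [r| |]//; last by exists 1 => //; exact: ltry.
  rewrite lte_fin => r0; exists (r / 2); first by rewrite divr_gt0.
  by rewrite lte_fin; lra.
have [D D0 hD] := besov_upper hphi0 p0 hp hq.
apply/eqyP => A A0.
(* the exponent by which the norm of the partial sum exceeds that of f *)
pose r := q^-1 - p^-1.
have r0 : 0 < r by rewrite subr_gt0 ltf_pV2.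
pose c := gam `^ p^-1 / D.
have cp : 0 < c by rewrite divr_gt0// powR_gt0.
pose M := (Num.truncn ((A / c) `^ r^-1)).+1.
have hM : A <= M%:R `^ r * c.
  rewrite -ler_pdivrMr//.
  have -> : A / c = ((A / c) `^ r^-1) `^ r.
    by rewrite -powRrM mulVf ?gt_eqF// powRr1// divr_ge0 ?ltW.
  by apply: ge0_ler_powR; rewrite ?nnegrE ?powR_ge0 ?ltW// truncnS_gt.
have M0 : 0 < M%:R `^ p^-1 :> R by rewrite powR_gt0.
pose lam := (D * M%:R `^ p^-1)^-1.
have lam0 : 0 < lam by rewrite invr_gt0 mulr_gt0.
have [m [N [J [x [Mm N1 J2 hb]]]]] :=
  besov_terms_lower hphi0 p0 gamI hu (ltn0Sn _ : (0 < M)%N) lam0 (ltW gam0).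
pose f := lp_sum phi0 x lam J.
have fi : cintegrable f := cintegrable_lp_sum hphi0 x lam J.
have fB : besov_unit_ball_L1 phi0 s p q f.
  split; [exact: fi|split; first exact: tempered_regular fi].
  apply: (le_trans (hD M x lam J (ltW lam0) J2)).
  by rewrite lee_fin -mulrA mulVf ?gt_eqF// mulr_gt0.
apply: (@le_trans _ _ (besov_norm phi0 s p q (regular_distribution (haar_partial_sum u N f)))).
  apply: le_trans (besov_norm_lower hq Mm _ hb); last by rewrite mulr_ge0 ?powR_ge0// ltW.
  rewrite lee_fin; apply: (le_trans hM); rewrite /c /lam /r powRD; last first.
    by apply/implyP => _; rewrite gt_eqF.
  rewrite powRN invfM le_eqVlt; apply/orP; left; apply/eqP; ring.
apply: (@le_trans _ _ (ereal_sup [set besov_norm phi0 s p q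
    (regular_distribution (haar_partial_sum u N f)) | f in besov_unit_ball_L1 phi0 s p q])).
  by apply: ereal_sup_ubound; exists f.
by apply: ereal_sup_ubound; exists N.
Qed.
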